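(* Suppose that $M$ is symmetric with respect to the origin $0_d$ (i.e. $-M=M$), that $\mu$ is invariant with respect to the reflection $x\mapsto -x$, and that $X$ and $Y$ have the same distribution $F$. Then, as $m,n\to\infty$ in such a way that $\frac{m}{m+n}\to\tau$ for some $\tau\in[0,1]$, the bootstrap distribution of $T_{n,m}$ converges weakly, $\mathbb{P}$-almost surely, to the distribution of $\|W\|_{\mathbb{H}}^2$, where $W$ is a centred Gaussian random element of $\mathbb{H}=L^2(M,\mathcal{B}(M),\mu)$ with covariance kernel $K(s,t)=\mathrm{Cov}\big(\mathrm{CS}(s^\top X),\mathrm{CS}(t^\top X)\big)$, $s,t\in M$.
   Context: Let $d\ge 2$, let $M\subset\mathbb{R}^d$ be a nonempty Borel set, and let $\mu$ be a finite measure on the Borel subsets $\mathcal{B}(M)$ of $M$. Let $X,X_1,X_2,\ldots$ and $Y,Y_1,Y_2,\ldots$ be independent $M$-valued random vectors defined on a common probability space $(\Omega,\mathcal{A},\mathbb{P})$, where $X,X_1,X_2,\ldots$ are i.i.d. with a density with respect to $\mu$, and $Y,Y_1,Y_2,\ldots$ are i.i.d. with a density with respect to $\mu$. For points $x_1,\ldots,x_n,y_1,\ldots,y_m\in M$ put $$T_{n,m}(x_1,\ldots,x_n,y_1,\ldots,y_m)=\frac{nm}{n+m}\int_M\left|\frac1n\sum_{j=1}^n e^{\mathrm{i}t^\top x_j}-\frac1m\sum_{k=1}^m e^{\mathrm{i}t^\top y_k}\right|^2\mu(\mathrm{d}t).$$ Let $F_n$ and $G_m$ be the empirical distributions of $X_1,\ldots,X_n$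 and $Y_1,\ldots,Y_m$, and let $H_{n,m}=\frac{n}{m+n}F_n+\frac{m}{m+n}G_m$ be the empirical distribution of the pooled sample. The bootstrap distribution of $T_{n,m}$ is the conditional distribution, given the pooled sample $X_1,\ldots,X_n,Y_1,\ldots,Y_m$, of $T_{n,m}(X_1^{m,n},\ldots,X_n^{m,n},Y_1^{m,n},\ldots,Y_m^{m,n})$, where, conditionally on the pooled sample, $X_1^{m,n},\ldots,X_n^{m,n},Y_1^{m,n},\ldots,Y_m^{m,n}$ are i.i.d. with distribution $H_{n,m}$. Write $\mathrm{CS}(\xi)=\cos\xi+\sin\xi$, $\xi\in\mathbb{R}$. $\mathbb{H}=L^2(M,\mathcal{B}(M),\mu)$ is the separable Hilbert space of (classes of) real measurable functions $u$ on $M$ with $\int_M u^2\,\mathrm{d}\mu<\infty$, with inner product $\langle u,v\rangle=\int_M uv\,\mathrm{d}\mu$ and norm $\|u\|_{\mathbb{H}}=\langle u,u\rangle^{1/2}$. That $W$ has covariance kernel $K$ means that, for each $h\in\mathbb{H}$, $\langle W,h\rangle$ is normal with mean $0$ and variance $\int_M\int_M K(s,t)h(s)h(t)\,\mu(\mathrm{d}s)\mu(\mathrm{d}t)$. *)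

(* Defs.v *)
From HB Require Import structures.
From mathcomp Require Import all_boot all_order all_algebra finmap complex.
From mathcomp Require Import all_classical all_reals all_analysis measurable_realfun lra.

Set Implicit Arguments.
Unset Strict Implicit.
Unset Printing Implicit Defensive.

Import Order.TTheory GRing.Theory Num.Theory.
Import numFieldNormedType.Exports.

Local Open Scope classical_set_scope.
Local Open Scope ring_scope.

(* 'rV[R]_d, the type of vectors of R^d, gets its Borel sigma-algebra. *)
Section borel_rV.
Context (R : realType) (d : nat).

HB.instance Definition _ := @isMeasurable.Build (sigma_display (@open 'rV[R]_d))
  'rV[R]_d <<s @open 'rV[R]_d >>
  (@sigma_algebra0 _ setT (@open 'rV[R]_d)) (@sigma_algebraC _ (@open 'rV[R]_d))
  (@sigma_algebra_bigcup _ setT (@open 'rV[R]_d)).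

Lemma measurable_coord (i : 'I_d) :
  measurable_fun [set: 'rV[R]_d] (fun x : 'rV[R]_d => x 0 i).
Proof.
apply: (measurability _ (RGenOInfty.measurableE R)) => _ [_ [a ->] <-].
rewrite setTI; apply: sub_sigma_algebra.
apply: open_comp; last exact: interval_open.
by move=> x _; exact: coord_continuous.
Qed.

Definition dotp (s t : 'rV[R]_d) : R := \sum_(i < d) s 0 i * t 0 i.

Lemma measurable_dotp dZ (Z : measurableType dZ) (f g : Z -> 'rV[R]_d) :
  measurable_fun setT f -> measurable_fun setT g ->
  measurable_fun setT (fun z => dotp (f z) (g z)).
Proof.
move=> mf mg; apply: measurable_sum => i.
by apply: measurable_funM; apply: (measurableT_comp (measurable_coord i)).
Qed.

End borel_rV.

Section probability_notions.
Context (R : realType).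

Definition mutually_independent dO dE (Omega : measurableType dO)
    (E : measurableType dE) (P : probability Omega R) (I : choiceType)
    (Z : I -> Omega -> E) :=
  forall (J : {fset I}) (A : I -> set E), (forall i, measurable (A i)) ->
  P (\bigcap_(i in [set` J]) Z i @^-1` A i) =
    (\prod_(i <- J) P (Z i @^-1` A i))%E.

Definition same_distribution dO dE (Omega : measurableType dO)
    (E : measurableType dE) (P : probability Omega R) (Z Z' : {RV P >-> E}) :=
  forall A, measurable A -> distribution P Z A = distribution P Z' A.

Definition has_density dO dE (Omega : measurableType dO) (E : measurableType dE)
    (P : probability Omega R) (mu : {measure set E -> \bar R})
    (Z : {RV P >-> E}) :=
  exists f : E -> R, [/\ measurable_fun setT f, (forall x, 0 <= f x) &
    forall A, measurable A ->
      distribution P Z A = (\int[mu]_(x in A) (f x)%:E)%E].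

Definition weakly_converges (nu_ : nat -> probability R R)
    (nu : probability R R) :=
  forall f : R -> R, continuous f -> (exists C : R, forall x, `|f x| <= C) ->
  \int[nu_ k]_x f x @[k --> \oo] --> \int[nu]_x f x.

(* The case v = 0 is separate because normal_prob 0 0 is not a point mass. *)
Definition centred_normal (v : R) (A : set R) : \bar R :=
  if v == 0 then \d_(0 : R) A else normal_prob 0 (Num.sqrt v) A.

End probability_notions.

Section iid_samples.
Context (R : realType) dE (E : measurableType dE).

Definition cons_pair n (p : E * n.-tuple E) : n.+1.-tuple E :=
  [the n.+1.-tuple E of p.1 :: p.2].

Let measurable_cons_pair n : measurable_fun setT (@cons_pair n).
Proof. exact: measurable_cons. Qed.

HB.instance Definition _ n := @isMeasurableFun.Build _ _ _ _ (@cons_pair n)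
  (@measurable_cons_pair n).

(* The n-fold product measure of P. *)
Fixpoint iid_law (P : probability E R) n : probability (n.-tuple E) R :=
  match n with
  | 0 => \d_([tuple] : 0.-tuple E)
  | k.+1 => distribution (P \x iid_law P k)%E (@cons_pair k)
  end.

Definition empirical (x : nat -> E) (n : nat) : {measure set E -> \bar R} :=
  mscale (n%:R^-1)%:nng (msum (fun j => \d_(x j)) n).

Definition pooled_empirical_raw (x y : nat -> E) (n m : nat) :
    {measure set E -> \bar R} :=
  measure_add (mscale (n%:R / (m + n)%:R)%:nng (empirical x n))
              (mscale (m%:R / (m + n)%:R)%:nng (empirical y m)).

(* mnormalize makes this a probability measure also when n = m = 0; for n, m > 0
   it changes nothing, see pooled_empiricalE. *)
Definition pooled_empirical (x y : nat -> E) (n m : nat) : probability E R :=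
  mnormalize (pooled_empirical_raw x y n m) (\d_(x 0)).

Lemma empirical_setT x n : (0 < n)%N -> empirical x n setT = 1%E.
Proof.
move=> n0; rewrite /empirical /= /mscale/= /msum.
rewrite (eq_bigr (fun=> 1%:E)); last by move=> i _; rewrite /= diracT.
rewrite sumEFin sumr_const card_ord -EFinM mulVf//.
by rewrite pnatr_eq0 -lt0n.
Qed.

Lemma pooled_empirical_raw_setT x y n m : (0 < n)%N -> (0 < m)%N ->
  pooled_empirical_raw x y n m setT = 1%E.
Proof.
move=> n0 m0; rewrite /pooled_empirical_raw.
apply: eq_trans (measure_addE _ _ _) _.
transitivity ((n%:R / (m + n)%:R)%:E * empirical x n setT +
  (m%:R / (m + n)%:R)%:E * empirical y m setT)%E; first by [].
rewrite !empirical_setT// !mule1 -EFinD/= -mulrDl -natrD addnC mulfV//.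
by rewrite pnatr_eq0 addn_eq0 negb_and -!lt0n m0.
Qed.

Lemma pooled_empiricalE x y n m : (0 < n)%N -> (0 < m)%N ->
  pooled_empirical x y n m = pooled_empirical_raw x y n m :> (set E -> \bar R).
Proof.
move=> n0 m0; apply/funext => A.
rewrite /pooled_empirical/= /mnormalize pooled_empirical_raw_setT//=.
by rewrite onee_eq0/= invr1 mule1.
Qed.

End iid_samples.

(* A finite measure on the Borel subsets of a Borel set M is represented by its
   extension to R^d that gives mass 0 to the complement of M; integrals over M
   are then integrals over R^d, and L^2(M, B(M), mu) is L2 mu below. *)
Section statistic.
Context (R : realType) (d : nat).
Variable mu : {finite_measure set 'rV[R]_d -> \bar R}.

Definition expi (a : R) : R[i] := (cos a +i* sin a)%C.

Definition ecf n (x : n.-tuple 'rV[R]_d) (t : 'rV[R]_d) : R[i] :=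
  n%:R^-1 * \sum_(j < n) expi (dotp t (tnth x j)).

Definition Tstat n m (x : n.-tuple 'rV[R]_d) (y : m.-tuple 'rV[R]_d) : R :=
  (n%:R * m%:R) / (n + m)%:R *
  \int[mu]_t (ComplexField.Normc.normc (ecf x t - ecf y t) ^+ 2).

Definition Tstat_pair n m (p : n.-tuple 'rV[R]_d * m.-tuple 'rV[R]_d) : R :=
  Tstat p.1 p.2.

Let ecfE n (x : n.-tuple 'rV[R]_d) t : ecf x t =
  ((n%:R^-1 * \sum_(j < n) cos (dotp t (tnth x j)))
   +i* (n%:R^-1 * \sum_(j < n) sin (dotp t (tnth x j))))%C.
Proof.
rewrite /ecf.
have -> : n%:R^-1 = (n%:R^-1)%:C%C :> R[i].
  by rewrite fmorphV/= rmorph_nat.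
have -> : \sum_(j < n) expi (dotp t (tnth x j)) =
   ((\sum_(j < n) cos (dotp t (tnth x j))) +i*
    (\sum_(j < n) sin (dotp t (tnth x j))))%C.
  apply/eqP; rewrite eq_complex/= !raddf_sum/=.
  by apply/andP; split; apply/eqP; apply: eq_bigr.
by apply/eqP; rewrite eq_complex/= !mul0r subr0 addr0 !eqxx.
Qed.

Let measurable_Tstat_pair n m : measurable_fun setT (@Tstat_pair n m).
Proof.
apply: measurable_funM => //.
pose g (z : (n.-tuple 'rV[R]_d * m.-tuple 'rV[R]_d) * 'rV[R]_d) : \bar R :=
  (ComplexField.Normc.normc (ecf z.1.1 z.2 - ecf z.1.2 z.2) ^+ 2)%:E.
have mg : measurable_fun setT g.
  apply/measurable_EFinP; rewrite (_ : (fun _ => _) = (fun z =>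
    (n%:R^-1 * \sum_(j < n) cos (dotp z.2 (tnth z.1.1 j)) -
     m%:R^-1 * \sum_(j < m) cos (dotp z.2 (tnth z.1.2 j))) ^+ 2 +
    (n%:R^-1 * \sum_(j < n) sin (dotp z.2 (tnth z.1.1 j)) -
     m%:R^-1 * \sum_(j < m) sin (dotp z.2 (tnth z.1.2 j))) ^+ 2)); last first.
    by apply/funext => z; rewrite !ecfE /= sqr_sqrtr// addr_ge0// sqr_ge0.
  have m1 j : measurable_fun setT (fun z : (n.-tuple 'rV[R]_d *
      m.-tuple 'rV[R]_d) * 'rV[R]_d => dotp z.2 (tnth z.1.1 j)).
    apply: measurable_dotp => //.
    apply: (measurableT_comp (measurable_tnth j)) => //.
    exact: measurableT_comp.
  have m2 j : measurable_fun setT (fun z : (n.-tuple 'rV[R]_d *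
      m.-tuple 'rV[R]_d) * 'rV[R]_d => dotp z.2 (tnth z.1.2 j)).
    apply: measurable_dotp => //.
    apply: (measurableT_comp (measurable_tnth j)) => //.
    exact: measurableT_comp.
  have mc : measurable_fun setT (@cos R).
    by apply: continuous_measurable_fun; exact: continuous_cos.
  have ms : measurable_fun setT (@sin R).
    by apply: continuous_measurable_fun; exact: continuous_sin.
  by apply: measurable_funD; apply: measurable_funX; apply: measurable_funB;
    apply: measurable_funM => //; apply: measurable_sum => j;
    apply: measurableT_comp => //.
apply: (measurableT_comp (fine_measurable measurableT)).
apply: (measurable_fun_fubini_tonelli_F (m2 := mu) _ mg).
by move=> z; rewrite lee_fin sqr_ge0.
Qed.

HB.instance Definition _ n m := @isMeasurableFun.Build _ _ _ _ (@Tstat_pair n m)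
  (@measurable_Tstat_pair n m).

(* The law of T_{n,m}(X*_1, .., X*_n, Y*_1, .., Y*_m) when X*_i, Y*_j are i.i.d.
   with the pooled empirical distribution of x_0, .., x_{n-1}, y_0, .., y_{m-1};
   with x and y the observed samples this is the bootstrap distribution. *)
Definition bootstrap_law (x y : nat -> 'rV[R]_d) (n m : nat) :
    probability R R :=
  let H := pooled_empirical R x y n m in
  distribution (iid_law H n \x iid_law H m)%E (@Tstat_pair n m).

End statistic.

Section L2_space.
Context (R : realType) dT (T : measurableType dT).
Variable mu : {measure set T -> \bar R}.

(* Classes of square-integrable functions modulo equality mu-almost everywhere;
   a class is coerced to a function by choosing a representative. *)
Definition L2 : Type := LspaceType2 mu.

Definition L2_fun (u : L2) : T -> R := u.
Coercion L2_fun : L2 >-> Funclass.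

Definition L2inner (u v : T -> R) : R := \int[mu]_x (u x * v x).
Definition L2norm (u : T -> R) : R := Num.sqrt (L2inner u u).

Definition L2_open (U : set L2) :=
  forall u, U u -> exists2 e : R, 0 < e &
    forall v : L2, L2norm (v \- u) < e -> U v.

Let L2_zero : L2.
Proof.
pose f0 : {mfun T >-> measurableTypeR R} := cst (0 : R).
pose q : {mfun_ mu, T >-> measurableTypeR R} := (\pi f0)%qT.
have q0 : (q : T -> R) = cst 0 %[ae mu].
  have : (repr q == f0 %[mod {mfun_ mu, T >-> measurableTypeR R}])%qT.
    by rewrite reprK.
  by rewrite eqmodE => /asboolP.
suff h : finite_norm mu 2 (q : T -> R).
  exact: (LebesgueSpace.Pack (LebesgueSpace.Class (isFinLebesgue.Build _ _ _ _ _ (lee1n 2) q h))).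
rewrite /finite_norm unlock.
rewrite [X in (X `^ _)%E](_ : _ = 0%E); first by rewrite poweR0r ?ltry.
have mq : measurable_fun setT (q : T -> R) by exact: (measurable_funPT (repr q)).
rewrite (ae_eq_integral (cst 0%E)) ?integral0//.
- apply/measurable_EFinP => /=.
  apply: (measurableT_comp (measurable_powR _)) => //.
  exact: measurableT_comp.
- by apply: filterS q0 => x qx _ /=; rewrite (qx I) normr0 powR0.
Qed.

(* L2 gets the Borel sigma-algebra of its norm topology, so that {RV P >-> L2}
   is the type of random elements of the Hilbert space. *)
HB.instance Definition _ := gen_eqMixin L2.
HB.instance Definition _ := gen_choiceMixin L2.
HB.instance Definition _ := isPointed.Build L2 L2_zero.

HB.instance Definition _ := @isMeasurable.Build (sigma_display L2_open)
  L2 <<s L2_open >>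
  (@sigma_algebra0 _ setT L2_open) (@sigma_algebraC _ L2_open)
  (@sigma_algebra_bigcup _ setT L2_open).

Lemma measurable_L2_fun (u : L2) : measurable_fun setT (u : T -> R).
Proof. exact: (measurable_funPT (repr (LebesgueSpace.sort u))). Qed.

Lemma L2_normE (f : T -> R) : L2norm f = fine ('N[mu]_2%:E[EFin \o f]).
Proof.
rewrite /L2norm /L2inner /Rintegral unlock /Lnorm.
set I := (X in (X `^ _)%E).
rewrite (_ : (\int[mu]_x (f x * f x)%:E)%E = I); last first.
  apply: eq_integral => x _ /=.
  by rewrite powR_mulrn// -normrX expr2 ger0_norm// -expr2 sqr_ge0.
have : (0 <= I)%E by apply: integral_ge0 => x _; exact: poweR_ge0.
case: I => [r| |]// r0; first by rewrite poweR_EFin /= powR12_sqrt.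
by rewrite poweRyr// sqrtr0.
Qed.

Lemma L2_norm_fin (u : L2) : ('N[mu]_2%:E[EFin \o (u : T -> R)] < +oo)%E.
Proof. exact: (@Lebesgue_finite _ _ _ _ _ _ u). Qed.

Lemma L2_normBC (u v : T -> R) : L2norm (v \- u) = L2norm (u \- v).
Proof.
rewrite /L2norm; congr Num.sqrt; apply: eq_Rintegral => x _ /=.
by rewrite -mulrNN !opprB.
Qed.

Lemma L2_norm_triangle (u v : L2) : L2norm u <= L2norm v + L2norm (u \- v).
Proof.
have mu_ := measurable_L2_fun u; have mv := measurable_L2_fun v.
have fin (f : T -> R) : ('N[mu]_2%:E[EFin \o f] < +oo)%E ->
    'N[mu]_2%:E[EFin \o f]%E \is a fin_num.
  by move=> h; rewrite ge0_fin_numE ?Lnorm_ge0.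
have huv : ('N[mu]_2%:E[EFin \o (u \- v)%R] < +oo)%E.
  apply: le_lt_trans; first apply: (eminkowski mu mu_ (measurable_funN mv)).
    by rewrite lee_fin ler1n.
  apply: lte_add_pinfty; first exact: L2_norm_fin.
  have /= := oppe_Lnorm mu (EFin \o v) 2%:E.
  rewrite (_ : EFin \o (\- v)%R = (\- (EFin \o v))%E) => [->|//].
  exact: L2_norm_fin.
rewrite !L2_normE -lee_fin [leRHS](EFinD (fine _) (fine _)) !fineK ?fin ?L2_norm_fin//.
have -> : EFin \o (u : T -> R) = EFin \o (v \+ (u \- v))%R.
  by apply/funext => x /=; rewrite addrC subrK.
apply: (eminkowski mu mv (measurable_funB mu_ mv)).
by rewrite lee_fin ler1n.
Qed.

Definition L2sqnorm (u : L2) : R := L2norm u ^+ 2.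

Let measurable_L2sqnorm : measurable_fun setT L2sqnorm.
Proof.
apply: measurable_funX.
apply: (measurability _ (RGenOInfty.measurableE R)) => _ [_ [a ->] <-].
rewrite setTI; apply: sub_sigma_algebra => u /=.
rewrite in_itv/= andbT => au; exists (L2norm u - a); first by rewrite subr_gt0.
move=> v uv; rewrite /= in_itv/= andbT.
have := L2_norm_triangle u v; rewrite L2_normBC => h.
by rewrite -(ltrD2r (L2norm u)) -ltrBrDl; lra.
Qed.

HB.instance Definition _ := @isMeasurableFun.Build _ _ _ _ L2sqnorm
  measurable_L2sqnorm.

Definition centred_gaussian dO (Omega : measurableType dO)
    (P : probability Omega R) (W : {RV P >-> L2}) (K : T -> T -> R) :=
  forall (h : L2) (A : set R), measurable A ->
  P [set w | A (L2inner (W w) h)] =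
    centred_normal (\int[mu]_s (\int[mu]_t (K s t * h s * h t))) A.

Definition sqnorm_law dO (Omega : measurableType dO) (P : probability Omega R)
    (W : {RV P >-> L2}) : probability R R :=
  distribution P (L2sqnorm \o W).

End L2_space.

Definition CS (R : realType) (a : R) : R := cos a + sin a.

(* Main.v *)
Require Import Defs.
From HB Require Import structures.
From mathcomp Require Import all_boot all_order all_algebra.
From mathcomp Require Import all_classical all_reals all_analysis.
From mathcomp Require Import finmap complex measurable_realfun ring lra zify.

Set Implicit Arguments.
Unset Strict Implicit.
Unset Printing Implicit Defensive.

Import Order.TTheory GRing.Theory Num.Theory.
Import numFieldNormedType.Exports.

Local Open Scope classical_set_scope.
Local Open Scope ring_scope.

(** Put [Phi x t = CS (t . x)].  The real and the imaginary part of the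
    difference of the two empirical characteristic functions are respectively
    even and odd in [t], so under the symmetric measure [mu] their product
    integrates to 0 and the statistic is the squared norm in L^2(mu) of
      Z = s (Phi x_1 + ... + Phi x_n) + r (Phi y_1 + ... + Phi y_m),
    where s = c / n, r = - c / m and c^2 = n m / (n + m) ([Tstat_CS]).  These
    weights satisfy n s + m r = 0 and n s^2 + m r^2 = 1, so the common mean of
    the resampled vectors cancels and Z has the covariance of a single one.

    The random data enter only through the pooled empirical law H_k.  By the
    strong law for bounded variables ([slln_bounded]), almost surely the
    integrals of countably many prescribed functions against H_k converge to
    their integrals against the law L of X ([cvg_pooled_empirical]).  What
    remains is a deterministic limit theorem for resampling from a convergent
    sequence H_k ([resampling_sqnorm_cvg]), whose proof uses Laplace transforms
    of squared norms.

    - A countable generator of the Borel sets yields finer and finer finite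
      partitions.  The squared norm of the projection of u on the step functions
      of level N, [proj_sqnorm], increases to the squared norm of u for every
      square-integrable u ([proj_sqnorm_cvg]).
    - exp(- lam |v|^2) for a finite vector v is the mean of the cosine of a
      Gaussian linear form in v ([Rint_cos_gauss_vector]).  So the Laplace
      transform of [proj_sqnorm] at Z is a mean of expectations
      E cos <Z, h> over random step functions h.  The scalar <Z, h> is a weighted
      sum of i.i.d. bounded variables, and adding the summands one by one gives
      E cos <Z, h> = exp(- Var / 2) up to an error of the order of the weights
      ([Rint_weighted_sum_cos]).  In the limit, Var is the variance of <W, h>
      ([var_pairing], [gaussian_cosine]), which identifies the limit as the
      Laplace transform of [proj_sqnorm] at W.
    - The part of |Z|^2 lost by the projection has a mean bounded by the
      integral of [residual] against H_k ([residual_mean]).  This converges to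
      its integral against L, which is small for large N ([residual_cvg0]).

    So the Laplace transforms of |Z|^2 converge to the one of |W|^2.  With
    bounded means this gives weak convergence: after u = exp(- x), polynomials
    are uniformly dense on the unit interval ([weierstrass_unit],
    [laplace_weak_convergence]). *)

(** * Bounded measurable functions *)

(** Such functions form an algebra, and against finite measures their integrals
    are finite, additive and exchangeable, so no integrability condition has to
    be carried along. *)
Definition bmf (R : realType) d (T : measurableType d) (f : T -> R) :=
  measurable_fun setT f /\ exists C, forall x, `|f x| <= C.

Section bmf_closure.
Context (R : realType) d (T : measurableType d).
Implicit Types f g : T -> R.

Lemma bmf_cst (c : R) : bmf (fun _ : T => c).
Proof. by split; [exact: measurable_cst | exists `|c|]. Qed.

Lemma bmfD f g : bmf f -> bmf g -> bmf (fun x => f x + g x).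
Proof.
move=> [mf [C fC]] [mg [D gD]]; split; first exact: measurable_funD.
by exists (C + D) => x; rewrite (le_trans (ler_normD _ _))// lerD.
Qed.

Lemma bmfM f g : bmf f -> bmf g -> bmf (fun x => f x * g x).
Proof.
move=> [mf [C fC]] [mg [D gD]]; split; first exact: measurable_funM.
by exists (C * D) => x; rewrite normrM ler_pM.
Qed.

Lemma bmfZ (c : R) f : bmf f -> bmf (fun x => c * f x).
Proof. exact: (bmfM (bmf_cst c)). Qed.

Lemma bmfN f : bmf f -> bmf (fun x => - f x).
Proof.
move=> [mf [C fC]]; split; first exact: measurable_funN.
by exists C => x; rewrite normrN.
Qed.

Lemma bmfB f g : bmf f -> bmf g -> bmf (fun x => f x - g x).
Proof. by move=> bf bg; apply: bmfD => //; exact: bmfN. Qed.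

Lemma bmfX n f : bmf f -> bmf (fun x => f x ^+ n).
Proof.
move=> bf; elim: n => [|n ih]; first exact: bmf_cst.
under eq_fun do rewrite exprS.
exact: bmfM.
Qed.

Lemma bmf_sum (I : Type) (r : seq I) (p : pred I) (F : I -> T -> R) :
  (forall i, bmf (F i)) -> bmf (fun x => \sum_(i <- r | p i) F i x).
Proof.
move=> bF; elim: r => [|i r ih].
  by under eq_fun do rewrite big_nil; exact: bmf_cst.
under eq_fun do rewrite big_cons.
by case: (p i) => //; exact: bmfD.
Qed.

Lemma bmf_measurable f : bmf f -> measurable_fun setT f.
Proof. by case. Qed.

Lemma bmf_ge0_bound f : bmf f -> exists2 C, 0 <= C & forall x, `|f x| <= C.
Proof.
by move=> [_ [C fC]]; exists C => //; exact: le_trans (normr_ge0 _) (fC point).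
Qed.

Lemma bmf_compr (h : R -> R) (C : R) f : measurable_fun setT f ->
  measurable_fun setT h -> (forall x, `|h x| <= C) -> bmf (fun x => h (f x)).
Proof.
by move=> mf mh hC; split; [exact: measurableT_comp | exists C].
Qed.

Lemma bmf_cos f : measurable_fun setT f -> bmf (fun x => cos (f x)).
Proof.
move=> mf; apply: (bmf_compr mf (C := 1)) => [|x].
  by apply: continuous_measurable_fun; exact: continuous_cos.
by rewrite ler_norml cos_geN1 cos_le1.
Qed.

Lemma bmf_sin f : measurable_fun setT f -> bmf (fun x => sin (f x)).
Proof.
move=> mf; apply: (bmf_compr mf (C := 1)) => [|x].
  by apply: continuous_measurable_fun; exact: continuous_sin.
by rewrite ler_norml sin_geN1 sin_le1.
Qed.

Lemma bmf_expRN f : measurable_fun setT f -> (forall x, 0 <= f x) ->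
  bmf (fun x => expR (- f x)).
Proof.
move=> mf f0; split; last first.
  exists 1 => x; rewrite ger0_norm ?expR_ge0//.
  by rewrite -expR0 ler_expR oppr_le0.
by apply: measurableT_comp => //; exact: measurable_funN.
Qed.

Lemma bmf_indic (A : set T) : measurable A -> bmf (\1_A : T -> R).
Proof.
move=> mA; split => //; exists 1 => x.
by rewrite indicE; case: (x \in A); rewrite ?normr1 ?normr0.
Qed.

End bmf_closure.

Lemma bmf_comp (R : realType) d1 d2 (T1 : measurableType d1)
    (T2 : measurableType d2) (f : T2 -> R) (h : T1 -> T2) :
  measurable_fun setT h -> bmf f -> bmf (fun x => f (h x)).
Proof.
by move=> mh [mf [C fC]]; split; [exact: measurableT_comp | exists C].
Qed.

Section bmf_integral.
Context (R : realType) d (T : measurableType d).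
Variable mu : {finite_measure set T -> \bar R}.
Implicit Types f g : T -> R.

Lemma bmf_integrable f : bmf f -> mu.-integrable setT (EFin \o f).
Proof.
move=> [mf [C fC]]; apply: measurable_bounded_integrable => //.
  by rewrite ltey_eq fin_num_measure.
by exists C; split; [exact: num_real|move=> D CD x _; exact: le_trans (fC x) (ltW CD)].
Qed.

Lemma bmf_integralE f : bmf f ->
  (\int[mu]_x (f x)%:E)%E = (\int[mu]_x f x)%:E.
Proof.
move=> bf; rewrite /Rintegral fineK//.
exact: integrable_fin_num (bmf_integrable bf).
Qed.

Lemma RintD f g : bmf f -> bmf g ->
  \int[mu]_x (f x + g x) = \int[mu]_x f x + \int[mu]_x g x.
Proof. by move=> bf bg; apply: RintegralD => //; exact: bmf_integrable. Qed.

Lemma RintB f g : bmf f -> bmf g ->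
  \int[mu]_x (f x - g x) = \int[mu]_x f x - \int[mu]_x g x.
Proof. by move=> bf bg; apply: RintegralB => //; exact: bmf_integrable. Qed.

Lemma RintZ (c : R) f : bmf f -> \int[mu]_x (c * f x) = c * \int[mu]_x f x.
Proof. by move=> bf; apply: RintegralZl => //; exact: bmf_integrable. Qed.

Lemma Rint_sum (I : Type) (r : seq I) (F : I -> T -> R) :
  (forall i, bmf (F i)) ->
  \int[mu]_x (\sum_(i <- r) F i x) = \sum_(i <- r) \int[mu]_x F i x.
Proof.
move=> bF; elim: r => [|i r ih].
  rewrite big_nil; under eq_Rintegral do rewrite big_nil.
  by rewrite Rintegral_cst ?mul0r.
under eq_Rintegral do rewrite big_cons.
rewrite big_cons -ih RintD//.
exact: bmf_sum.
Qed.

Lemma le_Rint f g : bmf f -> bmf g -> (forall x, f x <= g x) ->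
  \int[mu]_x f x <= \int[mu]_x g x.
Proof. by move=> bf bg fg; apply: le_Rintegral => //; exact: bmf_integrable. Qed.

Lemma Rint_cst (c : R) : \int[mu]_x c = c * fine (mu setT).
Proof. exact: Rintegral_cst. Qed.

Lemma norm_Rint_le f C : bmf f -> (forall x, `|f x| <= C) ->
  `|\int[mu]_x f x| <= C * fine (mu setT).
Proof.
move=> bf fC; apply: le_trans (le_normr_Rintegral _ _) _ => //.
  exact: bmf_integrable.
rewrite -Rint_cst; apply: le_Rint => //; last exact: bmf_cst.
case: bf => mf [D fD]; split; first exact: measurableT_comp.
by exists D => x; rewrite normr_id.
Qed.

End bmf_integral.

Section bmf_sections.
Context (R : realType) d1 d2 (T1 : measurableType d1) (T2 : measurableType d2).
Variable f : T1 * T2 -> R.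
Hypothesis bf : bmf f.

Lemma bmf_xsection x : bmf (fun y => f (x, y)).
Proof. by apply: bmf_comp bf; exact: pair1_measurable. Qed.

Lemma bmf_ysection y : bmf (fun x => f (x, y)).
Proof. by apply: bmf_comp bf; exact: pair2_measurable. Qed.

Lemma bmf_integrable_prod (m1 : {finite_measure set T1 -> \bar R})
    (m2 : {finite_measure set T2 -> \bar R}) :
  (m1 \x m2)%E.-integrable setT (EFin \o f).
Proof.
have [mf [C fC]] := bf.
apply: measurable_bounded_integrable => //.
  rewrite /= -setXTT product_measure1E//.
  by rewrite lte_mul_pinfty ?fin_num_measure// ltey_eq fin_num_measure.
by exists C; split; [exact: num_real|move=> D CD x _; exact: le_trans (fC x) (ltW CD)].
Qed.

End bmf_sections.

(** Measurability is that of the partial integrals in Fubini's theorem, which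
    asks for a measure on the first factor: a point mass serves. *)
Lemma bmf_Rint_l (R : realType) d1 d2 (T1 : measurableType d1)
    (T2 : measurableType d2) (m2 : {finite_measure set T2 -> \bar R})
    (f : T1 * T2 -> R) : bmf f -> bmf (fun x => \int[m2]_y f (x, y)).
Proof.
move=> bf; split; last first.
  have [C C0 fC] := bmf_ge0_bound bf.
  exists (C * fine (m2 setT)) => x; apply: norm_Rint_le => //.
  exact: bmf_xsection.
have := measurable_fubini_F (bmf_integrable_prod bf (\d_(point : T1)) m2).
rewrite /fubini_F => /(measurableT_comp (fine_measurable measurableT)).
by apply.
Qed.

Lemma bmf_Rint_r (R : realType) d1 d2 (T1 : measurableType d1)
    (T2 : measurableType d2) (m1 : {finite_measure set T1 -> \bar R})
    (f : T1 * T2 -> R) : bmf f -> bmf (fun y => \int[m1]_x f (x, y)).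
Proof.
move=> bf; apply: (bmf_Rint_l m1 (f := fun z => f (z.2, z.1))).
by apply: (bmf_comp (h := fun z : T2 * T1 => (z.2, z.1))) bf; exact: measurable_swap.
Qed.

Section bmf_fubini.
Context (R : realType) d1 d2 (T1 : measurableType d1) (T2 : measurableType d2).
Variable m1 : {finite_measure set T1 -> \bar R}.
Variable m2 : {finite_measure set T2 -> \bar R}.
Variable f : T1 * T2 -> R.
Hypothesis bf : bmf f.

Let m12f := bmf_integrable_prod bf m1 m2.

Lemma Rint_prod : \int[(m1 \x m2)%E]_z f z = \int[m1]_x \int[m2]_y f (x, y).
Proof.
rewrite /Rintegral -integral12_prod_meas1//; congr fine.
apply: eq_integral => x _; rewrite /fubini_F/=.
by rewrite (bmf_integralE _ (bmf_xsection bf x)).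
Qed.

Lemma Rint_swap : \int[m1]_x \int[m2]_y f (x, y) = \int[m2]_y \int[m1]_x f (x, y).
Proof.
rewrite -Rint_prod /Rintegral -integral21_prod_meas1//; congr fine.
apply: eq_integral => x _; rewrite /fubini_G/=.
by rewrite (bmf_integralE _ (bmf_ysection bf x)).
Qed.

End bmf_fubini.

Section bmf_distribution.
Context (R : realType) d d' (T : measurableType d) (T' : measurableType d').
Variables (P : probability T R).

Lemma Rint_distribution (X : {RV P >-> T'}) (f : T' -> R) : bmf f ->
  \int[distribution P X]_y f y = \int[P]_x f (X x).
Proof.
move=> bf; rewrite /Rintegral integral_distribution//.
  by apply/measurable_EFinP; case: bf.
by apply: (bmf_integrable P (f := f \o X)); exact: bmf_comp.
Qed.

Lemma prob_Rint_cst (c : R) : \int[P]_x c = c.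
Proof.
rewrite Rint_cst (_ : fine _ = 1) ?mulr1//.
by rewrite [X in fine X]probability_setT.
Qed.

End bmf_distribution.

Lemma dominated_cvg_Rint (R : realType) d (T : measurableType d)
    (mu : {measure set T -> \bar R}) (f_ : nat -> T -> R) (f g : T -> R) :
  (forall n, measurable_fun setT (f_ n)) -> mu.-integrable setT (EFin \o g) ->
  (forall n x, `|f_ n x| <= g x) -> (forall x, f_ n x @[n --> \oo] --> f x) ->
  \int[mu]_x f_ n x @[n --> \oo] --> \int[mu]_x f x.
Proof.
move=> mf ig fg ff.
have h : (\int[mu]_x (f_ n x)%:E)%E @[n --> \oo] --> (\int[mu]_x (f x)%:E)%E.
  apply: (@dominated_cvg _ _ _ mu setT measurableT (fun n => EFin \o f_ n)
    (EFin \o f) (EFin \o g)) => //.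
  - by move=> n; apply/measurable_EFinP.
  - by move=> x _; apply: cvg_EFin; [near=> n => //|exact: ff].
  - by move=> n x _; rewrite lee_fin.
have fi : mu.-integrable setT (EFin \o f).
  apply: le_integrable ig => //.
    apply/measurable_EFinP; apply: (measurable_fun_cvg mf) => x _; exact: ff.
  move=> x _ /=; rewrite lee_fin [leRHS]ger0_norm; last first.
    exact: le_trans (normr_ge0 _) (fg 0%N x).
  apply: (ler_cvg_to (cvg_norm (ff x)) (cvg_cst (g x))).
  by near=> n; exact: fg.
apply: fine_cvg; rewrite /Rintegral fineK//.
exact: integrable_fin_num fi.
Unshelve. all: end_near. Qed.

Lemma bounded_cvg_Rint (R : realType) d (T : measurableType d)
    (mu : {finite_measure set T -> \bar R}) (f_ : nat -> T -> R) (f : T -> R)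
    (C : R) :
  (forall n, measurable_fun setT (f_ n)) -> (forall n x, `|f_ n x| <= C) ->
  (forall x, f_ n x @[n --> \oo] --> f x) ->
  \int[mu]_x f_ n x @[n --> \oo] --> \int[mu]_x f x.
Proof.
move=> mf fC; apply: (dominated_cvg_Rint mf (g := fun=> C)) => //.
exact: (bmf_integrable mu (bmf_cst T C)).
Qed.

Lemma cvg_sum_seq (R : realType) (I : Type) (r : seq I) (F : I -> nat -> R)
    (l : I -> R) : (forall i, F i n @[n --> \oo] --> l i) ->
  \sum_(i <- r) F i n @[n --> \oo] --> \sum_(i <- r) l i.
Proof.
move=> Fl; elim: r => [|i r ih].
  by rewrite big_nil; under eq_fun do rewrite big_nil; exact: cvg_cst.
by rewrite big_cons; under eq_fun do rewrite big_cons; exact: cvgD.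
Qed.

(** * The cosine transform of the normal law *)

Section gaussian_cosine_transform.
Context (R : realType) (s : R).
Hypothesis s0 : s != 0.
Let leb := @lebesgue_measure R.
Let p : R -> R := normal_pdf 0 s.

Let pE x : p x = normal_peak s * expR (- x ^+ 2 / (s ^+ 2 *+ 2)).
Proof. by rewrite /p normal_pdfE// /normal_fun subr0. Qed.

Let s2_gt0 : 0 < s ^+ 2.
Proof. by rewrite exprn_even_gt0. Qed.

Let mp : measurable_fun setT p.
Proof. exact: measurable_normal_pdf. Qed.

Let ip : leb.-integrable setT (EFin \o p).
Proof. exact: integrable_normal_pdf. Qed.

Let p_ge0 x : 0 <= p x.
Proof. exact: normal_pdf_ge0. Qed.

Let is_derive_p x : is_derive x (1 : R) p (- x / s ^+ 2 * p x).
Proof.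
have -> : p = fun x => normal_peak s * expR (- x ^+ 2 / (s ^+ 2 *+ 2)).
  by apply/funext => y; rewrite pE.
apply: is_derive_eq => /=.
rewrite /GRing.scale/=.
by field.
Qed.

(** The bound |x| <= 2 |s| exp(x^2 / 4 s^2) turns x p(x) into a multiple of the
    density with standard deviation sqrt 2 s. *)
Let xp_le x : `|x| * p x <=
  2 * `|s| * normal_peak s * expR (- x ^+ 2 / (s ^+ 2 *+ 4)).
Proof.
have t2 : `|x| <= 2 * `|s| * expR (x ^+ 2 / (s ^+ 2 *+ 4)).
  set t := `|x| / (2 * `|s|).
  have s' : 0 < `|s| by rewrite normr_gt0.
  have -> : x ^+ 2 / (s ^+ 2 *+ 4) = t ^+ 2.
    rewrite /t -(real_normK (num_real x)) -(real_normK (num_real s)).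
    by field; rewrite normr_eq0.
  have -> : `|x| = 2 * `|s| * t by rewrite /t; field; rewrite normr_eq0.
  rewrite ler_pM2l ?mulr_gt0//.
  apply: le_trans (expR_ge1Dx _).
  by have := sqr_ge0 (t - 2^-1); rewrite sqrrB; nra.
have e : expR (- x ^+ 2 / (s ^+ 2 *+ 4)) =
    expR (x ^+ 2 / (s ^+ 2 *+ 4)) * expR (- x ^+ 2 / (s ^+ 2 *+ 2)).
  by rewrite -expRD; congr expR; field.
rewrite e pE.
have -> : 2 * `|s| * normal_peak s * (expR (x ^+ 2 / (s ^+ 2 *+ 4)) *
    expR (- x ^+ 2 / (s ^+ 2 *+ 2))) = 2 * `|s| * expR (x ^+ 2 / (s ^+ 2 *+ 4)) *
    (normal_peak s * expR (- x ^+ 2 / (s ^+ 2 *+ 2))) by ring.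
by rewrite ler_wpM2r// mulr_ge0 ?normal_peak_ge0 ?expR_ge0.
Qed.

Let ixp : leb.-integrable setT (EFin \o (fun x => `|x| * p x)).
Proof.
have r2 : Num.sqrt 2 * s != 0 by rewrite mulf_neq0// gt_eqF// sqrtr_gt0.
pose c := 2 * `|s| * normal_peak s / normal_peak (Num.sqrt 2 * s).
have : leb.-integrable setT (EFin \o (fun x => c * normal_pdf 0 (Num.sqrt 2 * s) x)).
  exact: (integrableZl measurableT c (integrable_normal_pdf 0 (Num.sqrt 2 * s))).
apply: le_integrable => //.
  by apply/measurable_EFinP; apply: measurable_funM => //; exact: measurable_normr.
move=> x _ /=; rewrite lee_fin ger0_norm ?mulr_ge0//.
apply: le_trans (ler_norm _); apply: le_trans (xp_le x) _.
rewrite normal_pdfE// /normal_fun subr0 exprMn sqr_sqrtr// /c.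
rewrite le_eqVlt; apply/orP; left; apply/eqP.
rewrite [RHS]mulrA divfK ?gt_eqF ?normal_peak_gt0//.
by congr (_ * expR _); field.
Qed.

Let p_cvg0 : p n%:R @[n --> \oo] --> (0 : R).
Proof.
pose C := 2 * `|s| * normal_peak s.
apply: (@squeeze_cvgr _ _ _ _ (fun=> 0) (fun n => C / n%:R)).
- near=> n; rewrite p_ge0/=.
  have n0 : 0 < n%:R :> R by rewrite ltr0n; near: n; exact: nbhs_infty_gt.
  rewrite ler_pdivlMr// mulrC.
  have := xp_le n%:R; rewrite ger0_norm ?ler0n// => /le_trans; apply.
  rewrite ler_piMr ?mulr_ge0 ?normal_peak_ge0//.
  rewrite -expR0 ler_expR mulNr oppr_le0 divr_ge0 ?sqr_ge0//.
  by rewrite mulrn_wge0 ?sqr_ge0.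
- exact: cvg_cst.
- rewrite -(mulr0 C); apply: cvgMr; apply/gtr0_cvgV0.
    by near=> n; rewrite ltr0n; near: n; exact: nbhs_infty_gt.
  exact: cvgr_idn.
Unshelve. all: end_near. Qed.

Section shift.
Variable a : R.
Let f (b x : R) : R := cos (a + b * x) * p x.
Let F b : R := \int[leb]_x f b x.

Let mcos b : measurable_fun setT (fun x : R => cos (a + b * x)).
Proof. by apply: continuous_measurable_fun => x; apply: continuous_comp;
  [apply: cvgD; [exact: cvg_cst|apply: cvgMr; exact: cvg_id]|exact: continuous_cos]. Qed.

Let msin b : measurable_fun setT (fun x : R => sin (a + b * x)).
Proof. by apply: continuous_measurable_fun => x; apply: continuous_comp;
  [apply: cvgD; [exact: cvg_cst|apply: cvgMr; exact: cvg_id]|exact: continuous_sin]. Qed.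

Let cosle1 x : `|cos x| <= 1 :> R.
Proof. by rewrite ler_norml cos_geN1 cos_le1. Qed.

Let sinle1 x : `|sin x| <= 1 :> R.
Proof. by rewrite ler_norml sin_geN1 sin_le1. Qed.

Let if_ b : leb.-integrable setT (EFin \o f b).
Proof.
apply: le_integrable ip => //.
  by apply/measurable_EFinP; apply: measurable_funM; [exact: mcos|exact: mp].
by move=> x _ /=; rewrite lee_fin normrM ler_piMl.
Qed.

Let ig b : leb.-integrable setT (EFin \o (fun x => x * sin (a + b * x) * p x)).
Proof.
apply: le_integrable ixp => //.
  apply/measurable_EFinP; apply: measurable_funM; last exact: mp.
  by apply: measurable_funM; [exact: measurable_id|exact: msin].
move=> x _ /=; rewrite lee_fin !normrM normr_id ler_wpM2r// ler_piMr//.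
Qed.

Let is_derive_G b x : is_derive x (1 : R) (fun x => s ^+ 2 * (sin (a + b * x) * p x))
  (s ^+ 2 * (b * cos (a + b * x) * p x) - x * sin (a + b * x) * p x).
Proof.
have dp := is_derive_p x.
apply: is_derive_eq => /=.
rewrite /GRing.scale/=.
by field.
Qed.

(** Integration by parts: the difference of the two integrands is the derivative
    of s^2 sin (a + b x) p(x), which vanishes at infinity.  Integrate over
    [- n, n] and let n grow. *)
Let int_x_sin b : \int[leb]_x (x * sin (a + b * x) * p x) = s ^+ 2 * b * F b.
Proof.
pose g x := s ^+ 2 * (b * cos (a + b * x) * p x) - x * sin (a + b * x) * p x.
pose G x := s ^+ 2 * (sin (a + b * x) * p x).
have gE : g = fun x => s ^+ 2 * b * f b x - x * sin (a + b * x) * p x.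
  by apply/funext => x; rewrite /g /f; ring.
have i1 : leb.-integrable setT (EFin \o (fun x => s ^+ 2 * b * f b x)).
  exact: (integrableZl measurableT (s ^+ 2 * b) (if_ b)).
have int_g : leb.-integrable setT (EFin \o g).
  rewrite gE.
  have := integrableB measurableT i1 (ig b).
  by apply: eq_integrable => // x _.
suff : \int[leb]_x g x = 0.
  rewrite gE RintegralB// RintegralZl// => /eqP.
  by rewrite subr_eq0 => /eqP <-.
have mg : measurable_fun setT g.
  by apply/measurable_EFinP; exact: measurable_int int_g.
have cg : continuous g.
  move=> x; apply: cvgB.
    apply: cvgMr; apply: cvgM; last exact: continuous_normal_pdf.
    by apply: cvgMr; apply: continuous_comp;
      [apply: cvgD; [exact: cvg_cst|apply: cvgMr; exact: cvg_id]|exact: continuous_cos].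
  apply: cvgM; last exact: continuous_normal_pdf.
  by apply: cvgM; [exact: cvg_id|apply: continuous_comp;
      [apply: cvgD; [exact: cvg_cst|apply: cvgMr; exact: cvg_id]|exact: continuous_sin]].
have h1 : \int[leb]_x (g x * \1_(`[- n%:R, n%:R]%classic : set R) x) @[n --> \oo] --> \int[leb]_x g x.
  have := @dominated_cvg_Rint R _ _ leb (fun n x => g x * \1_(`[- n%:R, n%:R]%classic : set R) x) g (fun x => `|g x|); apply.
  - by move=> n; apply: measurable_funM => //.
  - exact: integrable_norm.
  - by move=> n x; rewrite normrM indicE; case: (_ \in _); rewrite ?normr1 ?normr0 ?mulr1 ?mulr0.
  - move=> x; apply: cvg_near_cst; near=> n.
    rewrite indicE mem_set ?mulr1//= in_itv/= -ler_norml.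
    near: n; exact: nbhs_infty_ger.
have h2 : \int[leb]_x (g x * \1_(`[- n%:R, n%:R]%classic : set R) x) @[n --> \oo] --> 0.
  have b1 n : `|s ^+ 2 * p n%:R| = s ^+ 2 * p n%:R.
    by rewrite ger0_norm// mulr_ge0// sqr_ge0.
  have h3 : s ^+ 2 * p n%:R *+ 2 @[n --> \oo] --> (0 : R).
    rewrite -(mul0rn _ 2); apply: cvgMn; rewrite -(mulr0 (s ^+ 2)).
    exact: cvgMr p_cvg0.
  apply/cvgr0Pnorm_le => e e0.
  have /cvgr0Pnorm_le/(_ _ e0)[N _ hN] := h3.
  exists (maxn N 1) => // n /=; rewrite geq_max => /andP[Nn n0].
  apply: le_trans (hN n Nn).
  have nn : - n%:R < n%:R :> R.
    by rewrite (@lt_trans _ _ 0)// ?oppr_lt0 ltr0n.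
  have dG x : is_derive x (1 : R) G (g x) by exact: is_derive_G.
  have cG : continuous G.
    by move=> x; apply: differentiable_continuous; apply/derivable1_diffP.
  have -> : \int[leb]_x (g x * \1_(`[- n%:R, n%:R]%classic : set R) x) =
      G n%:R - G (- n%:R).
    transitivity (\int[leb]_(x in `[- n%:R, n%:R]) g x).
      rewrite [RHS]Rintegral_mkcond; apply: eq_Rintegral => x _.
      by rewrite patchE indicE; case: ifPn => _; rewrite ?mulr1 ?mulr0.
    rewrite /Rintegral (@continuous_FTC2 _ g G)//.
    - exact: continuous_subspaceT.
    - split.
      + by move=> x _.
      + exact: cvg_at_right_filter (cG _).
      + exact: cvg_at_left_filter (cG _).
    - by move=> x _; rewrite derive1E derive_val.
  rewrite /G (le_trans (ler_normB _ _))//.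
  have pN : p (- n%:R) = p n%:R by rewrite !pE sqrrN.
  have h x : `|s ^+ 2 * (sin (a + b * x) * p x)| <= s ^+ 2 * p x.
    rewrite normrM (ger0_norm (ltW s2_gt0)) normrM (ger0_norm (p_ge0 x)).
    by rewrite ler_wpM2l ?(ltW s2_gt0)// ler_piMl.
  rewrite [leRHS]ger0_norm; last by rewrite mulrn_wge0// mulr_ge0// sqr_ge0.
  by rewrite mulr2n lerD// -[in leRHS]pN.
exact: (cvg_unique _ h1 h2).
Unshelve. all: end_near. Qed.

(** Differentiation under the integral sign and [int_x_sin] give the equation
    F' = - s^2 b F, whose solutions are multiples of exp(- s^2 b^2 / 2). *)
Let is_derive_F b : is_derive b (1 : R) F (- (s ^+ 2 * b * F b)).
Proof.
have df c x : is_derive c (1 : R) (fun c => f c x) (- (x * sin (a + c * x) * p x)).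
  apply: is_derive_eq => /=; rewrite /GRing.scale/=.
  by ring.
have d1 c x : partial1of2 f c x = - (x * sin (a + c * x) * p x).
  by rewrite partial1of2E; have [_ ->] := df c x.
have bI : `]b - 1, b + 1[%classic b.
  by rewrite /= in_itv/= ltrBlDr ltrDl ltr01.
have fI c : `]b - 1, b + 1[%classic c -> leb.-integrable setT (EFin \o f c).
  by move=> _; exact: if_.
have dI c y : `]b - 1, b + 1[%classic c -> setT y -> derivable (f ^~ y) c 1.
  by move=> _ _; have [] := df c y.
have ub c y : `]b - 1, b + 1[%classic c -> setT y -> `|partial1of2 f c y| <= `|y| * p y.
  move=> _ _; rewrite d1 normrN !normrM (ger0_norm (p_ge0 y)).
  by rewrite ler_wpM2r// ler_piMr.
have G0 y : 0 <= `|y| * p y by rewrite mulr_ge0.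
split.
  exact: (derivable_under_integral measurableT bI fI dI G0 ixp ub).
rewrite -derive1E (differentiation_under_integral measurableT bI fI dI G0 ixp ub).
rewrite -int_x_sin.
under eq_Rintegral do rewrite d1 -mulN1r.
by rewrite RintegralZl// mulN1r.
Qed.

Let FE b : F b = cos a * expR (- (s ^+ 2 * b ^+ 2 / 2)).
Proof.
pose H b := F b * expR (s ^+ 2 * b ^+ 2 / 2).
have H0 x y : H x = H y.
  apply: is_derive_0_is_cst => {}x.
  have := is_derive_F x => dF.
  apply: is_derive_eq; rewrite /GRing.scale/=.
  by field.
have : H b = cos a.
  rewrite (H0 b 0) /H expr0n/= mulr0 mul0r expR0 mulr1 /F /f.
  under eq_Rintegral do rewrite mul0r addr0.
  rewrite RintegralZl// /Rintegral.
  by rewrite integral_normal_pdf/= mulr1.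
by move=> <-; rewrite /H -mulrA -expRD subrr expR0 mulr1.
Qed.

Lemma Rint_cos_normal b :
  \int[normal_prob 0 s]_x cos (a + b * x) =
  cos a * expR (- (s ^+ 2 * b ^+ 2 / 2)).
Proof.
rewrite -FE /F /Rintegral; congr fine.
pose nu := normal_prob 0 s : probability _ R.
have nudom : nu `<< leb by exact: normal_prob_dominates.
have ic : nu.-integrable setT (EFin \o (fun x => cos (a + b * x))).
  by apply: bmf_integrable; split; [exact: mcos|exists 1 => x; exact: cosle1].
rewrite -(Radon_Nikodym_change_of_variables nudom measurableT ic).
under [RHS]eq_integral do rewrite /f EFinM.
apply: ae_eq_integral => //.
- apply: emeasurable_funM; first exact: (measurable_int nu).
  apply: (measurable_int leb).
  by apply: Radon_Nikodym_integrable.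
- by apply: emeasurable_funM; apply/measurable_EFinP; [exact: mcos|exact: mp].
- apply: ae_eqe_mul2l => /=.
  rewrite Radon_NikodymE//=.
  case: cid => /= h [h1 h2 h3].
  apply: integral_ae_eq => //=.
    exact/measurable_EFinP.
  by move=> E _ mE; rewrite -h3.
Qed.

End shift.
End gaussian_cosine_transform.

(** The centred normal law on the real line with its default Borel structure;
    [normal_prob] lives on a copy of it with another display. *)
Section normal_law.
Context (R : realType).

Let idTR : measurableTypeR R -> R := idfun.

#[local] HB.instance Definition _ := @isMeasurableFun.Build _ _ _ _
  idTR (@measurable_id _ _ setT).

Definition normal_law (s : R) : probability R R :=
  distribution (normal_prob 0 s) idTR.

Lemma normal_lawE s A : normal_law s A = normal_prob 0 s A.
Proof. by []. Qed.

Lemma Rint_cos_normal_law (s a b : R) : s != 0 ->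
  \int[normal_law s]_x cos (a + b * x) =
  cos a * expR (- (s ^+ 2 * b ^+ 2 / 2)).
Proof.
move=> s0; rewrite -Rint_cos_normal// /normal_law Rint_distribution//.
apply: bmf_cos; apply: measurable_funD; first exact: measurable_cst.
by apply: measurable_funM; [exact: measurable_cst|exact: measurable_id].
Qed.

End normal_law.

(** * Sums over i.i.d. samples *)

Section taylor_trigo.
Context (R : realType).
Implicit Types u x : R.

Let mvt0 (f df : R -> R) u : 0 <= u -> (forall x, is_derive x (1 : R) f (df x)) ->
  exists2 c, 0 <= c <= u & f u - f 0 = df c * u.
Proof.
move=> u0 hf.
have cf : {within `[0, u], continuous f}.
  apply: continuous_subspaceT => y.
  by apply: differentiable_continuous; apply/derivable1_diffP; have [] := hf y.
have [c] := @MVT_segment R f df 0 u u0 (fun x _ => hf x) cf.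
by rewrite in_itv/= subr0 => cu ->; exists c.
Qed.

Let sin_le u : 0 <= u -> `|sin u| <= u.
Proof.
move=> u0; have [c cu] := mvt0 u0 (fun x => is_derive_sin x).
rewrite sin0 subr0 => ->; rewrite normrM (ger0_norm u0) ler_piMl//.
by rewrite ler_norml cos_geN1 cos_le1.
Qed.

Let cos_le u : 0 <= u -> `|cos u - 1| <= u ^+ 2.
Proof.
move=> u0; have [c /andP[c0 cu]] := mvt0 u0 (fun x => is_derive_cos x).
rewrite cos0 => ->; rewrite normrM normrN (ger0_norm u0) expr2 ler_wpM2r//.
exact: le_trans (sin_le c0) cu.
Qed.

Lemma sin_taylor u : `|sin u - u| <= `|u| ^+ 3.
Proof.
wlog u0 : u / 0 <= u => [hw|].
  have [/hw//|/ltW u0] := leP 0 u.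
  have := hw (- u); rewrite oppr_ge0 => /(_ u0).
  by rewrite sinN -opprD normrN normrN.
have d x : is_derive x (1 : R) (fun x => sin x - x) (cos x - 1).
  by apply: is_derive_eq.
have [c /andP[c0 cu]] := mvt0 u0 d.
rewrite sin0 !subr0 => ->; rewrite normrM (ger0_norm u0) exprSr ler_wpM2r//.
apply: le_trans (cos_le c0) _; rewrite ler_pXn2r// nnegrE//.
Qed.

Lemma cos_taylor u : `|cos u - 1 + u ^+ 2 / 2| <= u ^+ 4.
Proof.
wlog u0 : u / 0 <= u => [hw|].
  have [/hw//|/ltW u0] := leP 0 u.
  have := hw (- u); rewrite oppr_ge0 => /(_ u0).
  by rewrite cosN sqrrN (_ : (- u) ^+ 4 = u ^+ 4)//; ring.
have d x : is_derive x (1 : R) (fun x => cos x - 1 + x ^+ 2 / 2) (- (sin x - x)).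
  by apply: is_derive_eq; rewrite /GRing.scale/=; field.
have [c /andP[c0 cu]] := mvt0 u0 d.
rewrite cos0 subrr add0r expr0n/= mul0r subr0 => ->.
rewrite normrM normrN (ger0_norm u0) exprSr ler_wpM2r//.
apply: le_trans (sin_taylor c) _; rewrite (ger0_norm c0) ler_pXn2r// nnegrE//.
Qed.

Lemma cosD_taylor (a u : R) :
  `|cos (a + u) - (cos a - u * sin a - u ^+ 2 / 2 * cos a)| <=
  `|u| ^+ 3 + u ^+ 4.
Proof.
rewrite cosD.
have -> : cos a * cos u - sin a * sin u -
    (cos a - u * sin a - u ^+ 2 / 2 * cos a) =
    cos a * (cos u - 1 + u ^+ 2 / 2) - sin a * (sin u - u) by ring.
rewrite (le_trans (ler_normB _ _))// addrC !normrM lerD//.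
  apply: le_trans (sin_taylor u); rewrite ler_piMl//.
  by rewrite ler_norml sin_geN1 sin_le1.
apply: le_trans (cos_taylor u); rewrite ler_piMl//.
by rewrite ler_norml cos_geN1 cos_le1.
Qed.

Lemma expRN_taylor x : 0 <= x -> `|expR (- x) - (1 - x)| <= x ^+ 2.
Proof.
move=> x0; have h := expR_ge1Dx (- x).
rewrite ger0_norm ?subr_ge0//.
have [x1|x1] := leP x 1.
  have h1 : expR (- x) * (1 + x) <= 1.
    apply: (@le_trans _ _ (expR (- x) * expR x)); last by rewrite -expRD addNr expR0.
    by rewrite ler_wpM2l ?expR_ge0// expR_ge1Dx.
  have h2 : expR (- x) <= 1 by rewrite -expR0 ler_expR oppr_le0.
  by have := expR_ge0 (- x); nra.
have h2 : expR (- x) <= 1 by rewrite -expR0 ler_expR oppr_le0.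
by nra.
Qed.

End taylor_trigo.

Section iid_integrals.
Context (R : realType) dE (E : measurableType dE) (P : probability E R).

Lemma bmf_cons n (f : n.+1.-tuple E -> R) : bmf f ->
  bmf (fun p : E * n.-tuple E => f (cons_pair p)).
Proof. by move=> bf; exact: (bmf_comp (h := @cons_pair _ E n)). Qed.

Lemma Rint_iid_lawS n (f : n.+1.-tuple E -> R) : bmf f ->
  \int[iid_law P n.+1]_t f t =
  \int[P]_x \int[iid_law P n]_t f (cons_pair (x, t)).
Proof.
move=> bf; rewrite /= Rint_distribution//.
by rewrite Rint_prod//; exact: bmf_cons.
Qed.

Lemma tnth_cons_pair0 n x (t : n.-tuple E) : tnth (cons_pair (x, t)) ord0 = x.
Proof. by []. Qed.

Lemma tnth_cons_pairS n x (t : n.-tuple E) i :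
  tnth (cons_pair (x, t)) (lift ord0 i) = tnth t i.
Proof. by rewrite (tnth_nth x) /= -tnth_nth. Qed.

Lemma sum_cons_pair n x (t : n.-tuple E) (F : 'I_n.+1 -> E -> R) :
  \sum_(i < n.+1) F i (tnth (cons_pair (x, t)) i) =
  F ord0 x + \sum_(i < n) F (lift ord0 i) (tnth t i).
Proof.
by rewrite big_ord_recl tnth_cons_pair0; under eq_bigr do rewrite tnth_cons_pairS.
Qed.

Lemma measurable_tuple_sum n (F : 'I_n -> E -> R) :
  (forall i, measurable_fun setT (F i)) ->
  measurable_fun setT (fun t : n.-tuple E => \sum_(i < n) F i (tnth t i)).
Proof.
move=> mF; apply: measurable_sum => i.
exact: measurableT_comp (mF i) (measurable_tnth i).
Qed.

Section centred.
Variables (psi : E -> R) (B : R).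
Hypotheses (mpsi : measurable_fun setT psi) (psiB : forall x, `|psi x| <= B).
Hypothesis psi0 : \int[P]_x psi x = 0.
Let v := \int[P]_x (psi x ^+ 2).

Let bpsi : bmf psi. Proof. by split => //; exists B. Qed.

Let B0 : 0 <= B. Proof. exact: le_trans (normr_ge0 _) (psiB point). Qed.

Lemma centred_variance_ge0 : 0 <= v.
Proof. by apply: Rintegral_ge0 => x _; exact: sqr_ge0. Qed.

Let vB : v <= B ^+ 2.
Proof.
rewrite -(prob_Rint_cst P (B ^+ 2)); apply: le_Rint; [exact: bmfX|exact: bmf_cst|].
by move=> x; rewrite -real_normK ?num_real// ler_pXn2r// nnegrE.
Qed.

Let err s := (`|s| * B) ^+ 3 + (s * B) ^+ 4 *+ 2.

(** Second order expansions of the cosine and of the exponential agree because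
    [psi] has mean 0 and second moment [v]. *)
Lemma Rint_cos_one a s :
  `|\int[P]_x cos (a + s * psi x) - expR (- (s ^+ 2 * v / 2)) * cos a| <=
  (`|s| * B) ^+ 3 + (s * B) ^+ 4 *+ 2.
Proof.
pose g x := cos a - s * psi x * sin a - (s * psi x) ^+ 2 / 2 * cos a.
have b1 : bmf (fun x => cos (a + s * psi x)).
  by apply: bmf_cos; apply: measurable_funD => //; exact: measurable_funM.
have bs : bmf (fun x => s * psi x) by exact: bmfZ.
have bg : bmf g.
  apply: bmfB; first by apply: bmfB; [exact: bmf_cst|exact: bmfM bs (bmf_cst _ _)].
  by apply: bmfM (bmf_cst _ _); apply: bmfM (bmf_cst _ _); exact: bmfX.
have ig : \int[P]_x g x = (1 - s ^+ 2 * v / 2) * cos a.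
  have -> : g = fun x => cos a - (s * sin a * psi x + s ^+ 2 / 2 * cos a * psi x ^+ 2).
    by apply/funext => x; rewrite /g; field.
  have b2 : bmf (fun x => psi x ^+ 2) by exact: bmfX.
  rewrite RintB; [|exact: bmf_cst|by apply: bmfD; exact: bmfZ].
  rewrite prob_Rint_cst RintD; [|exact: bmfZ|exact: bmfZ].
  by rewrite !RintZ// psi0 -/v; field.
rewrite -(subrKA (\int[P]_x g x)) (le_trans (ler_normD _ _))//.
have -> : (`|s| * B) ^+ 3 + (s * B) ^+ 4 *+ 2 =
  ((`|s| * B) ^+ 3 + (s * B) ^+ 4) + (s * B) ^+ 4 by ring.
rewrite lerD//.
  rewrite -RintB//.
  apply: le_trans (norm_Rint_le (C := (`|s| * B) ^+ 3 + (s * B) ^+ 4) _ _ _) _.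
  - exact: bmfB.
  - move=> x; apply: le_trans (cosD_taylor _ _) _.
    have h : `|s * psi x| <= `|s| * B by rewrite normrM ler_wpM2l.
    have -> : (s * B) ^+ 4 = (`|s| * B) ^+ 4.
      by rewrite !exprMn -normrX [X in _ = X * _]ger0_norm ?exprn_even_ge0.
    rewrite lerD//; first by rewrite ler_pXn2r// nnegrE ?mulr_ge0.
    have -> : (s * psi x) ^+ 4 = `|s * psi x| ^+ 4.
      by rewrite -[LHS]ger0_norm ?exprn_even_ge0// normrX.
    by rewrite ler_pXn2r// nnegrE ?mulr_ge0.
  - by rewrite [X in _ * fine X]probability_setT mulr1.
rewrite ig -mulrBl normrM distrC.
rewrite (@le_trans _ _ (`|expR (- (s ^+ 2 * v / 2)) - (1 - s ^+ 2 * v / 2)|))//.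
  by rewrite ler_piMr// ler_norml cos_geN1 cos_le1.
have v0 := centred_variance_ge0.
apply: le_trans (expRN_taylor _) _; first by rewrite divr_ge0// mulr_ge0// sqr_ge0.
have -> : (s * B) ^+ 4 = (s ^+ 2 * B ^+ 2) ^+ 2 by ring.
have s20 := sqr_ge0 s; have B20 := sqr_ge0 B.
rewrite ler_pXn2r// ?nnegrE; [|by rewrite divr_ge0// mulr_ge0|exact: mulr_ge0].
rewrite -mulrA ler_wpM2l//.
by move: vB v0; lra.
Qed.

(** Integrating out one summand multiplies cos (a + ...) by the Gaussian factor
    exp(- s^2 v / 2), whatever the shift [a], up to the error of
    [Rint_cos_one].  The factors are at most 1, so the errors only add up: this
    is the central limit theorem by induction on the number of summands. *)
Lemma Rint_cos_iid n a s :
  `|\int[iid_law P n]_t cos (a + s * \sum_(i < n) psi (tnth t i)) -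
    expR (- (n%:R * s ^+ 2 * v / 2)) * cos a| <=
  n%:R * ((`|s| * B) ^+ 3 + (s * B) ^+ 4 *+ 2).
Proof.
elim: n a => [|n ih] a.
  under eq_Rintegral do rewrite big_ord0 mulr0 addr0.
  by rewrite prob_Rint_cst !mul0r oppr0 expR0 mul1r subrr normr0.
pose f (z : E * n.-tuple E) := cos (a + s * psi z.1 + s * \sum_(i < n) psi (tnth z.2 i)).
have mS k : measurable_fun setT (fun t : k.-tuple E => \sum_(i < k) psi (tnth t i)).
  exact: (measurable_tuple_sum (F := fun=> psi)).
have bf : bmf f.
  apply: bmf_cos; apply: measurable_funD; first apply: measurable_funD => //.
    by apply: measurable_funM => //; exact: measurableT_comp.
  by apply: measurable_funM => //; exact: (measurableT_comp (mS n)).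
rewrite Rint_iid_lawS; last first.
  by apply: bmf_cos; apply: measurable_funD => //; apply: measurable_funM => //;
    exact: mS.
under eq_Rintegral => x _.
  under eq_Rintegral => t _.
    rewrite (sum_cons_pair x t (fun=> psi)) mulrDr addrA; over.
  over.
set e := err s; set w := expR (- (n%:R * s ^+ 2 * v / 2)).
have b1 : bmf (fun x => \int[iid_law P n]_t f (x, t)) by exact: (bmf_Rint_l (iid_law P n) bf).
have b2 : bmf (fun x => cos (a + s * psi x)).
  by apply: bmf_cos; apply: measurable_funD => //; exact: measurable_funM.
have -> : expR (- (n.+1%:R * s ^+ 2 * v / 2)) * cos a =
  w * (expR (- (s ^+ 2 * v / 2)) * cos a).
  by rewrite /w mulrA -expRD; congr (expR _ * _); rewrite -natr1; field.
rewrite -(subrKA (w * \int[P]_x cos (a + s * psi x))).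
rewrite (le_trans (ler_normD _ _))// -[in leRHS]natr1 [leRHS]mulrDl mul1r lerD//.
  rewrite -RintZ// -RintB//; last exact: bmfZ.
  apply: le_trans (norm_Rint_le (C := n%:R * e) _ _ _) _.
  - by apply: bmfB => //; exact: bmfZ.
  - by move=> x; exact: ih.
  - by rewrite [X in _ * fine X]probability_setT mulr1.
rewrite -mulrBr normrM ger0_norm ?expR_ge0//.
apply: le_trans (Rint_cos_one a s); rewrite ler_piMl//.
rewrite -expR0 ler_expR oppr_le0 divr_ge0// mulr_ge0//; last exact: centred_variance_ge0.
by rewrite mulr_ge0// sqr_ge0.
Qed.

(** The shift [a] makes the induction go through: the cross term with the
    centred new summand integrates to 0. *)
Lemma Rint_sqr_iid n a s :
  \int[iid_law P n]_t ((a + s * \sum_(i < n) psi (tnth t i)) ^+ 2) =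
  a ^+ 2 + n%:R * s ^+ 2 * v.
Proof.
elim: n a => [|n ih] a.
  under eq_Rintegral do rewrite big_ord0 mulr0 addr0.
  by rewrite prob_Rint_cst !mul0r addr0.
have bS k : bmf (fun t : k.-tuple E => \sum_(i < k) psi (tnth t i)).
  by apply: bmf_sum => i; apply: bmf_comp bpsi; exact: measurable_tnth.
rewrite Rint_iid_lawS; last first.
  by apply: bmfX; apply: bmfD; [exact: bmf_cst|exact: bmfZ].
under eq_Rintegral => x _.
  under eq_Rintegral => t _.
    rewrite (sum_cons_pair x t (fun=> psi)) mulrDr addrA; over.
  rewrite ih sqrrD; over.
have b2 : bmf (fun x => psi x ^+ 2) by exact: bmfX.
transitivity (\int[P]_x ((a ^+ 2 + n%:R * s ^+ 2 * v) +
    (a * s *+ 2 * psi x + s ^+ 2 * psi x ^+ 2))).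
  by apply: eq_Rintegral => x _; ring.
rewrite RintD; [|exact: bmf_cst|by apply: bmfD; exact: bmfZ].
rewrite prob_Rint_cst RintD; [|exact: bmfZ|exact: bmfZ].
by rewrite !RintZ// psi0 -/v -natr1; ring.
Qed.

Section two_samples.
Variables n m : nat.
Let Pnm : probability _ R := (iid_law P n \x iid_law P m)%E.

Let Sn k (t : k.-tuple E) := \sum_(i < k) psi (tnth t i).

Let bS k : bmf (@Sn k).
Proof. by apply: bmf_sum => i; apply: bmf_comp bpsi; exact: measurable_tnth. Qed.

Let mS k : measurable_fun setT (@Sn k). Proof. by case: (bS k). Qed.

Lemma Rint_cos_two_samples s r :
  `|\int[Pnm]_z cos (s * \sum_(i < n) psi (tnth z.1 i) +
                     r * \sum_(i < m) psi (tnth z.2 i)) -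
    expR (- ((n%:R * s ^+ 2 + m%:R * r ^+ 2) * v / 2))| <=
  n%:R * ((`|s| * B) ^+ 3 + (s * B) ^+ 4 *+ 2) +
  m%:R * ((`|r| * B) ^+ 3 + (r * B) ^+ 4 *+ 2).
Proof.
have b1 : bmf (fun z : n.-tuple E * m.-tuple E => cos (s * Sn z.1 + r * Sn z.2)).
  apply: bmf_cos; apply: measurable_funD; apply: measurable_funM => //;
    exact: (measurableT_comp (@mS _)).
rewrite Rint_prod//=.
set w := expR (- (m%:R * r ^+ 2 * v / 2)).
have b2 : bmf (fun t : n.-tuple E => cos (s * Sn t)).
  by apply: bmf_cos; apply: measurable_funM => //; exact: mS.
have -> : expR (- ((n%:R * s ^+ 2 + m%:R * r ^+ 2) * v / 2)) =
  w * (expR (- (n%:R * s ^+ 2 * v / 2)) * cos 0).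
  by rewrite cos0 mulr1 /w -expRD; congr expR; field.
rewrite -(subrKA (w * \int[iid_law P n]_t cos (s * Sn t))).
rewrite (le_trans (ler_normD _ _))// addrC lerD//.
  rewrite -mulrBr normrM ger0_norm ?expR_ge0//.
  have := Rint_cos_iid n 0 s.
  under eq_Rintegral do rewrite add0r.
  move/(le_trans _); apply; rewrite ler_piMl//.
  rewrite -expR0 ler_expR oppr_le0 divr_ge0// mulr_ge0//; last exact: centred_variance_ge0.
  by rewrite mulr_ge0// sqr_ge0.
have b3 := bmf_Rint_l (iid_law P m) b1.
rewrite -RintZ// -RintB//; last exact: bmfZ.
apply: le_trans (norm_Rint_le (C := m%:R * err r) _ _ _) _.
- by apply: bmfB => //; exact: bmfZ.
- by move=> x; exact: Rint_cos_iid.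
- by rewrite [X in _ * fine X]probability_setT mulr1.
Qed.

Lemma Rint_sqr_two_samples s r :
  \int[Pnm]_z ((s * \sum_(i < n) psi (tnth z.1 i) +
                r * \sum_(i < m) psi (tnth z.2 i)) ^+ 2) =
  (n%:R * s ^+ 2 + m%:R * r ^+ 2) * v.
Proof.
have b1 : bmf (fun z : n.-tuple E * m.-tuple E => (s * Sn z.1 + r * Sn z.2) ^+ 2).
  by apply: bmfX; apply: bmfD; apply: bmfZ;
    [exact: (bmf_comp (h := fst))|exact: (bmf_comp (h := snd))].
rewrite Rint_prod//=.
under eq_Rintegral do rewrite Rint_sqr_iid.
have b2 : bmf (fun t : n.-tuple E => (s * Sn t) ^+ 2) by apply: bmfX; exact: bmfZ.
rewrite RintD//; last exact: bmf_cst.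
have := Rint_sqr_iid n 0 s; under eq_Rintegral do rewrite add0r.
by rewrite prob_Rint_cst expr0n/= add0r => ->; ring.
Qed.

End two_samples.
End centred.

End iid_integrals.

(** The standard Gaussian average of cosines of linear forms is a Gaussian
    function of the coefficients: this turns exp(- |b|^2 / 2) into an average of
    functions of linear forms. *)
Lemma Rint_cos_gauss_vector (R : realType) n (b : 'I_n -> R) (a : R) :
  \int[iid_law (normal_law (1 : R)) n]_g cos (a + \sum_(i < n) b i * tnth g i) =
  cos a * expR (- (\sum_(i < n) b i ^+ 2 / 2)).
Proof.
elim: n b a => [|n ih] b a.
  under eq_Rintegral do rewrite big_ord0 addr0.
  by rewrite prob_Rint_cst big_ord0 oppr0 expR0 mulr1.
have mb (i : 'I_n.+1) : measurable_fun setT (fun x : R => b i * x).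
  by apply: measurable_funM.
rewrite Rint_iid_lawS; last first.
  apply: bmf_cos; apply: measurable_funD => //.
  exact: (measurable_tuple_sum (F := fun i x => b i * x)).
under eq_Rintegral => x _.
  under eq_Rintegral => t _.
    rewrite (sum_cons_pair x t (fun i y => b i * y)) addrA; over.
  rewrite ih mulrC; over.
rewrite RintZ; last by apply: bmf_cos; exact: measurable_funD.
rewrite Rint_cos_normal_law ?oner_neq0// big_ord_recl expr1n mul1r.
by rewrite opprD expRD; ring.
Qed.

(** * Laplace transforms determine weak convergence on the half-line *)

Section bernstein.
Context (R : realType).
Implicit Types (G H : nat -> R) (u : R).

(** The Bernstein polynomial with values [G k] at [k / n], built one coin toss
    at a time: its value at [u] is the mean of [G] under the binomial law. *)
Fixpoint bernstein (n : nat) G : {poly R} :=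
  if n is n'.+1 then
    (1 - 'X) * bernstein n' G + 'X * bernstein n' (fun k => G k.+1)
  else (G 0%N)%:P.

Lemma horner_bernsteinS n G u : (bernstein n.+1 G).[u] =
  (1 - u) * (bernstein n G).[u] + u * (bernstein n (fun k => G k.+1)).[u].
Proof. by rewrite /= !hornerE. Qed.

Lemma bernstein_le n G H u : 0 <= u <= 1 ->
  (forall k, (k <= n)%N -> G k <= H k) ->
  (bernstein n G).[u] <= (bernstein n H).[u].
Proof.
move=> /andP[u0 u1]; elim: n G H => [|n ih] G H GH.
  by rewrite /= !hornerE GH.
rewrite !horner_bernsteinS lerD// ler_wpM2l ?subr_ge0// ih// => k kn.
  by rewrite GH// ltnW.
by rewrite GH.
Qed.

Lemma bernstein_affine n G (a b : R) u :
  (bernstein n (fun k => a + b * G k)).[u] = a + b * (bernstein n G).[u].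
Proof.
elim: n G => [|n ih] G; first by rewrite /= !hornerE.
by rewrite !horner_bernsteinS !ih; ring.
Qed.

(** Mean and variance of the binomial law, as one identity. *)
Lemma bernstein_sqr n (a : R) u :
  (bernstein n (fun k => (a + k%:R) ^+ 2)).[u] =
  (a + n%:R * u) ^+ 2 + n%:R * u * (1 - u).
Proof.
elim: n a => [|n ih] a; first by rewrite /= !hornerE; ring.
rewrite horner_bernsteinS ih.
have -> : (fun k => (a + k.+1%:R) ^+ 2) = (fun k : nat => (a + 1 + k%:R) ^+ 2).
  by apply/funext => k; rewrite -natr1; ring.
by rewrite ih -natr1; ring.
Qed.

(** Compactness of the segment gives a uniform modulus of continuity around its
    points; [v] will be any Bernstein node [k / n]. *)
Lemma heine_segment (F : R -> R) (e : R) : continuous F -> 0 < e ->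
  exists2 dl, 0 < dl & forall u v, 0 <= u <= 1 -> `|u - v| < dl -> `|F u - F v| <= e.
Proof.
move=> cF e0.
have /compact_near_coveringP/(_ R (0^'+)
    (fun dl u => forall v, `|u - v| < dl -> `|F u - F v| <= e) _) := @segment_compact R 0 1.
move=> [x _|].
- have /cvgrPdist_lt/(_ (e / 2)) := cF x; rewrite divr_gt0// => /(_ isT).
  move=> /nbhs_ballP[r /= r0 hr].
  exists (ball x (r / 2), [set dl | dl < r / 2]) => /=.
    split; first by apply: nbhsx_ballx; rewrite divr_gt0.
    by apply: nbhs_right_lt; rewrite divr_gt0.
  move=> [u dl] [/= xu dlr] v uv.
  have h1 : `|F x - F u| < e / 2.
    apply: hr; apply: le_ball xu; rewrite ler_pdivrMr// ler_pMr//; lra.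
  have h2 : `|F x - F v| < e / 2.
    apply: hr; rewrite /ball/=; rewrite /ball/= in xu.
    rewrite -(subrKA u) (le_lt_trans (ler_normD _ _))//.
    by have := lt_trans uv dlr; lra.
  rewrite -(subrKA (F x)) (le_trans (ler_normD _ _))// distrC.
  by lra.
- move=> r /= r0 hr; exists (r / 2); first by rewrite divr_gt0.
  move=> u v u01; apply: (hr (r / 2) _ _ u _ v).
  + rewrite /ball/= sub0r normrN gtr0_norm ?divr_gt0//; lra.
  + by rewrite divr_gt0.
  + by rewrite /= in_itv.
Qed.

(** Bernstein's proof.  Where k / n is close to u, [F (k / n)] is close to [F u];
    elsewhere the difference is at most 2 M, which the quadratic (k / n - u)^2
    dominates up to a constant, and the binomial variance u (1 - u) / n makes the
    mean of the latter small. *)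
Lemma weierstrass_unit (F : R -> R) (M e : R) : continuous F ->
  (forall x, `|F x| <= M) -> 0 < e ->
  exists p : {poly R}, forall u, 0 <= u <= 1 -> `|p.[u] - F u| <= e.
Proof.
move=> cF FM e0; have [dl dl0 hdl] := heine_segment cF (divr_gt0 e0 (ltr0n R 2)).
have M0 : 0 <= M by exact: le_trans (normr_ge0 _) (FM 0).
pose n := (Num.bound (4 * M / (dl ^+ 2 * e))).+1.
have hn : 2 * M / (dl ^+ 2 * n%:R) <= e / 2.
  rewrite ler_pdivrMr ?mulr_gt0 ?exprn_gt0//.
  have : 4 * M / (dl ^+ 2 * e) <= n%:R.
    apply: (@le_trans _ _ (Num.bound (4 * M / (dl ^+ 2 * e)))%:R).
      rewrite ltW// archi_boundP//.
      by apply: divr_ge0; [exact: mulr_ge0|apply: mulr_ge0; [exact: sqr_ge0|exact: ltW]].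
    by rewrite ler_nat.
  rewrite ler_pdivrMr ?mulr_gt0 ?exprn_gt0//.
  by lra.
have n0 : 0 < n%:R :> R by rewrite ltr0n.
exists (bernstein n (fun k => F (k%:R / n%:R))) => u /andP[u0 u1].
(* D k bounds |F (k / n) - F u| by a quadratic in k for all k at once *)
pose c := 2 * M / (dl ^+ 2 * n%:R ^+ 2).
pose D k := e / 2 + c * (- (n%:R * u) + k%:R) ^+ 2.
have c0 : 0 <= c.
  by apply: divr_ge0; [exact: mulr_ge0|apply: mulr_ge0; exact: sqr_ge0].
have key k : `|F (k%:R / n%:R) - F u| <= D k.
  have [h|h] := ltP `|u - k%:R / n%:R| dl.
    rewrite distrC (le_trans (hdl _ _ _ h)) ?u0//.
    by rewrite /D lerDl mulr_ge0// sqr_ge0.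
  apply: (@le_trans _ _ (2 * M)).
    by rewrite (le_trans (ler_normB _ _))// [leRHS]mulr_natl mulr2n lerD.
  apply: (@le_trans _ _ (c * (- (n%:R * u) + k%:R) ^+ 2)); last first.
    by rewrite /D lerDr divr_ge0// ltW.
  have -> : - (n%:R * u) + k%:R = - n%:R * (u - k%:R / n%:R).
    by field; rewrite gt_eqF.
  rewrite exprMn sqrrN /c.
  have -> : 2 * M / (dl ^+ 2 * n%:R ^+ 2) * (n%:R ^+ 2 * (u - k%:R / n%:R) ^+ 2) =
    2 * M * ((u - k%:R / n%:R) ^+ 2 / dl ^+ 2).
    by field; rewrite !gt_eqF.
  rewrite ler_peMr ?mulr_ge0// ler_pdivlMr ?exprn_gt0// mul1r.
  by rewrite -(real_normK (num_real (u - _))) ler_pXn2r// nnegrE// ltW.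
have DE : (bernstein n D).[u] <= e.
  rewrite /D bernstein_affine bernstein_sqr addNr expr0n/= add0r.
  rewrite [leRHS](splitr e) lerD2l; apply: le_trans hn.
  have -> : c * (n%:R * u * (1 - u)) = 2 * M / (dl ^+ 2 * n%:R) * (u * (1 - u)).
    by rewrite /c; field; rewrite !gt_eqF.
  rewrite ler_piMr//.
    by apply: divr_ge0; [exact: mulr_ge0|apply: mulr_ge0; [exact: sqr_ge0|exact: ltW]].
  by nra.
have u01 : 0 <= u <= 1 by rewrite u0.
have := bernstein_affine n (fun k => F (k%:R / n%:R)) (- F u) 1 u; rewrite mul1r addrC => <-.
rewrite ler_norml; apply/andP; split; last first.
  apply: le_trans DE; apply: bernstein_le => // k _.
  by rewrite mul1r addrC; have := key k; rewrite ler_norml => /andP[].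
rewrite -lerN2 opprK; apply: le_trans DE.
have := bernstein_affine n (fun k => - F u + 1 * F (k%:R / n%:R)) 0 (-1) u.
rewrite add0r mulN1r => <-; apply: bernstein_le => // k _.
by have := key k; rewrite ler_norml => /andP[+ _]; lra.
Qed.

End bernstein.

Section laplace.
Context (R : realType).
Context (d_ : nat -> measure_display) (Om_ : forall k, measurableType (d_ k)).
Variables (P_ : forall k, probability (Om_ k) R) (V_ : forall k, Om_ k -> R).
Context (d : measure_display) (Om : measurableType d).
Variables (P : probability Om R) (V : Om -> R).
Hypotheses (bV_ : forall k, bmf (@V_ k)) (V_ge0_ : forall k z, 0 <= @V_ k z).
Hypotheses (mV : measurable_fun setT V) (V_ge0 : forall z, 0 <= V z).
Variable C : R.
Hypothesis tight : forall k, \int[P_ k]_z @V_ k z <= C.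
Hypothesis laplace : forall j : nat,
  \int[P_ k]_z expR (- (j%:R * @V_ k z)) @[k --> \oo] -->
  \int[P]_z expR (- (j%:R * V z)).

(** The continuous cut-off: 1 up to [L], 0 from [L + 1] on, affine between. *)
Let cut (L x : R) : R := Num.max 0 (Num.min 1 (L + 1 - x)).

Let cut_ge0 L x : 0 <= cut L x. Proof. by rewrite /cut le_max lexx. Qed.

Let cut_le1 L x : cut L x <= 1.
Proof. by rewrite /cut ge_max ler01/= ge_min lexx. Qed.

Let cut1 L x : x <= L -> cut L x = 1.
Proof.
by move=> xL; rewrite /cut min_l ?max_r ?ler01//; rewrite lerBrDr addrC lerD2r.
Qed.

Let cut0 L x : L + 1 <= x -> cut L x = 0.
Proof.
by move=> xL; rewrite /cut max_l// ge_min subr_le0 xL orbT.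
Qed.

Let cut_tail L x : 0 < L -> 0 <= x -> 1 - cut L x <= L^-1 * x.
Proof.
move=> L0 x0; have [xL|xL] := leP x L.
  by rewrite cut1// subrr mulr_ge0// invr_ge0 ltW.
rewrite (@le_trans _ _ 1) ?gerBl//.
by rewrite mulrC ler_pdivlMr// mul1r ltW.
Qed.

Let continuous_cut L : continuous (cut L).
Proof.
move=> x.
have h : {for x, continuous (fun y : R => L + 1 - y : R^o)}.
  by apply: cvgB; [exact: cvg_cst|exact: cvg_id].
have cc (c : R) : {for x, continuous (fun _ : R => c : R^o)} by exact: cvg_cst.
exact: (continuous_max (cc 0) (continuous_min (cc 1) h)).
Qed.

Section poly.
Variable p : {poly R}.
Let q x := p.[expR (- x)].

Let bmf_exp dT (T : measurableType dT) (U : T -> R) (i : nat) :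
  measurable_fun setT U -> (forall z, 0 <= U z) ->
  bmf (fun z => expR (- (i%:R * U z))).
Proof.
move=> mU U0; apply: bmf_expRN => [|z]; first exact: measurable_funM.
by rewrite mulr_ge0.
Qed.

Let qE x : q x = \sum_(i < size p) p`_i * expR (- (i%:R * x)).
Proof.
rewrite /q horner_coef; apply: eq_bigr => i _.
by rewrite -expRM_natl mulrN.
Qed.

Lemma bmf_poly_exp dT (T : measurableType dT) (U : T -> R) :
  measurable_fun setT U -> (forall z, 0 <= U z) ->
  bmf (fun z => p.[expR (- U z)]).
Proof.
move=> mU U0; under eq_fun do rewrite [_.[_]]qE.
by apply: bmf_sum => i; apply: bmfZ; exact: bmf_exp.
Qed.

Lemma laplace_poly :
  \int[P_ k]_z p.[expR (- @V_ k z)] @[k --> \oo] --> \int[P]_z p.[expR (- V z)].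
Proof.
have E dT (T : measurableType dT) (Q : probability T R) (U : T -> R) :
    measurable_fun setT U -> (forall z, 0 <= U z) ->
    \int[Q]_z p.[expR (- U z)] =
    \sum_(i < size p) p`_i * \int[Q]_z expR (- (i%:R * U z)).
  move=> mU U0; under eq_Rintegral do rewrite [_.[_]]qE.
  rewrite Rint_sum; last by move=> i; apply: bmfZ; exact: bmf_exp.
  by apply: eq_bigr => i _; rewrite RintZ//; exact: bmf_exp.
rewrite E//.
under eq_fun => k do
  rewrite (E _ _ (P_ k) (@V_ k) (bmf_measurable (bV_ k)) (@V_ge0_ k)).
apply: cvg_sum_seq => i.
by apply: cvgMr; exact: laplace.
Qed.

End poly.

(** Convergence of the Laplace transforms at the natural numbers is convergence
    of the means of polynomials in exp(- V).  A test function cut off at [L] is a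
    continuous function of exp(- x) on the unit interval, hence a uniform limit
    of such polynomials; the bound on the means controls the cut-off part
    uniformly in [k], by Markov's inequality ([cut_tail]). *)
Theorem laplace_weak_convergence (f : R -> R) (M : R) : continuous f ->
  (forall x, `|f x| <= M) ->
  \int[P_ k]_z f (@V_ k z) @[k --> \oo] --> \int[P]_z f (V z).
Proof.
move=> cf fM.
have M0 : 0 <= M by exact: le_trans (normr_ge0 _) (fM 0).
have mf : measurable_fun setT f by exact: continuous_measurable_fun.
have mcut L : measurable_fun setT (cut L) by exact: continuous_measurable_fun.
have bf dT (T : measurableType dT) (U : T -> R) : measurable_fun setT U ->
    bmf (fun z => f (U z)).
  by move=> mU; exact: (bmf_compr mU mf fM).
have bcut L dT (T : measurableType dT) (U : T -> R) : measurable_fun setT U ->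
    bmf (fun z => 1 - cut L (U z)).
  move=> mU; apply: bmfB; first exact: bmf_cst.
  apply: (bmf_compr mU (mcut L) (C := 1)) => x.
  by rewrite ger0_norm.
apply/cvgrPdist_le => e e0.
pose e5 := e / 5.
have e50 : 0 < e5 by rewrite divr_gt0.
have tailV : \int[P]_z (1 - cut n%:R (V z)) @[n --> \oo] --> \int[P]_z (0 : R).
  apply: (bounded_cvg_Rint (C := 1)).
  - by move=> n; case: (bcut n%:R _ _ _ mV).
  - by move=> n x; rewrite ger0_norm ?subr_ge0// gerBl.
  - move=> x; apply: cvg_near_cst; near=> n.
    rewrite cut1 ?subrr//; near: n; exact: nbhs_infty_ger.
rewrite prob_Rint_cst in tailV.
have eM : 0 < e5 / (M + 1) by rewrite divr_gt0// ltr_wpDl.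
have [L L0 [tL tC]] : exists2 L : R, 0 < L &
    M * \int[P]_z (1 - cut L (V z)) <= e5 /\ M * (L^-1 * C) <= e5.
  have C0 : 0 <= C.
    by apply: le_trans (tight 0%N); apply: Rintegral_ge0 => z _.
  near \oo => n; exists n%:R; first by rewrite ltr0n; near: n; exact: nbhs_infty_gt.
  have h1 : \int[P]_z (1 - cut n%:R (V z)) <= e5 / (M + 1).
    by near: n; apply: cvgr_le tailV _ eM.
  have n0 : 0 < n%:R :> R by rewrite ltr0n; near: n; exact: nbhs_infty_gt.
  split.
    apply: le_trans (ler_wpM2l M0 h1) _.
    rewrite mulrCA ler_piMr ?(ltW e50)// ler_pdivrMr ?ltr_wpDl// mul1r.
    by rewrite lerDl.
  have h2 : M * C / e5 <= n%:R by near: n; exact: nbhs_infty_ger.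
  by move: h2; rewrite ler_pdivrMr// => h2; rewrite mulrCA mulrC ler_pdivrMr// (mulrC e5).
(* the cut-off test function in the variable u = exp(- x) *)
pose F u : R := if u <= 0 then 0 else f (- ln u) * cut L (- ln u).
have FE x : F (expR (- x)) = f x * cut L x.
  by rewrite /F leNgt expR_gt0/= expRK opprK.
have cF : continuous F.
  move=> u; have [u0|u0] := ltP u (expR (- (L + 1))).
    apply: (@near_cst_continuous _ _ 0).
    near=> x; rewrite /F; case: ifPn => //; rewrite -ltNge => x0.
    rewrite cut0 ?mulr0// lerNr.
    rewrite -(expRK (- (L + 1))) ler_ln ?posrE ?expR_gt0//.
    by apply: ltW; near: x; exact: lt_nbhsl.
  have {}u0 : 0 < u by rewrite (lt_le_trans (expR_gt0 _) u0).
  have cln : {for u, continuous (fun v : R => - ln v)}.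
    by apply: continuousN; exact: continuous_ln.
  have : {for u, continuous (fun v => f (- ln v) * cut L (- ln v))}.
    by apply: continuousM; apply: continuous_comp => //; [exact: cf|exact: continuous_cut].
  rewrite /continuous_at; have -> : F u = f (- ln u) * cut L (- ln u).
    by rewrite /F leNgt u0.
  apply: cvg_trans; apply: near_eq_cvg.
  near=> x; rewrite /F leNgt (_ : 0 < x)//.
  by near: x; exact: lt_nbhsr.
have FM u : `|F u| <= M.
  rewrite /F; case: ifP => _; first by rewrite normr0.
  by rewrite normrM -[leRHS]mulr1 ler_pM// ger0_norm.
have [p hp] := weierstrass_unit cF FM e50.
have step dT (T : measurableType dT) (Q : probability T R) (U : T -> R) :
    measurable_fun setT U -> (forall z, 0 <= U z) ->
    M * \int[Q]_z (1 - cut L (U z)) <= e5 ->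
    `|\int[Q]_z f (U z) - \int[Q]_z p.[expR (- U z)]| <= e5 + e5.
  move=> mU U0 hU; have b1 := bf _ _ _ mU; have b2 := bmf_poly_exp p mU U0.
  have b3 := bcut L _ _ _ mU.
  rewrite -RintB//; apply: le_trans (le_normr_Rintegral _ _) _ => //.
    by apply: bmf_integrable; exact: bmfB.
  apply: (@le_trans _ _ (\int[Q]_z (M * (1 - cut L (U z)) + e5))).
    apply: le_Rint.
    - have [m12 [D hD]] := bmfB b1 b2; split; first exact: measurableT_comp.
      by exists D => x; rewrite normr_id.
    - by apply: bmfD (bmf_cst _ _); exact: bmfZ.
    move=> z; rewrite -(subrKA (F (expR (- U z)))) (le_trans (ler_normD _ _))// lerD//.
      rewrite FE -[X in `|X - _|]mulr1 -mulrBr normrM.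
      by rewrite ler_pM// ger0_norm// subr_ge0.
    rewrite distrC hp// expR_ge0/= -expR0 ler_expR oppr_le0.
    exact: U0.
  rewrite RintD; [|exact: bmfZ|exact: bmf_cst].
  by rewrite RintZ// prob_Rint_cst lerD2r.
have hV := step _ _ P V mV V_ge0 tL.
have hV_ k := step _ _ (P_ k) (@V_ k) (bmf_measurable (bV_ k)) (@V_ge0_ k).
have /cvgrPdist_le/(_ _ e50) := @laplace_poly p.
apply: filterS => k hk.
have {}hV_ := hV_ k.
have : M * \int[P_ k]_z (1 - cut L (@V_ k z)) <= e5.
  apply: le_trans tC; rewrite ler_wpM2l//.
  apply: (@le_trans _ _ (\int[P_ k]_z (L^-1 * @V_ k z))).
    apply: le_Rint => [||z]; [exact: bcut (bmf_measurable (bV_ k))|exact: bmfZ|].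
    exact: cut_tail.
  by rewrite RintZ// ler_wpM2l ?invr_ge0 ?(ltW L0).
move=> /hV_ {}hV_.
have eE : e = 5 * e5 by rewrite /e5; field.
move: hV hk hV_; rewrite !ler_norml => /andP[? ?] /andP[? ?] /andP[? ?].
by apply/andP; split; lra.
Unshelve. all: end_near. Qed.

End laplace.

(** * Finite partitions generating a sigma-algebra *)

Section partition.
Context (R : realType) dT (T : measurableType dT).
Variable mu : {finite_measure set T -> \bar R}.
Variable A : nat -> set T.
Hypothesis mA : forall j, measurable (A j).
Hypothesis genA : forall B, measurable B -> <<s range A >> B.

(** The binary digits of [cell_code N x] record to which of [A 0], ...,
    [A (N - 1)] the point [x] belongs, so the fibres of [cell_code N] are the
    atoms of the algebra generated by these sets. *)
Fixpoint cell_code (N : nat) (x : T) : nat :=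
  if N is N'.+1 then ((cell_code N' x).*2 + (x \in A N'))%N else 0%N.

Lemma cell_code_lt N x : (cell_code N x < 2 ^ N)%N.
Proof.
elim: N => //= N ih; rewrite expnS mul2n.
by case: (x \in A N); rewrite ?addn1 ?addn0 ?ltn_Sdouble ?ltn_double.
Qed.

Lemma cell_code_half N x : (cell_code N.+1 x)./2 = cell_code N x.
Proof. by rewrite /= addnC half_bit_double. Qed.

Lemma cell_code_odd N x : odd (cell_code N.+1 x) = (x \in A N).
Proof. by rewrite /= oddD odd_double oddb. Qed.

Definition cell N i : set T := [set x | cell_code N x = i].

Lemma measurable_cell N i : measurable (cell N i).
Proof.
elim: N i => [|N ih] i.
  have [->|i0] := eqVneq i 0%N.
    by rewrite (_ : cell _ _ = setT)//; apply/seteqP; split.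
  rewrite (_ : cell _ _ = set0)//; apply/seteqP; split => // x /= /eqP.
  by rewrite eq_sym (negbTE i0).
rewrite (_ : cell _ _ = cell N i./2 `&` (if odd i then A N else ~` A N)).
  apply: measurableI => //; case: ifP => _ //; exact: measurableC.
apply/seteqP; split => [x xi|x [xi ix]].
  have <- : cell_code N.+1 x = i := xi.
  rewrite cell_code_odd cell_code_half; split => //.
  by case: ifPn => [/set_mem//|/negP h Ax]; apply: h; exact: mem_set.
rewrite /cell/= xi addnC.
have -> : (x \in A N) = odd i.
  by move: ix; case: ifP => _ ix; [rewrite mem_set|rewrite memNset].
by rewrite odd_double_half.
Qed.

(** Halving a code forgets the last digit, so functions of a coarse code are
    functions of any finer one. *)
Lemma coarse_code (V : Type) (a : nat -> V) N k :
  exists b : nat -> V, forall x, a (cell_code N x) = b (cell_code (N + k) x).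
Proof.
elim: k => [|k [b ih]]; first by exists a => x; rewrite addn0.
by exists (fun i => b i./2) => x; rewrite addnS cell_code_half.
Qed.

Lemma step_functionE (a : nat -> R) N x :
  a (cell_code N x) = \sum_(i < 2 ^ N) a i * \1_(cell N i) x.
Proof.
rewrite (bigD1 (Ordinal (cell_code_lt N x)))//= big1 => [|i /eqP ix].
  by rewrite addr0 indicE mem_set// mulr1.
rewrite indicE memNset ?mulr0// => /= xi; apply: ix.
by apply/val_inj.
Qed.

Lemma bmf_step (a : nat -> R) N : bmf (fun x => a (cell_code N x)).
Proof.
under eq_fun do rewrite step_functionE.
by apply: bmf_sum => i; apply: bmfZ; apply: bmf_indic; exact: measurable_cell.
Qed.

(** The sets approximated in measure by unions of cells form a sigma-algebra
    containing every [A j], hence contain all measurable sets. *)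
Let approx_set (B : set T) := measurable B /\ forall e : R, 0 < e ->
  exists N (S : nat -> bool),
    \int[mu]_x `|\1_B x - (S (cell_code N x))%:R| <= e.

Let bmf_dist B N (S : nat -> bool) : measurable B ->
  bmf (fun x => `|\1_B x - (S (cell_code N x))%:R : R|).
Proof.
move=> mB; have b1 : bmf (fun x => \1_B x - (S (cell_code N x))%:R : R).
  apply: bmfB; first exact: bmf_indic.
  exact: (@bmf_step (fun i => (S i)%:R)).
have [m1 [C hC]] := b1; split; first exact: measurableT_comp.
by exists C => x; rewrite normr_id.
Qed.

Let approx_setC B : approx_set B -> approx_set (~` B).
Proof.
move=> [mB aB]; split; first exact: measurableC.
move=> e /aB[N [S h]]; exists N, (fun i => ~~ S i).
apply: le_trans h; rewrite le_eqVlt; apply/orP; left; apply/eqP.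
apply: eq_Rintegral => x _; rewrite !indicE in_setC.
by case: (x \in B); case: (S _) => /=; rewrite ?subrr ?subr0 ?sub0r ?normr0 ?normrN.
Qed.

Let approx_setU B C : approx_set B -> approx_set C -> approx_set (B `|` C).
Proof.
move=> [mB aB] [mC aC]; split; first exact: measurableU.
move=> e e0; have e20 : 0 < e / 2 by rewrite divr_gt0.
have [N [S hS]] := aB _ e20; have [N' [S' hS']] := aC _ e20.
have [U hU] := coarse_code S N N'; have [U' hU'] := coarse_code S' N' N.
exists (N + N')%N, (fun i => U i || U' i).
rewrite (splitr e); apply: le_trans (lerD hS hS').
rewrite -RintD; [|exact: bmf_dist|exact: bmf_dist].
apply: le_Rint; [apply: (@bmf_dist _ _ (fun i => U i || U' i)); exact: measurableU|by apply: bmfD; exact: bmf_dist|].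
move=> x; rewrite hU hU' addnC (addnC N' N) !indicE in_setU.
by case: (x \in B); case: (x \in C); case: (U _); case: (U' _) => /=;
  rewrite ?subrr ?subr0 ?sub0r ?normrN ?normr0 ?normr1; lra.
Qed.

Let approx_set_bigcup (F : nat -> set T) : (forall i, approx_set (F i)) ->
  approx_set (\bigcup_i F i).
Proof.
move=> aF.
have mF i : measurable (F i) by case: (aF i).
pose G n := \big[setU/set0]_(i < n) F i.
have aG n : approx_set (G n).
  elim: n => [|n ih]; last by rewrite /G big_ord_recr; exact: approx_setU.
  rewrite /G big_ord0; split => // e e0; exists 0%N, xpred0.
  under eq_Rintegral do rewrite indic0 subrr normr0.
  by rewrite Rintegral_cst// mul0r ltW.
have mU : measurable (\bigcup_i F i) by exact: bigcup_measurable.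
split => // e e0.
have bU n : bmf (fun x => `|\1_(\bigcup_i F i) x - \1_(G n) x : R|).
  have b1 : bmf (fun x => \1_(\bigcup_i F i) x - \1_(G n) x : R).
    by apply: bmfB; apply: bmf_indic => //; case: (aG n).
  have [m1 [C hC]] := b1; split; first exact: measurableT_comp.
  by exists C => x; rewrite normr_id.
have cvgG : \int[mu]_x `|\1_(\bigcup_i F i) x - \1_(G n) x : R| @[n --> \oo] -->
    \int[mu]_x (0 : R).
  apply: (bounded_cvg_Rint (C := 1)).
  - by move=> n; case: (bU n).
  - move=> n x; rewrite normr_id !indicE.
    by case: (_ \in _); case: (_ \in _); rewrite ?subrr ?subr0 ?sub0r ?normrN ?normr0 ?normr1.
  - move=> x; apply: cvg_near_cst.
    have [[i _ Fix]|nF] := pselect ((\bigcup_i F i) x).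
      near=> n; rewrite !indicE (mem_set (A := \bigcup_i F i)); last by exists i.
      rewrite mem_set ?subrr ?normr0// /G -bigcup_mkord; exists i => //=.
      by near: n; exact: nbhs_infty_gt.
    near=> n; rewrite !indicE memNset// memNset ?subrr ?normr0// /G -bigcup_mkord.
    by move=> [i _ Fix]; apply: nF; exists i.
have e20 : 0 < e / 2 by rewrite divr_gt0.
rewrite Rintegral_cst// mul0r in cvgG.
have /cvgrPdist_le/(_ _ e20)[n _ /(_ n (leqnn n))] := cvgG.
rewrite sub0r normrN ger0_norm; last by apply: Rintegral_ge0 => x _.
move=> hn; have [_ /(_ _ e20)[N [S hS]]] := aG n.
exists N, S; rewrite (splitr e); apply: le_trans (lerD hn hS).
have mG : measurable (G n) by case: (aG n).
rewrite -RintD//; last exact: bmf_dist.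
apply: le_Rint; [exact: bmf_dist|by apply: bmfD => //; exact: bmf_dist|].
by move=> x; rewrite -[X in `|X| <= _](subrKA (\1_(G n) x)) ler_normD.
Unshelve. all: end_near. Qed.

Let approx_measurable B : measurable B -> approx_set B.
Proof.
move=> /genA; apply: smallest_sub => [|_ [j _ <-]].
  split.
  - rewrite -setCT; apply: approx_setC; split => // e e0.
    exists 0%N, xpredT; under eq_Rintegral do rewrite indicT subrr normr0.
    by rewrite Rintegral_cst// mul0r ltW.
  - by move=> D aD; rewrite setTD; exact: approx_setC.
  - exact: approx_set_bigcup.
split => // e e0; exists j.+1, odd.
under eq_Rintegral do rewrite cell_code_odd indicE subrr normr0.
by rewrite Rintegral_cst// mul0r ltW.
Qed.

Let approx_fun (u : T -> R) := forall e : R, 0 < e ->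
  exists N (a : nat -> R), \int[mu]_x ((u x - a (cell_code N x)) ^+ 2) <= e.

Let bmf_sqdist u N (a : nat -> R) : bmf u ->
  bmf (fun x => (u x - a (cell_code N x)) ^+ 2).
Proof. by move=> bu; apply: bmfX; apply: bmfB => //; exact: bmf_step. Qed.

Let approx_funD u w : bmf u -> bmf w -> approx_fun u -> approx_fun w ->
  approx_fun (fun x => u x + w x).
Proof.
move=> bu bw au aw e e0; have e40 : 0 < e / 4 by rewrite divr_gt0.
have [N [a ha]] := au _ e40; have [N' [a' ha']] := aw _ e40.
have [c hc] := coarse_code a N N'; have [c' hc'] := coarse_code a' N' N.
exists (N + N')%N, (fun i => c i + c' i).
have b1 : bmf (fun x => (u x - a (cell_code N x)) ^+ 2) by exact: bmf_sqdist.
have b2 : bmf (fun x => (w x - a' (cell_code N' x)) ^+ 2) by exact: bmf_sqdist.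
apply: (@le_trans _ _ (2 * (\int[mu]_x ((u x - a (cell_code N x)) ^+ 2) +
    \int[mu]_x ((w x - a' (cell_code N' x)) ^+ 2)))); last by lra.
rewrite -RintD// -RintZ; last exact: bmfD.
apply: le_Rint.
- apply: (@bmf_sqdist (fun x => u x + w x) _ (fun i => c i + c' i)).
  exact: bmfD.
- by apply: bmfZ; exact: bmfD.
- move=> x; rewrite hc hc' (addnC N' N).
  by set p := c _; set q := c' _; have := sqr_ge0 ((u x - p) - (w x - q)); nra.
Qed.

Let approx_funZ k u : bmf u -> approx_fun u -> approx_fun (fun x => k * u x).
Proof.
move=> bu au e e0; have k0 : 0 < k ^+ 2 + 1 by rewrite ltr_wpDl ?sqr_ge0.
have [N [a ha]] := au _ (divr_gt0 e0 k0).
exists N, (fun i => k * a i).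
under eq_Rintegral do rewrite -mulrBr exprMn.
rewrite RintZ; last exact: bmf_sqdist.
apply: le_trans (ler_wpM2l (sqr_ge0 k) ha) _.
by rewrite mulrCA ler_piMr ?(ltW e0)// ler_pdivrMr// mul1r lerDl.
Qed.

Let approx_fun_indic B : measurable B -> approx_fun (\1_B).
Proof.
move=> mB e e0; have [_ /(_ _ e0)[N [S hS]]] := approx_measurable mB.
exists N, (fun i => (S i)%:R); apply: le_trans hS.
rewrite le_eqVlt; apply/orP; left; apply/eqP; apply: eq_Rintegral => x _.
rewrite indicE; case: (_ \in _); case: (S _);
  rewrite ?subrr ?subr0 ?sub0r ?normrN ?normr0 ?normr1 ?sqrrN ?expr1n ?expr0n//.
Qed.

(** The square-integrable approximable functions are closed in L^2. *)
Let approx_fun_close (u : T -> R) :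
  (forall e, 0 < e -> exists w, [/\ bmf w, approx_fun w &
    mu.-integrable setT (EFin \o (fun x => (u x - w x) ^+ 2)) /\
    \int[mu]_x ((u x - w x) ^+ 2) <= e]) -> measurable_fun setT u -> approx_fun u.
Proof.
move=> hu mu_ e e0; have e40 : 0 < e / 4 by rewrite divr_gt0.
have [w [bw aw [iw hw]]] := hu _ e40.
have [N [a ha]] := aw _ e40; exists N, a.
have b1 : bmf (fun x => (w x - a (cell_code N x)) ^+ 2) by exact: bmf_sqdist.
have i1 : mu.-integrable setT (EFin \o (fun x =>
    2 * ((u x - w x) ^+ 2 + (w x - a (cell_code N x)) ^+ 2))).
  have := integrableZl measurableT 2 (integrableD measurableT iw (bmf_integrable mu b1)).
  by apply: eq_integrable => // x _.
have le2 x : (u x - a (cell_code N x)) ^+ 2 <=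
    2 * ((u x - w x) ^+ 2 + (w x - a (cell_code N x)) ^+ 2).
  set p := a _; have := sqr_ge0 ((u x - w x) - (w x - p)); nra.
apply: (@le_trans _ _ (2 * (\int[mu]_x ((u x - w x) ^+ 2) +
    \int[mu]_x ((w x - a (cell_code N x)) ^+ 2)))); last by lra.
rewrite -RintegralD//; last exact: bmf_integrable.
rewrite -RintegralZl//; last first.
  have := integrableD measurableT iw (bmf_integrable mu b1).
  by apply: eq_integrable => // x _.
apply: le_Rintegral => //.
apply: le_integrable i1 => //.
  apply/measurable_EFinP; apply: measurable_funX; apply: measurable_funB => //.
  by case: (bmf_step a N).
move=> x _ /=; rewrite lee_fin ger0_norm ?sqr_ge0// (le_trans (le2 x))//.
exact: ler_norm.
Qed.

(** The number of levels j.+1 below [y] rounds [y] down. *)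
Let count_levels (K : nat) (y : R) : 0 <= y <= K%:R ->
  0 <= y - \sum_(j < K) (j.+1%:R <= y)%R%:R <= 1.
Proof.
move=> /andP[y0 yK].
suff h L : (L%:R <= y -> \sum_(j < L) (j.+1%:R <= y)%R%:R = L%:R :> R) /\
    (y <= L%:R -> 0 <= y - \sum_(j < L) (j.+1%:R <= y)%R%:R <= 1).
  by case: (h K) => _; exact.
elim: L => [|L [ih1 ih2]].
  by rewrite big_ord0; split => // yL; rewrite subr0 y0/= (le_trans yL).
rewrite big_ord_recr/=; split => [Ly|yL].
  have L1 : L%:R <= y by apply: le_trans Ly; rewrite ler_nat.
  by rewrite Ly ih1// natr1.
have [Ly|Ly] := leP L.+1%:R y.
  have yE : y = L.+1%:R by apply/eqP; rewrite eq_le yL.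
  rewrite ih1; last by rewrite yE ler_nat.
  by rewrite yE -natr1 subrr lexx ler01.
rewrite addr0; have [yL'|/ltW Ly'] := leP y L%:R; first exact: ih2.
by rewrite ih1// subr_ge0 Ly'/= lerBlDl natr1 ltW.
Qed.

(** Rounding the values of [u] down to a grid of step [dl] gives a finite sum of
    indicators of level sets that differs from [u] by at most [dl]. *)
Let approx_fun_bmf u : bmf u -> approx_fun u.
Proof.
move=> bu; apply: approx_fun_close (bmf_measurable bu) => e e0.
have [C C0 uC] := bmf_ge0_bound bu.
have m0 : 0 < fine (mu setT) + 1 by rewrite ltr_wpDl// fine_ge0.
near (0 : R)^'+ => dl.
have dl0 : 0 < dl by near: dl; exact: nbhs_right_gt.
have dlC : dl ^+ 2 * (fine (mu setT) + 1) <= e.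
  have dl1 : dl <= 1 by near: dl; apply: nbhs_right_le; exact: ltr01.
  have dle : dl <= e / (fine (mu setT) + 1).
    by near: dl; apply: nbhs_right_le; rewrite divr_gt0.
  rewrite -ler_pdivlMr// (le_trans _ dle)// expr2 ler_piMl// ltW.
pose K := (Num.bound (2 * C / dl)).
have hK : 2 * C / dl <= K%:R.
  by rewrite ltW// archi_boundP// divr_ge0 ?mulr_ge0// ltW.
pose y x := (u x + C) / dl.
pose w x := - C + dl * \sum_(j < K) \1_[set x | j.+1%:R <= y x] x.
have mB (j : 'I_K) : measurable [set x | j.+1%:R <= y x].
  have my : measurable_fun setT y.
    by apply: measurable_funM => //; apply: measurable_funD => //; case: bu.
  rewrite -[X in measurable X]setTI.
  have := my measurableT `[j.+1%:R, +oo[%classic (measurable_itv _).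
  rewrite (_ : y @^-1` _ = [set x | j.+1%:R <= y x])//.
  by apply/seteqP; split => x /=; rewrite in_itv/= andbT.
have bw1 (r : seq 'I_K) : bmf (fun x => \sum_(j <- r) \1_[set x | j.+1%:R <= y x] x : R).
  by apply: bmf_sum => j; exact: bmf_indic.
have bw : bmf w by apply: bmfD; [exact: bmf_cst|exact: bmfZ].
have a0 c : approx_fun (fun=> c).
  move=> e' e'0; exists 0%N, (fun=> c).
  under eq_Rintegral do rewrite subrr expr0n.
  by rewrite Rintegral_cst// mul0r ltW.
have close x : `|u x - w x| <= dl.
  have y0 : 0 <= y x <= K%:R.
    have := uC x; rewrite ler_norml => /andP[u1 u2].
    apply/andP; split; first by rewrite divr_ge0 ?(ltW dl0)//; lra.
    by apply: le_trans hK; rewrite ler_pM2r ?invr_gt0//; lra.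
  have := count_levels y0.
  have -> : \sum_(j < K) (j.+1%:R <= y x)%R%:R =
      \sum_(j < K) \1_[set x | j.+1%:R <= y x] x :> R.
    apply: eq_bigr => j _; rewrite indicE.
    by congr (nat_of_bool _)%:R; apply/idP/idP => [h|/set_mem//]; exact: mem_set.
  have -> : u x - w x = dl * (y x - \sum_(j < K) \1_[set x | j.+1%:R <= y x] x).
    by rewrite /w /y; field; rewrite gt_eqF.
  move=> /andP[h1 h2]; rewrite ger0_norm ?mulr_ge0 ?(ltW dl0)//.
  by rewrite ler_piMr// ltW.
exists w; split => //.
  apply: approx_funD; [exact: bmf_cst|exact: bmfZ|exact: a0|].
  apply: approx_funZ => //.
  elim: (index_enum _) => [|j r ih].
    by under eq_fun do rewrite big_nil; exact: a0.
  under eq_fun do rewrite big_cons.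
  apply: approx_funD => //; first exact: bmf_indic.
  exact: approx_fun_indic.
have b2 : bmf (fun x => (u x - w x) ^+ 2) by apply: bmfX; exact: bmfB.
split; first exact: bmf_integrable.
apply: le_trans dlC.
apply: (@le_trans _ _ (\int[mu]_x (dl ^+ 2))).
  apply: le_Rint => //; first exact: bmf_cst.
  move=> x; rewrite -(real_normK (num_real (u x - w x))).
  by rewrite ler_pXn2r// nnegrE// ltW.
by rewrite Rint_cst ler_wpM2l ?sqr_ge0// lerDl.
Unshelve. all: end_near. Qed.

(** Truncation of the values reduces to bounded functions. *)
Lemma step_dense (u : T -> R) (e : R) : measurable_fun setT u ->
  mu.-integrable setT (EFin \o (fun x => u x ^+ 2)) -> 0 < e ->
  exists N (a : nat -> R), \int[mu]_x ((u x - a (cell_code N x)) ^+ 2) <= e.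
Proof.
move=> mu_ iu; apply: approx_fun_close => // {}e e0.
pose B n := [set x | `|u x| <= n%:R].
have mB n : measurable (B n).
  have mn : measurable_fun setT (fun x => `|u x|) by exact: measurableT_comp.
  rewrite -[X in measurable X]setTI.
  have := mn measurableT `]-oo, n%:R]%classic (measurable_itv _).
  by rewrite (_ : (fun x => `|u x|) @^-1` _ = B n).
pose w n x := u x * \1_(B n) x.
have bw n : bmf (w n).
  split; first by apply: measurable_funM.
  exists n%:R => x; rewrite /w indicE; case: (boolP (x \in B n)) => [/set_mem Bx|_].
    by rewrite mulr1.
  by rewrite mulr0 normr0.
have md n : measurable_fun setT (fun x => (u x - w n x) ^+ 2).
  by apply: measurable_funX; apply: measurable_funB => //; case: (bw n).
have dom n x : `|(u x - w n x) ^+ 2| <= u x ^+ 2.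
  rewrite ger0_norm ?sqr_ge0// /w indicE; case: (_ \in _).
    by rewrite mulr1 subrr expr0n sqr_ge0.
  by rewrite mulr0 subr0.
have h : \int[mu]_x ((u x - w n x) ^+ 2) @[n --> \oo] --> \int[mu]_x (0 : R).
  apply: (dominated_cvg_Rint md iu dom) => x.
  apply: cvg_near_cst; near=> n.
  rewrite /w indicE mem_set ?mulr1 ?subrr ?expr0n//=.
  by near: n; exact: nbhs_infty_ger.
rewrite Rintegral_cst// mul0r in h.
have /cvgrPdist_le/(_ _ e0)[n _ /(_ n (leqnn n))] := h.
rewrite sub0r normrN ger0_norm; last by apply: Rintegral_ge0 => x _; exact: sqr_ge0.
move=> hn; exists (w n); split => //; first exact: approx_fun_bmf.
split => //; apply: le_integrable iu => //.
  by apply/measurable_EFinP; exact: md.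
by move=> x _ /=; rewrite lee_fin (le_trans (dom n x))// ler_norm.
Unshelve. all: end_near. Qed.

End partition.

(** * Square-integrable functions and their projections on partitions *)

Section square_integrable.
Context (R : realType) dT (T : measurableType dT).
Variable mu : {finite_measure set T -> \bar R}.

Definition l2 (u : T -> R) := measurable_fun setT u /\
  mu.-integrable setT (EFin \o (fun x => u x ^+ 2)).

Lemma l2_bmf u : bmf u -> l2 u.
Proof. by move=> bu; split; [case: bu|apply: bmf_integrable; exact: bmfX]. Qed.

Lemma l2_mul_integrable u v : l2 u -> l2 v ->
  mu.-integrable setT (EFin \o (fun x => u x * v x)).
Proof.
move=> [mu_ iu] [mv iv].
have := integrableD measurableT iu iv; apply: le_integrable => //.
  by apply/measurable_EFinP; exact: measurable_funM.
move=> x _ /=; rewrite lee_fin [leRHS]ger0_norm ?addr_ge0 ?sqr_ge0//.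
rewrite ler_norml; apply/andP; split.
  by have := sqr_ge0 (u x + v x); have := sqr_ge0 (u x); have := sqr_ge0 (v x); nra.
by have := sqr_ge0 (u x - v x); have := sqr_ge0 (u x); have := sqr_ge0 (v x); nra.
Qed.

Lemma l2N u : l2 u -> l2 (fun x => - u x).
Proof.
move=> [mu_ iu]; split; first exact: measurable_funN.
by apply: eq_integrable iu => // x _ /=; rewrite sqrrN.
Qed.

Lemma l2D u v : l2 u -> l2 v -> l2 (fun x => u x + v x).
Proof.
move=> lu lv; have [mu_ iu] := lu; have [mv iv] := lv.
split; first exact: measurable_funD.
have iuv := l2_mul_integrable lu lv.
have := integrableD measurableT (integrableD measurableT iu iv)
  (integrableZl measurableT 2 iuv).
by apply: eq_integrable => // x _ /=; congr EFin; ring.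
Qed.

Lemma l2B u v : l2 u -> l2 v -> l2 (fun x => u x - v x).
Proof. by move=> lu lv; apply: l2D => //; exact: l2N. Qed.

Lemma l2_sqrB u v : l2 u -> l2 v ->
  \int[mu]_x ((u x - v x) ^+ 2) =
  \int[mu]_x (u x ^+ 2) - 2 * \int[mu]_x (u x * v x) + \int[mu]_x (v x ^+ 2).
Proof.
move=> lu lv; have [mu_ iu] := lu; have [mv iv] := lv.
have iuv := l2_mul_integrable lu lv.
have i2 := integrableZl measurableT 2 iuv.
rewrite -RintegralZl// -RintegralB// -RintegralD//; last first.
  exact: (integrableB measurableT iu i2).
by apply: eq_Rintegral => x _; ring.
Qed.

Section projection.
Variable A : nat -> set T.
Hypothesis mA : forall j, measurable (A j).
Notation code := (cell_code A).
Notation cel := (cell A).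

(** [proj_sqnorm N u] is the squared norm of the orthogonal projection of [u] on
    the step functions of level [N].  A cell of mass 0 contributes 0 since the
    inverse of 0 is 0. *)
Definition cell_int N (u : T -> R) i := \int[mu]_x (u x * \1_(cel N i) x).
Definition cell_mass N i := \int[mu]_x \1_(cel N i) x.
Definition proj_sqnorm N (u : T -> R) :=
  \sum_(i < 2 ^ N) cell_int N u i ^+ 2 / cell_mass N i.

Let b1 N i : bmf (\1_(cel N i) : T -> R).
Proof. by apply: bmf_indic; exact: measurable_cell. Qed.

Lemma cell_mass_ge0 N i : 0 <= cell_mass N i.
Proof. by apply: Rintegral_ge0 => x _. Qed.

Lemma proj_sqnorm_ge0 N u : 0 <= proj_sqnorm N u.
Proof.
by apply: sumr_ge0 => i _; rewrite divr_ge0 ?sqr_ge0 ?cell_mass_ge0.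
Qed.

Let int_indic_sqr N i : \int[mu]_x (\1_(cel N i) x ^+ 2) = cell_mass N i.
Proof.
by apply: eq_Rintegral => x _; rewrite indicE; case: (_ \in _); rewrite ?expr1n ?expr0n.
Qed.

Lemma int_mul_step N u (a : nat -> R) : l2 u ->
  \int[mu]_x (u x * a (code N x)) = \sum_(i < 2 ^ N) a i * cell_int N u i.
Proof.
move=> lu; under eq_Rintegral do rewrite step_functionE mulr_sumr.
have iI i : mu.-integrable setT (EFin \o (fun x => u x * (a i * \1_(cel N i) x))).
  by apply: l2_mul_integrable lu (l2_bmf _); exact: bmfZ.
elim: (index_enum _) => [|i r ih].
  under eq_Rintegral do rewrite big_nil.
  by rewrite big_nil Rintegral_cst// mul0r.
under eq_Rintegral do rewrite big_cons.
rewrite big_cons RintegralD// ?ih.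
  congr (_ + _); under eq_Rintegral do rewrite mulrCA.
  by rewrite RintegralZl//; exact: l2_mul_integrable lu (l2_bmf (b1 _ _)).
elim: r {ih} => [|j r ih].
  have := bmf_integrable mu (bmf_cst T 0).
  by apply: eq_integrable => // x _ /=; rewrite big_nil.
have := integrableD measurableT (iI j) ih.
by apply: eq_integrable => // x _ /=; rewrite big_cons.
Qed.

Lemma sqdist_step N u (a : nat -> R) : l2 u ->
  \int[mu]_x ((u x - a (code N x)) ^+ 2) = \int[mu]_x (u x ^+ 2) -
    2 * (\sum_(i < 2 ^ N) a i * cell_int N u i) +
    \sum_(i < 2 ^ N) a i ^+ 2 * cell_mass N i.
Proof.
move=> lu; have ba := bmf_step mA a N.
rewrite l2_sqrB//; last exact: l2_bmf.
rewrite int_mul_step//; congr (_ + _).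
transitivity (\int[mu]_x (1 * (a (code N x) ^+ 2))).
  by apply: eq_Rintegral => x _; rewrite mul1r.
rewrite (int_mul_step N (fun i => a i ^+ 2) (l2_bmf (bmf_cst T 1))).
apply: eq_bigr => i _; congr (_ * _).
by apply: eq_Rintegral => x _; rewrite mul1r.
Qed.

(** On a null cell 0 <= |u - a 1|^2 = |u|^2 - 2 a I for every real [a], where [I]
    is the integral of [u] over the cell; this forces I = 0. *)
Lemma cell_int_null N u i : l2 u -> cell_mass N i = 0 -> cell_int N u i = 0.
Proof.
move=> lu m0; apply/eqP; apply: contraT => I0.
set S := \int[mu]_x (u x ^+ 2).
pose a := (S + 1) / (2 * cell_int N u i).
have : 0 <= \int[mu]_x ((u x - a * \1_(cel N i) x) ^+ 2).
  by apply: Rintegral_ge0 => x _; exact: sqr_ge0.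
rewrite l2_sqrB//; last by apply: l2_bmf; exact: bmfZ.
under [X in _ + X]eq_Rintegral do rewrite exprMn.
rewrite RintZ; last exact: bmfX.
rewrite int_indic_sqr m0 mulr0 addr0 -/S.
under eq_Rintegral do rewrite mulrCA.
rewrite RintegralZl//; last exact: l2_mul_integrable lu (l2_bmf (b1 _ _)).
rewrite -/(cell_int N u i).
have -> : 2 * (a * cell_int N u i) = S + 1 by rewrite /a; field.
lra.
Qed.

(** Bessel's inequality: test with the cell averages of [u]. *)
Lemma proj_sqnorm_le N u : l2 u -> proj_sqnorm N u <= \int[mu]_x (u x ^+ 2).
Proof.
move=> lu; rewrite -subr_ge0.
pose a i := cell_int N u i / cell_mass N i.
have : 0 <= \int[mu]_x ((u x - a (code N x)) ^+ 2).
  by apply: Rintegral_ge0 => x _; exact: sqr_ge0.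
rewrite sqdist_step//.
have -> : \sum_(i < 2 ^ N) a i * cell_int N u i = proj_sqnorm N u.
  by apply: eq_bigr => i _; rewrite /a; ring.
have -> : \sum_(i < 2 ^ N) a i ^+ 2 * cell_mass N i = proj_sqnorm N u.
  apply: eq_bigr => i _; rewrite /a.
  have [->|m0] := eqVneq (cell_mass N i) 0; first by rewrite invr0 !mulr0.
  by field.
lra.
Qed.

(** The projection is the best approximation.  On each cell, minimising
    a^2 m - 2 a I over [a] gives - I^2 / m. *)
Lemma proj_sqnorm_best N u (a : nat -> R) : l2 u ->
  \int[mu]_x (u x ^+ 2) - proj_sqnorm N u <= \int[mu]_x ((u x - a (code N x)) ^+ 2).
Proof.
move=> lu; rewrite sqdist_step// -addrA lerD2l lerNl opprD opprK mulr_sumr.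
rewrite -sumrB; apply: ler_sum => i _.
have [m0|m0] := eqVneq (cell_mass N i) 0.
  by rewrite m0 (cell_int_null lu m0) expr0n/= mul0r !mulr0 subrr.
have mp : 0 < cell_mass N i by rewrite lt0r m0 cell_mass_ge0.
rewrite ler_pdivlMr//.
by have := sqr_ge0 (cell_int N u i - a i * cell_mass N i); nra.
Qed.

Hypothesis genA : forall B, measurable B -> <<s range A >> B.

(** An approximating step function of level [N] is also one of each higher
    level, where the projection is at least as close. *)
Lemma proj_sqnorm_cvg u : l2 u ->
  proj_sqnorm N u @[N --> \oo] --> \int[mu]_x (u x ^+ 2).
Proof.
move=> lu; apply/cvgrPdist_le => e e0.
have [mu_ iu] := lu.
have [N [a ha]] := step_dense mA genA mu_ iu e0.
exists N => // N' /= NN'.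
rewrite ger0_norm ?subr_ge0 ?proj_sqnorm_le//.
have [b hb] := coarse_code A a N (N' - N).
apply: le_trans ha; rewrite -(subnKC NN').
under [leRHS]eq_Rintegral do rewrite hb.
exact: proj_sqnorm_best.
Qed.

End projection.
End square_integrable.

(** * Gaussian random elements of the Hilbert space *)

Section L2_elements.
Context (R : realType) dT (T : measurableType dT).
Variable mu : {finite_measure set T -> \bar R}.

Lemma L2_l2 (u : L2 mu) : l2 mu u.
Proof.
split; first exact: measurable_L2_fun.
have mf : (u : T -> R) \in Lfun mu 2%:E.
  apply/andP; split; apply: mem_set; first exact: measurable_L2_fun.
  exact: L2_norm_fin.
exact: Lfun2_integrable_sqr mf.
Qed.

Lemma ae_eq_Rint_mul (u q h : T -> R) : l2 mu u -> measurable_fun setT q ->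
  measurable_fun setT h -> {ae mu, forall x, q x = h x} ->
  \int[mu]_x (u x * q x) = \int[mu]_x (u x * h x).
Proof.
move=> [mu_ _] mq mh qh; congr fine; apply: ae_eq_integral => //.
- by apply/measurable_EFinP; exact: measurable_funM.
- by apply/measurable_EFinP; exact: measurable_funM.
- by apply: filterS qh => x /= -> _.
Qed.

(** The law of a Gaussian element is given by its pairings with classes; this
    lets a function stand for its class. *)
Lemma L2_representative (h : T -> R) : bmf h ->
  exists q : L2 mu, {ae mu, forall x, q x = h x}.
Proof.
move=> bh; have mh := bmf_measurable bh.
pose h1 : {mfun T >-> measurableTypeR R} :=
  @mfun_Sub _ _ T (measurableTypeR R) h (mem_set mh).
pose q : {mfun_ mu, T >-> measurableTypeR R} := (\pi h1)%qT.
have q0 : (q : T -> R) = h %[ae mu].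
  have : (repr q == h1 %[mod {mfun_ mu, T >-> measurableTypeR R}])%qT.
    by rewrite reprK.
  by rewrite eqmodE => /asboolP.
have qh : {ae mu, forall x, q x = h x} by apply: filterS q0 => x; exact.
have mq : measurable_fun setT (q : T -> R) by exact: (measurable_funPT (repr q)).
have fin : finite_norm mu 2 (q : T -> R).
  have : finite_norm mu 2 h.
    rewrite /finite_norm unlock; apply: poweR_lty.
    have [_ /integrableP[_]] := l2_bmf mu bh.
    apply: le_lt_trans; rewrite le_eqVlt; apply/orP; left; apply/eqP.
    apply: eq_integral => x _ /=.
    by rewrite powR_mulrn// -normrX.
  rewrite /finite_norm unlock => hfin.
  rewrite (ae_eq_integral (fun x => (`|(h x)%:E| `^ 2)%E))//.
  - apply/measurable_EFinP => /=.
    apply: (measurableT_comp (measurable_powR _)) => //.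
    exact: measurableT_comp.
  - apply/measurable_EFinP => /=.
    apply: (measurableT_comp (measurable_powR _)) => //.
    exact: measurableT_comp.
  - by apply: filterS qh => x /= -> _.
by exists (LebesgueSpace.Pack (LebesgueSpace.Class
  (isFinLebesgue.Build _ _ _ _ _ (lee1n 2) q fin))).
Qed.

Lemma L2sqnormE (u : L2 mu) : L2sqnorm u = \int[mu]_x (u x ^+ 2).
Proof.
rewrite /L2sqnorm /L2norm sqr_sqrtr.
  by apply: eq_Rintegral => x _; rewrite expr2.
by apply: Rintegral_ge0 => x _; rewrite -expr2 sqr_ge0.
Qed.

(** The preimage of an open half-line is open in the norm topology, by a
    Cauchy-Schwarz estimate. *)
Lemma measurable_L2inner (h : T -> R) : l2 mu h ->
  measurable_fun [set: L2 mu] (fun u : L2 mu => L2inner mu u h).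
Proof.
move=> lh.
apply: (measurability _ (RGenOInfty.measurableE R)) => _ [_ [a ->] <-].
rewrite setTI; apply: sub_sigma_algebra => u /=.
rewrite in_itv/= andbT => au.
pose e := L2inner mu u h - a.
have e0 : 0 < e by rewrite subr_gt0.
pose H := \int[mu]_x (h x ^+ 2).
have H0 : 0 <= H by apply: Rintegral_ge0 => x _; exact: sqr_ge0.
(* 2 <w, h> >= - (t |w|^2 + |h|^2 / t), with t chosen so that |h|^2 / t < e *)
pose t := (H + 1) / e.
have t0 : 0 < t by rewrite divr_gt0// ltr_wpDl.
have Ht : H / t < e.
  rewrite ltr_pdivrMr// /t mulrCA mulfV ?gt_eqF// mulr1.
  by rewrite ltrDl.
exists (Num.sqrt (e / t)); first by rewrite sqrtr_gt0 divr_gt0.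
move=> v uv; rewrite /= in_itv/= andbT.
have lu := L2_l2 u; have lv := L2_l2 v.
have luv : l2 mu (fun x => v x - u x) by exact: l2B.
have N : \int[mu]_x ((v x - u x) ^+ 2) < e / t.
  by have := uv; rewrite /L2norm ltr_sqrt ?(divr_gt0 e0 t0)//.
have dE : L2inner mu v h = L2inner mu u h + \int[mu]_x ((v x - u x) * h x).
  rewrite /L2inner -RintegralD//; [|exact: l2_mul_integrable|exact: l2_mul_integrable].
  by apply: eq_Rintegral => x _; ring.
have [_ iw] := luv; have [_ ih] := lh.
have sq : 0 <= t * \int[mu]_x ((v x - u x) ^+ 2) +
    2 * \int[mu]_x ((v x - u x) * h x) + t^-1 * H.
  rewrite -!RintegralZl//; last exact: l2_mul_integrable.
  rewrite -RintegralD//; last 2 first.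
    exact: (integrableZl measurableT t iw).
    exact: (integrableZl measurableT 2 (l2_mul_integrable luv lh)).
  rewrite -RintegralD//; last 2 first.
    exact: (integrableD measurableT (integrableZl measurableT t iw)
      (integrableZl measurableT 2 (l2_mul_integrable luv lh))).
    exact: (integrableZl measurableT t^-1 ih).
  apply: Rintegral_ge0 => x _.
  have -> : t * (v x - u x) ^+ 2 + 2 * ((v x - u x) * h x) + t^-1 * h x ^+ 2 =
    t^-1 * (t * (v x - u x) + h x) ^+ 2 by field; rewrite gt_eqF.
  by rewrite mulr_ge0 ?sqr_ge0// invr_ge0 ltW.
have N' : t * \int[mu]_x ((v x - u x) ^+ 2) < e.
  by rewrite mulrC -ltr_pdivlMr.
rewrite mulrC in Ht; rewrite dE /e in N' Ht *.
by move: sq; set I2 := \int[mu]_x (_ * _); move: Ht; rewrite /e; lra.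
Qed.

Variables (dO : measure_display) (Omega : measurableType dO).
Variables (P : probability Omega R) (W : {RV P >-> L2 mu}).
Variable K : T -> T -> R.
Hypothesis gW : centred_gaussian W K.

Lemma measurable_gaussian_inner (h : T -> R) : l2 mu h ->
  measurable_fun setT (fun w => \int[mu]_x (W w x * h x)).
Proof.
by move=> lh; exact: (measurableT_comp (measurable_L2inner lh)).
Qed.

(** The pairing of [W] with [h] is normal with variance [v].  For [v = 0] the
    law is the point mass at 0, otherwise the cosine transform of the normal law
    applies with standard deviation [Num.sqrt v]. *)
Lemma gaussian_cosine (h : T -> R) (v : R) : bmf h ->
  bmf (fun z : T * T => K z.1 z.2) ->
  \int[mu]_s \int[mu]_t (K s t * h s * h t) = v -> 0 <= v ->
  \int[P]_w cos (\int[mu]_x (W w x * h x)) = expR (- (v / 2)).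
Proof.
move=> bh bK vE v0.
have [q qh] := L2_representative bh.
have mq := measurable_L2_fun q; have mh := bmf_measurable bh.
have inE w : L2inner mu (W w) q = \int[mu]_x (W w x * h x).
  by apply: ae_eq_Rint_mul => //; exact: L2_l2.
pose U w : R := L2inner mu (W w) q.
have mU : measurable_fun setT U.
  by apply: (measurableT_comp (measurable_L2inner (L2_l2 q))).
pose X : {RV P >-> R} := HB.pack U (isMeasurableFun.Build _ _ _ _ U mU).
have vq : \int[mu]_s \int[mu]_t (K s t * q s * q t) = v.
  rewrite -vE.
  pose G s := \int[mu]_t (K s t * h t).
  have bKs s : bmf (K s) by exact: (bmf_xsection bK).
  have bG : bmf G.
    apply: (bmf_Rint_l mu (f := fun z : T * T => K z.1 z.2 * h z.2)).
    by apply: bmfM => //; exact: bmf_comp bh.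
  have E (g : T -> R) : l2 mu g -> {ae mu, forall x, g x = h x} ->
      \int[mu]_s \int[mu]_t (K s t * g s * g t) = \int[mu]_s (G s * h s).
    move=> lg gh; have mg : measurable_fun setT g by case: lg.
    rewrite -(ae_eq_Rint_mul (l2_bmf mu bG) mg mh gh).
    apply: eq_Rintegral => s _.
    rewrite /G -(ae_eq_Rint_mul (l2_bmf mu (bKs s)) mg mh gh) -RintegralZr//.
      by apply: eq_Rintegral => t _; ring.
    exact: l2_mul_integrable (l2_bmf mu (bKs s)) lg.
  rewrite (E _ (L2_l2 q) qh) E//; first exact: l2_bmf.
  exact: nearW.
have lawU A : measurable A -> distribution P X A = centred_normal v A.
  by move=> mA; rewrite -vq -(gW q mA).
under eq_Rintegral do rewrite -inE.
have bc : bmf (fun x : R => cos x) by exact: bmf_cos.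
rewrite -(Rint_distribution X bc).
have [v00|vn0] := eqVneq v 0.
  rewrite v00 mul0r oppr0 expR0 /Rintegral.
  rewrite (eq_measure_integral (\d_(0 : R))); last first.
    by move=> A mA _; have := lawU A mA; rewrite /centred_normal v00 eqxx.
  rewrite integral_dirac//; last by apply/measurable_EFinP; case: bc.
  by rewrite diracT mul1e/= cos0.
have s0 : Num.sqrt v != 0 by rewrite gt_eqF// sqrtr_gt0 lt0r vn0.
transitivity (\int[normal_law (Num.sqrt v)]_x cos (0 + 1 * x)).
  under [RHS]eq_Rintegral do rewrite add0r mul1r.
  rewrite /Rintegral [in LHS](eq_measure_integral (normal_law (Num.sqrt v)))//.
  move=> A mA _; have := lawU A mA; rewrite /centred_normal (negbTE vn0).
  by rewrite -normal_lawE.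
by rewrite Rint_cos_normal_law// cos0 mul1r expr1n mulr1 sqr_sqrtr.
Qed.

End L2_elements.

(** * A strong law of large numbers for bounded variables *)

Section slln.
Context (R : realType) dO (Omega : measurableType dO) (P : probability Omega R).

(** Comparison with a telescoping sum. *)
Let sum_inv_sqr n : \sum_(k < n) (k.+1%:R ^+ 2)^-1 <= 2 :> R.
Proof.
suff h : \sum_(k < n.+1) (k.+1%:R ^+ 2)^-1 <= 2 - n.+1%:R^-1 :> R.
  have : \sum_(k < n) (k.+1%:R ^+ 2)^-1 <= 2 - n.+1%:R^-1 :> R.
    by apply: le_trans h; rewrite big_ord_recr/= lerDl invr_ge0 sqr_ge0.
  by move/le_trans; apply; rewrite gerBl invr_ge0.
elim: n => [|n ih]; first by rewrite big_ord1 expr1n invr1; lra.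
rewrite big_ord_recr/=; apply: le_trans (lerD ih (lexx _)) _.
rewrite -[n.+2%:R]natr1; have := ltr0Sn R n; move: (n.+1%:R : R) => a a0.
rewrite -subr_ge0 (_ : _ - _ = (a * (a + 1) ^+ 2)^-1).
  by rewrite invr_ge0 mulr_ge0 ?sqr_ge0 ?ltW.
have a1 : a + 1 != 0 by rewrite gt_eqF// addr_gt0.
by field; rewrite a1 gt_eqF.
Qed.

Section orthogonal.
Variables (U : nat -> Omega -> R) (C : R).
Hypotheses (mU : forall i, measurable_fun setT (U i)).
Hypotheses (UC : forall i w, `|U i w| <= C).
Hypothesis orth : forall i j, i != j -> \int[P]_w (U i w * U j w) = 0.
Let S n w := \sum_(i < n) U i w.

Let bU i : bmf (U i). Proof. by split => //; exists C. Qed.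

Let bS n : bmf (S n). Proof. exact: bmf_sum. Qed.

Let C0 : 0 <= C. Proof. exact: le_trans (normr_ge0 _) (UC 0%N point). Qed.

Let int_sqr_S n : \int[P]_w (S n w ^+ 2) <= n%:R * C ^+ 2.
Proof.
elim: n => [|n ih].
  by under eq_Rintegral do rewrite /S big_ord0 expr0n; rewrite prob_Rint_cst mul0r.
have cross : \int[P]_w (S n w * U n w) = 0.
  under eq_Rintegral do rewrite /S mulr_suml.
  rewrite Rint_sum => [|i]; last exact: bmfM.
  by apply: big1 => i _; apply: orth; rewrite ltn_eqF.
apply: (@le_trans _ _ (\int[P]_w (S n w ^+ 2 + (2 * (S n w * U n w) + U n w ^+ 2)))).
  rewrite le_eqVlt; apply/orP; left; apply/eqP.
  by apply: eq_Rintegral => w _; rewrite {1}/S big_ord_recr/= -/(S n w); ring.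
have b2 : bmf (fun w => U n w ^+ 2) by exact: bmfX.
have b3 : bmf (fun w => 2 * (S n w * U n w)) by apply: bmfZ; exact: bmfM.
rewrite RintD; [|exact: bmfX|exact: bmfD].
rewrite RintD// RintZ; last exact: bmfM.
rewrite cross mulr0 add0r -natr1 mulrDl mul1r lerD//.
rewrite -(prob_Rint_cst P (C ^+ 2)); apply: le_Rint => //; first exact: bmf_cst.
by move=> w; rewrite -real_normK ?num_real// ler_pXn2r// nnegrE.
Qed.

(** The squared means along the perfect squares have summable expectations. *)
Let Y k w : R := (S (k.+1 ^ 2) w / (k.+1 ^ 2)%:R) ^+ 2.

Let bY k : bmf (Y k).
Proof. by apply: bmfX; apply: bmfM; [exact: bS|exact: bmf_cst]. Qed.

Let Y0 k w : 0 <= Y k w. Proof. exact: sqr_ge0. Qed.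

Let int_Y k : \int[P]_w Y k w <= C ^+ 2 * (k.+1%:R ^+ 2)^-1.
Proof.
rewrite /Y; under eq_Rintegral do rewrite exprMn mulrC.
rewrite RintZ; last exact: bmfX.
apply: le_trans (ler_wpM2l _ (int_sqr_S _)) _; first exact: sqr_ge0.
rewrite le_eqVlt; apply/orP; left; apply/eqP.
rewrite natrX; have := ltr0Sn R k; move: (k.+1%:R : R) => a a0.
by field; rewrite gt_eqF.
Qed.

Let Y_cvg0 : {ae P, forall w, Y k w @[k --> \oo] --> (0 : R)}.
Proof.
pose F w := (\sum_(k <oo) (Y k w)%:E)%E.
have mY k : measurable_fun setT (fun w => (Y k w)%:E).
  by apply/measurable_EFinP; case: (bY k).
have mF : measurable_fun setT F.
  by apply: ge0_emeasurable_sum => // k w _ _; rewrite lee_fin.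
have F0 w : (0 <= F w)%E by apply: nneseries_ge0 => k _ _; rewrite lee_fin.
have iF : P.-integrable setT F.
  apply/integrableP; split => //.
  under eq_integral do rewrite gee0_abs//.
  rewrite integral_nneseries//; last by move=> k w _; rewrite lee_fin.
  apply: (@le_lt_trans _ _ (2 * C ^+ 2)%:E); last exact: ltry.
  apply: lime_le.
    by apply: is_cvg_nneseries => k _ _; apply: integral_ge0 => w _; rewrite lee_fin.
  near=> n; rewrite big_mkord.
  apply: (@le_trans _ _ (\sum_(k < n) (C ^+ 2 * (k.+1%:R ^+ 2)^-1)%:E)%E).
    by apply: lee_sum => k _; rewrite (bmf_integralE P (bY k)) lee_fin.
  by rewrite sumEFin lee_fin -mulr_sumr mulrC ler_wpM2r ?sqr_ge0.
apply: filterS (integrable_ae measurableT iF) => w /(_ I) Ffin.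
apply: cvg_series_cvg_0.
apply: nondecreasing_is_cvgn.
  by apply: nondecreasing_series => k _ _.
exists (fine (F w)) => _ [n _ <-].
rewrite -lee_fin fineK// /series/= -sumEFin.
by apply: nneseries_lim_ge => k _ _; rewrite lee_fin.
Unshelve. all: end_near. Qed.

Let nat_sqrt n : exists k, (k ^ 2 <= n < k.+1 ^ 2)%N.
Proof.
elim: n => [|n [k /andP[kn nk]]]; first by exists 0%N.
have [h|h] := ltnP n.+1 (k.+1 ^ 2); first by exists k; rewrite h leqW.
exists k.+1; rewrite h/=; apply: leq_ltn_trans nk _.
by rewrite ltn_sqr.
Qed.

(** By orthogonality the mean of the first [n] variables has second moment at
    most C^2 / n.  This is summable along the perfect squares, so the means
    converge almost surely to 0 along them.  Between two squares k^2 and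
    (k + 1)^2 the sum changes by at most 2 k C, which is small compared with
    k^2. *)
Lemma slln_orthogonal :
  {ae P, forall w, n%:R^-1 * \sum_(i < n) U i w @[n --> \oo] --> (0 : R)}.
Proof.
apply: filterS Y_cvg0 => w Yw.
apply/cvgr0Pnorm_le => e e0.
have e20 : 0 < e / 2 by rewrite divr_gt0.
have /cvgr0Pnorm_le/(_ _ (exprn_gt0 2 e20))[K _ hK] := Yw.
have [L hL] : exists L : nat, 2 * C / (e / 2) <= L%:R.
  exists (Num.bound (2 * C / (e / 2))); rewrite ltW// archi_boundP//.
  by rewrite divr_ge0 ?mulr_ge0// ltW.
exists ((maxn K L).+1 ^ 2)%N => // n /= Kn.
have [[|k] /andP[kn nk]] := nat_sqrt n.
  by move: (leq_ltn_trans Kn nk); rewrite ltn_sqr.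
have Kk : (maxn K L <= k)%N.
  by have := leq_ltn_trans Kn nk; rewrite ltn_sqr !ltnS.
move: Kk; rewrite geq_max => /andP[Kk Lk].
set q := (k.+1 ^ 2)%N in kn; have q0 : 0 < q%:R :> R by rewrite ltr0n expn_gt0.
have n0 : 0 < n%:R :> R by rewrite (lt_le_trans q0)// ler_nat.
have h1 : `|S q w| <= e / 2 * q%:R.
  have := hK k Kk; rewrite ger0_norm// /Y -/q.
  rewrite -(real_normK (num_real (_ / _))) ler_pXn2r ?nnegrE ?(ltW e20)//.
  by rewrite normrM normfV (gtr0_norm q0) ler_pdivrMr.
have h2 : `|S n w - S q w| <= C * (n - q)%:R.
  rewrite /S -(subnKC kn) big_split_ord/= addrAC subrr add0r.
  apply: le_trans (ler_norm_sum _ _ _) _.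
  apply: le_trans (ler_sum _ (fun i _ => UC _ _)) _.
  by rewrite sumr_const card_ord addKn mulr_natr.
have h3 : C * (n - q)%:R <= e / 2 * q%:R.
  have nq : (n - q <= 2 * k.+1)%N.
    rewrite leq_subLR /q -ltnS (leq_trans nk)// !expnS !expn0 !muln1; lia.
  apply: (@le_trans _ _ (C * (2 * k.+1)%:R)).
    by rewrite ler_wpM2l// ler_nat.
  move: hL; rewrite ler_pdivrMr// => hL.
  rewrite natrM mulrA [C * 2]mulrC.
  apply: (@le_trans _ _ (L%:R * (e / 2) * k.+1%:R)); first by rewrite ler_wpM2r.
  rewrite mulrAC mulrC ler_wpM2l ?(ltW e20)// /q natrX expr2 ler_wpM2r// ler_nat.
  exact: leqW.
rewrite normrM gtr0_norm ?invr_gt0// mulrC ler_pdivrMr//.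
rewrite -/(S n w) -(subrK (S q w) (S n w)) (le_trans (ler_normD _ _))//.
apply: (@le_trans _ _ (e * q%:R)).
  by rewrite [e in leRHS]splitr mulrDl lerD// (le_trans h2).
by rewrite ler_wpM2l ?(ltW e0)// ler_nat.
Qed.

End orthogonal.

Section iid.
Context dE (E : measurableType dE) (X : nat -> {RV P >-> E}) (X0 : {RV P >-> E}).
Hypothesis ident : forall i, same_distribution (X i) X0.
Hypothesis indep : forall i j A B, i != j -> measurable A -> measurable B ->
  P (X i @^-1` A `&` X j @^-1` B) = (P (X i @^-1` A) * P (X j @^-1` B))%E.

Lemma Rint_same_distribution i (f : E -> R) : bmf f ->
  \int[P]_w f (X i w) = \int[P]_w f (X0 w).
Proof.
move=> bf; rewrite -!Rint_distribution// /Rintegral; congr fine.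
by apply: eq_measure_integral => A mA _; exact: ident.
Qed.

(** The joint law of two independent variables is the product of their laws. *)
Lemma Rint_indep_mul i j (f g : E -> R) : i != j -> bmf f -> bmf g ->
  \int[P]_w (f (X i w) * g (X j w)) =
  \int[P]_w f (X i w) * \int[P]_w g (X j w).
Proof.
move=> ij bf bg.
pose Z w := (X i w, X j w).
have mZ : measurable_fun setT Z by exact: measurable_fun_pair.
pose ZR : {RV P >-> (E * E)%type} := HB.pack Z (isMeasurableFun.Build _ _ _ _ Z mZ).
have bfg : bmf (fun z : E * E => f z.1 * g z.2).
  by apply: bmfM; [exact: (bmf_comp (h := fst))|exact: (bmf_comp (h := snd))].
pose m1 := distribution P (X i); pose m2 := distribution P (X j).
transitivity (\int[distribution P ZR]_z (f z.1 * g z.2)).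
  by rewrite Rint_distribution.
transitivity (\int[(m1 \x m2)%E]_z (f z.1 * g z.2)).
  rewrite /Rintegral; congr fine; apply: eq_measure_integral => A mA _.
  apply/esym/product_measure_unique => // B D mB mD.
  exact: indep.
rewrite Rint_prod//=.
under eq_Rintegral do rewrite RintZ//.
rewrite -(Rint_distribution (X i) bf) -(Rint_distribution (X j) bg).
under eq_Rintegral do rewrite mulrC.
by rewrite RintZ// mulrC.
Qed.

Theorem slln_bounded (f : E -> R) : bmf f ->
  {ae P, forall w, n%:R^-1 * \sum_(i < n) f (X i w) @[n --> \oo] -->
                   \int[P]_w f (X0 w)}.
Proof.
move=> bf; set m := \int[P]_w f (X0 w).
pose g x := f x - m.
have bg : bmf g by apply: bmfB => //; exact: bmf_cst.
have [C C0 gC] := bmf_ge0_bound bg.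
have g0 i : \int[P]_w g (X i w) = 0.
  rewrite Rint_same_distribution// /g RintB; last exact: bmf_cst.
    by rewrite prob_Rint_cst subrr.
  exact: bmf_comp.
have := @slln_orthogonal (fun i w => g (X i w)) C _ (fun i w => gC _) _.
have m1 i : measurable_fun setT (fun w => g (X i w)).
  by case: (bmf_comp (h := X i) (measurable_funPT (X i)) bg).
have o1 i j : i != j -> \int[P]_w (g (X i w) * g (X j w)) = 0.
  by move=> ij; rewrite Rint_indep_mul// !g0 mulr0.
move=> /(_ m1 o1); apply: filterS => w h.
have h' : n%:R^-1 * \sum_(i < n) g (X i w) + m @[n --> \oo] --> 0 + m.
  by apply: cvgD h _; exact: cvg_cst.
rewrite add0r in h'; apply: cvg_trans h'; apply: near_eq_cvg.
near=> n; rewrite sumrB sumr_const card_ord mulrBr -[m *+ n]mulr_natl.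
rewrite mulKf ?subrK// pnatr_eq0 -lt0n.
by near: n; exact: nbhs_infty_gt.
Unshelve. all: end_near. Qed.

End iid.
End slln.

(** * Weighted sums of two resampled samples *)

Section variance.
Context (R : realType) dE (E : measurableType dE) (P : probability E R).

Definition var (f : E -> R) := \int[P]_x (f x ^+ 2) - (\int[P]_x f x) ^+ 2.

Definition cov (f g : E -> R) :=
  \int[P]_x (f x * g x) - \int[P]_x f x * \int[P]_x g x.

Lemma var_centred f : bmf f -> var f = \int[P]_x ((f x - \int[P]_y f y) ^+ 2).
Proof.
move=> bf; set m := \int[P]_y f y.
transitivity (\int[P]_x (f x ^+ 2 - (2 * m * f x - m ^+ 2))); last first.
  by apply: eq_Rintegral => x _; ring.
have b1 : bmf (fun x => 2 * m * f x) by exact: bmfZ.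
rewrite RintB; [|exact: bmfX|by apply: bmfB => //; exact: bmf_cst].
rewrite RintB//; last exact: bmf_cst.
by rewrite RintZ// prob_Rint_cst /var -/m; ring.
Qed.

Lemma var_ge0 f : bmf f -> 0 <= var f.
Proof.
by move=> bf; rewrite var_centred//; apply: Rintegral_ge0 => x _; exact: sqr_ge0.
Qed.

Lemma var_lin (I : finType) (a : I -> R) (F : I -> E -> R) :
  (forall i, bmf (F i)) ->
  var (fun x => \sum_i a i * F i x) = \sum_i \sum_j a i * a j * cov (F i) (F j).
Proof.
move=> bF; rewrite /var.
have b1 i : bmf (fun x => a i * F i x) by exact: bmfZ.
have -> : \int[P]_x ((\sum_i a i * F i x) ^+ 2) =
    \sum_i \sum_j a i * a j * \int[P]_x (F i x * F j x).
  transitivity (\int[P]_x (\sum_i \sum_j a i * a j * (F i x * F j x))).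
    apply: eq_Rintegral => x _; rewrite expr2 mulr_suml; apply: eq_bigr => i _.
    by rewrite mulr_sumr; apply: eq_bigr => j _; ring.
  have b2 i j : bmf (fun x => a i * a j * (F i x * F j x)).
    by apply: bmfZ; exact: bmfM.
  rewrite Rint_sum => [|i]; last exact: bmf_sum.
  apply: eq_bigr => i _; rewrite Rint_sum//.
  by apply: eq_bigr => j _; rewrite RintZ//; exact: bmfM.
rewrite Rint_sum// expr2 mulr_suml -sumrB; apply: eq_bigr => i _.
rewrite mulr_sumr -sumrB; apply: eq_bigr => j _.
by rewrite !RintZ// /cov; ring.
Qed.

(** The condition [balanced] cancels the common mean, [normalised] makes the
    variance of the weighted sum equal to the one of a single summand. *)
Section two_weighted_samples.
Variables (n m : nat) (s r : R).
Hypothesis balanced : n%:R * s + m%:R * r = 0.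
Hypothesis normalised : n%:R * s ^+ 2 + m%:R * r ^+ 2 = 1.
Let Pnm : probability _ R := (iid_law P n \x iid_law P m)%E.

Definition weighted_sum (f : E -> R) (z : n.-tuple E * m.-tuple E) : R :=
  s * \sum_(i < n) f (tnth z.1 i) + r * \sum_(i < m) f (tnth z.2 i).

Lemma bmf_weighted_sum f : bmf f -> bmf (weighted_sum f).
Proof.
move=> bf; apply: bmfD; apply: bmfZ; apply: bmf_sum => i; apply: bmf_comp bf.
  by apply: (measurableT_comp (measurable_tnth i)).
by apply: (measurableT_comp (measurable_tnth i)).
Qed.

Lemma weighted_sum_lin (I : finType) (a : I -> R) (F : I -> E -> R) z :
  weighted_sum (fun x => \sum_i a i * F i x) z = \sum_i a i * weighted_sum (F i) z.
Proof.
rewrite /weighted_sum exchange_big/= [X in r * X]exchange_big/=.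
rewrite !mulr_sumr -big_split/=; apply: eq_bigr => i _.
by rewrite -!mulr_sumr; ring.
Qed.

Let weighted_sum_shift f c z : weighted_sum (fun x => f x - c) z = weighted_sum f z.
Proof.
rewrite /weighted_sum !sumrB !sumr_const !card_ord -[c *+ n]mulr_natl -[c *+ m]mulr_natl.
rewrite !mulrBr.
have -> : s * (n%:R * c) = - (r * (m%:R * c)).
  have nm : n%:R * s = - (m%:R * r) by apply/eqP; rewrite -addr_eq0 balanced.
  by rewrite mulrCA mulrA nm; ring.
by ring.
Qed.

Lemma Rint_weighted_sum_sqr f : bmf f ->
  \int[Pnm]_z (weighted_sum f z ^+ 2) = var f.
Proof.
move=> bf; rewrite var_centred//; set c := \int[P]_y f y.
have bg : bmf (fun x => f x - c) by apply: bmfB => //; exact: bmf_cst.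
have [D _ gD] := bmf_ge0_bound bg.
have g0 : \int[P]_x (f x - c) = 0.
  by rewrite RintB ?prob_Rint_cst ?subrr//; exact: bmf_cst.
have := Rint_sqr_two_samples (bmf_measurable bg) gD g0 n m s r.
rewrite normalised mul1r => <-; apply: eq_Rintegral => z _.
by rewrite -(weighted_sum_shift f c).
Qed.

(** Centring costs nothing by [balanced].  The error terms of the two samples are
    absorbed by [normalised], leaving a bound that tends to 0 with the weights. *)
Lemma Rint_weighted_sum_cos f C : bmf f -> (forall x, `|f x| <= C) ->
  `|\int[Pnm]_z cos (weighted_sum f z) - expR (- (var f / 2))| <=
  (`|s| + `|r|) * (2 * C) ^+ 3 + (s ^+ 2 + r ^+ 2) * (2 * C) ^+ 4 *+ 2.
Proof.
move=> bf fC; rewrite var_centred//; set c := \int[P]_y f y.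
have C0 : 0 <= C by exact: le_trans (normr_ge0 _) (fC point).
have bg : bmf (fun x => f x - c) by apply: bmfB => //; exact: bmf_cst.
have gD x : `|f x - c| <= 2 * C.
  rewrite mulr_natl mulr2n (le_trans (ler_normB _ _))// lerD//.
  rewrite -[leRHS]mulr1 -(_ : fine (P setT) = 1); last by rewrite probability_setT.
  exact: norm_Rint_le.
have g0 : \int[P]_x (f x - c) = 0.
  by rewrite RintB ?prob_Rint_cst ?subrr//; exact: bmf_cst.
have := Rint_cos_two_samples (bmf_measurable bg) gD g0 n m s r.
rewrite normalised mul1r.
under eq_Rintegral do rewrite -/(weighted_sum (fun x => f x - c) _) weighted_sum_shift.
move/le_trans; apply.
set B := 2 * C; have B0 : 0 <= B by rewrite mulr_ge0.
have h (k : nat) (a : R) : k%:R * a ^+ 2 <= 1 ->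
    k%:R * ((`|a| * B) ^+ 3 + (a * B) ^+ 4 *+ 2) <=
    `|a| * B ^+ 3 + a ^+ 2 * B ^+ 4 *+ 2.
  move=> ka.
  have -> : k%:R * ((`|a| * B) ^+ 3 + (a * B) ^+ 4 *+ 2) =
      k%:R * a ^+ 2 * (`|a| * B ^+ 3 + a ^+ 2 * B ^+ 4 *+ 2).
    have -> : (`|a| * B) ^+ 3 = `|a| * `|a| ^+ 2 * B ^+ 3 by ring.
    by rewrite real_normK ?num_real//; ring.
  rewrite ler_piMl//; apply: addr_ge0.
    by apply: mulr_ge0 => //; exact: exprn_ge0.
  by apply: mulrn_wge0; apply: mulr_ge0; [exact: sqr_ge0|exact: exprn_ge0].
have sn : n%:R * s ^+ 2 <= 1 by rewrite -[leRHS]normalised lerDl mulr_ge0 ?sqr_ge0.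
have rm : m%:R * r ^+ 2 <= 1 by rewrite -[leRHS]normalised lerDr mulr_ge0 ?sqr_ge0.
apply: le_trans (lerD (h _ _ sn) (h _ _ rm)) _.
by rewrite le_eqVlt; apply/orP; left; apply/eqP; ring.
Qed.

End two_weighted_samples.
End variance.

(** * Bounded random elements of the Hilbert space *)

Section feature_map.
Context (R : realType) dE (E : measurableType dE) dT (T : measurableType dT).
Variable mu : {finite_measure set T -> \bar R}.
Variable Phi : E -> T -> R.
Hypothesis bPhi : bmf (fun z : E * T => Phi z.1 z.2).

Definition pairing (h : T -> R) (x : E) := \int[mu]_t (Phi x t * h t).

Lemma bmf_Phi_l x : bmf (Phi x).
Proof. exact: (bmf_xsection bPhi x). Qed.

Lemma bmf_Phi_r t : bmf (fun x => Phi x t).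
Proof. exact: (bmf_ysection bPhi t). Qed.

Lemma bmf_pairing h : bmf h -> bmf (pairing h).
Proof.
move=> bh; apply: (bmf_Rint_l mu (f := fun z => Phi z.1 z.2 * h z.2)).
by apply: bmfM => //; exact: bmf_comp bh.
Qed.

Definition cov_kernel (P : probability E R) (s t : T) :=
  cov P (fun x => Phi x s) (fun x => Phi x t).

Let bPhi2 : bmf (fun z : E * T * T => Phi z.1.1 z.1.2 * Phi z.1.1 z.2).
Proof.
apply: bmfM.
  by apply: (bmf_comp (h := fst)) bPhi.
apply: (bmf_comp (h := fun z : E * T * T => (z.1.1, z.2))) bPhi.
apply: measurable_fun_pair => //.
exact: (measurableT_comp (measurable_fst (T1 := E) (T2 := T))).
Qed.

Lemma bmf_mean (P : probability E R) : bmf (fun t => \int[P]_x Phi x t).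
Proof. exact: (bmf_Rint_r P bPhi). Qed.

Let bmf_second (P : probability E R) :
  bmf (fun z : T * T => \int[P]_x (Phi x z.1 * Phi x z.2)).
Proof.
apply: (bmf_Rint_r P (f := fun z : E * (T * T) => Phi z.1 z.2.1 * Phi z.1 z.2.2)).
apply: (bmf_comp (h := fun z : E * (T * T) => (z.1, z.2.1, z.2.2))) bPhi2.
have m21 : measurable_fun setT (fun z : E * (T * T) => z.2.1).
  exact: (measurableT_comp (measurable_fst (T1 := T) (T2 := T))).
have m22 : measurable_fun setT (fun z : E * (T * T) => z.2.2).
  exact: (measurableT_comp (measurable_snd (T1 := T) (T2 := T))).
by do 2 apply: measurable_fun_pair => //.
Qed.

Lemma bmf_cov_kernel P : bmf (fun z : T * T => cov_kernel P z.1 z.2).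
Proof.
apply: bmfB; first exact: bmf_second.
have bm := bmf_mean P.
by apply: bmfM; [exact: (bmf_comp (h := fst) _ bm)|exact: (bmf_comp (h := snd) _ bm)].
Qed.

Lemma mean_pairing (P : probability E R) h : bmf h ->
  \int[P]_x pairing h x = \int[mu]_t (\int[P]_x Phi x t * h t).
Proof.
move=> bh; rewrite /pairing.
rewrite (Rint_swap P mu (f := fun z => Phi z.1 z.2 * h z.2)).
  apply: eq_Rintegral => t _; under eq_Rintegral do rewrite /= mulrC.
  rewrite RintZ; last exact: bmf_Phi_r.
  exact: mulrC.
by apply: bmfM => //; exact: bmf_comp bh.
Qed.

(** Fubini's theorem for the kernel and for the mean function. *)
Lemma var_pairing (P : probability E R) h : bmf h ->
  \int[mu]_s \int[mu]_t (cov_kernel P s t * h s * h t) = var P (pairing h).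
Proof.
move=> bh.
have bm := bmf_mean P; set m := fun t => \int[P]_x Phi x t in bm *.
have bmh : bmf (fun t => m t * h t) by exact: bmfM.
have bh1 : bmf (fun z : T * T => h z.1) by exact: (bmf_comp (h := fst)).
have bh2 : bmf (fun z : T * T => h z.2) by exact: (bmf_comp (h := snd)).
pose F (z : T * T) := \int[P]_x (Phi x z.1 * Phi x z.2) * h z.1 * h z.2.
have bF : bmf F.
  by apply: bmfM bh2; apply: bmfM bh1; exact: bmf_second.
transitivity (\int[mu]_s (\int[mu]_t F (s, t) - m s * h s * \int[mu]_t (m t * h t))).
  apply: eq_Rintegral => s _.
  rewrite -RintZ// -RintB; [|exact: (bmf_xsection bF s)|exact: bmfZ].
  by apply: eq_Rintegral => t _; rewrite /F /cov_kernel /cov -/(m s) -/(m t)/=; ring.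
rewrite RintB; [|exact: (bmf_Rint_l mu bF)|exact: bmfM bmh (bmf_cst _ _)].
rewrite /var mean_pairing// -/m; congr (_ - _); last first.
  under eq_Rintegral do rewrite mulrC.
  by rewrite RintZ// expr2.
pose G (z : E * T * T) := Phi z.1.1 z.1.2 * Phi z.1.1 z.2 * h z.1.2 * h z.2.
have bG : bmf G.
  apply: bmfM; last exact: bmf_comp bh.
  apply: bmfM => //; apply: bmf_comp bh.
  by apply: (measurableT_comp (measurable_snd (T1 := E) (T2 := T))).
have bG1 := bmf_Rint_l mu bG.
transitivity (\int[mu]_s \int[P]_x \int[mu]_t G (x, s, t)).
  apply: eq_Rintegral => s _.
  have bGs : bmf (fun z : E * T => G (z.1, s, z.2)).
    apply: (bmf_comp (h := fun z : E * T => (z.1, s, z.2))) bG.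
    apply: measurable_fun_pair => //; apply: measurable_fun_pair => //.
  rewrite (Rint_swap P mu bGs); apply: eq_Rintegral => t _.
  rewrite /F /G/= -mulrA mulrC -RintZ; last first.
    by apply: bmfM; exact: bmf_Phi_r.
  by apply: eq_Rintegral => x _; ring.
rewrite -(Rint_swap P mu bG1); apply: eq_Rintegral => x _.
have bP := bmf_Phi_l x.
transitivity (\int[mu]_s (pairing h x * (Phi x s * h s))).
  apply: eq_Rintegral => s _; rewrite /pairing mulrC -RintZ; last exact: bmfM.
  by apply: eq_Rintegral => t _; rewrite /G/=; ring.
by rewrite RintZ ?expr2//; exact: bmfM.
Qed.

Lemma mean_sqnorm_var (P : probability E R) :
  \int[mu]_t var P (fun x => Phi x t) =
  \int[P]_x \int[mu]_t (Phi x t ^+ 2) - \int[mu]_t ((\int[P]_x Phi x t) ^+ 2).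
Proof.
have b2 : bmf (fun z : E * T => Phi z.1 z.2 ^+ 2) by exact: bmfX.
rewrite RintB; [|exact: (bmf_Rint_r P b2)|by apply: bmfX; exact: bmf_mean].
by rewrite (Rint_swap P mu b2).
Qed.

Section partition.
Variable A : nat -> set T.
Hypothesis mA : forall j, measurable (A j).
Let b1 N i : bmf (\1_(cell A N i) : T -> R).
Proof. by apply: bmf_indic; exact: measurable_cell. Qed.

Definition cell_pairing N i := pairing (\1_(cell A N i)).

Lemma bmf_cell_pairing N i : bmf (cell_pairing N i).
Proof. exact: bmf_pairing. Qed.

Lemma cell_int_mean (P : probability E R) N i :
  cell_int mu A N (fun t => \int[P]_x Phi x t) i = \int[P]_x cell_pairing N i x.
Proof. by rewrite mean_pairing. Qed.

Lemma pairing_step N (a : nat -> R) x :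
  pairing (fun t => a (cell_code A N t)) x =
  \sum_(i < 2 ^ N) a i * cell_pairing N i x.
Proof. by rewrite /pairing int_mul_step//; apply: l2_bmf; exact: bmf_Phi_l. Qed.

(** The squared distance of [Phi x] to the step functions of level [N]. *)
Definition residual N x :=
  \int[mu]_t (Phi x t ^+ 2) - proj_sqnorm mu A N (Phi x).

Let bmf_proj N : bmf (fun x => proj_sqnorm mu A N (Phi x)).
Proof.
apply: bmf_sum => i; apply: bmfM (bmf_cst _ _); apply: bmfX.
exact: bmf_cell_pairing.
Qed.

Let bmf_sqn : bmf (fun x => \int[mu]_t (Phi x t ^+ 2)).
Proof. by apply: (bmf_Rint_l mu (f := fun z => Phi z.1 z.2 ^+ 2)); exact: bmfX. Qed.

Lemma bmf_residual N : bmf (residual N).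
Proof. by apply: bmfB. Qed.

(** The left-hand side is the total variance of [Phi] outside the step functions
    of level [N].  It is at most the second moment, because the difference of the
    two sides is the squared distance of the mean function to these step
    functions. *)
Lemma residual_mean (P : probability E R) N :
  \int[mu]_t var P (fun x => Phi x t) -
  \sum_(i < 2 ^ N) var P (cell_pairing N i) / cell_mass mu A N i <=
  \int[P]_x residual N x.
Proof.
set m := fun t => \int[P]_x Phi x t.
have bm : bmf m by exact: bmf_mean.
have lm : l2 mu m by exact: l2_bmf.
rewrite mean_sqnorm_var [leRHS]RintB//.
have -> : \sum_(i < 2 ^ N) var P (cell_pairing N i) / cell_mass mu A N i =
    \int[P]_x proj_sqnorm mu A N (Phi x) - proj_sqnorm mu A N m.
  have bc i : bmf (fun x => cell_pairing N i x ^+ 2 / cell_mass mu A N i).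
    by apply: bmfM (bmf_cst _ _); apply: bmfX; exact: bmf_cell_pairing.
  rewrite /proj_sqnorm Rint_sum; last by move=> i; exact: bc.
  rewrite -sumrB; apply: eq_bigr => i _.
  rewrite cell_int_mean /var mulrBl; congr (_ - _).
  under [RHS]eq_Rintegral do rewrite mulrC.
  rewrite RintZ; last by apply: bmfX; exact: bmf_cell_pairing.
  exact: mulrC.
have := proj_sqnorm_le mA N lm; rewrite -/m.
by lra.
Qed.

Hypothesis genA : forall B, measurable B -> <<s range A >> B.

(** Pointwise convergence of the projections, dominated by the bounded squared
    norm of [Phi x]. *)
Lemma residual_cvg0 (P : probability E R) :
  \int[P]_x residual N x @[N --> \oo] --> (0 : R).
Proof.
rewrite -[X in _ --> X](prob_Rint_cst P).
have [C C0 hC] := bmf_ge0_bound bmf_sqn.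
apply: (bounded_cvg_Rint (C := C)).
- by move=> N; case: (bmf_residual N).
- move=> N x; have lx : l2 mu (Phi x) by apply: l2_bmf; exact: bmf_Phi_l.
  have h := proj_sqnorm_le mA N lx.
  rewrite ger0_norm /residual ?subr_ge0//; apply: le_trans (hC x).
  rewrite ger0_norm; first by rewrite gerBl proj_sqnorm_ge0.
  by apply: Rintegral_ge0 => t _; exact: sqr_ge0.
- move=> x; rewrite -(subrr (\int[mu]_t (Phi x t ^+ 2))).
  apply: cvgB; first exact: cvg_cst.
  by apply: proj_sqnorm_cvg => //; apply: l2_bmf; exact: bmf_Phi_l.
Qed.

End partition.
End feature_map.

(** * Resampling from a convergent sequence of laws *)

Section resampling_limit.
Context (R : realType) dE (E : measurableType dE) dT (T : measurableType dT).
Variable mu : {finite_measure set T -> \bar R}.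
Variable Phi : E -> T -> R.
Hypothesis bPhi : bmf (fun z : E * T => Phi z.1 z.2).
Variable A : nat -> set T.
Hypothesis mA : forall j, measurable (A j).
Hypothesis genA : forall B, measurable B -> <<s range A >> B.

Variables (H : nat -> probability E R) (L : probability E R).
Variables (n m : nat -> nat) (s r : nat -> R).
Hypothesis balanced : forall k, (n k)%:R * s k + (m k)%:R * r k = 0.
Hypothesis normalised : forall k, (n k)%:R * s k ^+ 2 + (m k)%:R * r k ^+ 2 = 1.
Hypotheses (s0 : s @ \oo --> (0 : R)) (r0 : r @ \oo --> (0 : R)).

Notation psi := (cell_pairing mu Phi A).

(** Countably many integrals suffice: they determine the limits of all variances
    of pairings with step functions, and of the mean residuals. *)
Hypothesis cvg_mean : forall N i,
  \int[H k]_x psi N i x @[k --> \oo] --> \int[L]_x psi N i x.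
Hypothesis cvg_mean2 : forall N i j,
  \int[H k]_x (psi N i x * psi N j x) @[k --> \oo] -->
  \int[L]_x (psi N i x * psi N j x).
Hypothesis cvg_residual : forall N,
  \int[H k]_x residual mu Phi A N x @[k --> \oo] -->
  \int[L]_x residual mu Phi A N x.

Variables (dO : measure_display) (Omega : measurableType dO).
Variables (P : probability Omega R) (W : {RV P >-> L2 mu}).
Hypothesis gW : centred_gaussian W (cov_kernel Phi L).

Let Q k : probability _ R := (iid_law (H k) (n k) \x iid_law (H k) (m k))%E.

Let smp k := ((n k).-tuple E * (m k).-tuple E)%type.

(** The random function whose squared norm [V] is the statistic. *)
Let Z k (z : smp k) (t : T) : R :=
  weighted_sum (s k) (r k) (fun x => Phi x t) z.

Let V k (z : smp k) : R := \int[mu]_t (Z z t ^+ 2).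

Let bZ k : bmf (fun p : smp k * T => Z p.1 p.2).
Proof.
have b f : measurable_fun setT f -> bmf (fun p : smp k * T => Phi (f p) p.2).
  move=> mf; apply: (bmf_comp (h := fun p : smp k * T => (f p, p.2))) bPhi.
  exact: measurable_fun_pair.
apply: bmfD; apply: bmfZ; apply: bmf_sum => i; apply: b.
  apply: (measurableT_comp (measurable_tnth i)).
  exact: (measurableT_comp (measurable_fst (T1 := (n k).-tuple E) (T2 := (m k).-tuple E))).
apply: (measurableT_comp (measurable_tnth i)).
exact: (measurableT_comp (measurable_snd (T1 := (n k).-tuple E) (T2 := (m k).-tuple E))).
Qed.

Let bV k : bmf (@V k).
Proof. exact: (bmf_Rint_l mu (bmfX 2 (@bZ k))). Qed.

Let lZ k (z : smp k) : l2 mu (Z z).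
Proof. by apply: l2_bmf; exact: (bmf_xsection (@bZ k) z). Qed.

Let V_ge0 k (z : smp k) : 0 <= V z.
Proof. by apply: Rintegral_ge0 => t _; exact: sqr_ge0. Qed.

Let int_Z k (z : smp k) h : bmf h ->
  \int[mu]_t (Z z t * h t) = weighted_sum (s k) (r k) (pairing mu Phi h) z.
Proof.
move=> bh; rewrite /Z /weighted_sum.
have bp x : bmf (fun t => Phi x t * h t) by apply: bmfM => //; exact: bmf_Phi_l.
transitivity (\int[mu]_t (s k * \sum_(i < n k) Phi (tnth z.1 i) t * h t +
    r k * \sum_(i < m k) Phi (tnth z.2 i) t * h t)).
  apply: eq_Rintegral => t _; rewrite mulrDl -!mulrA !mulr_suml.
  by [].
rewrite RintD; [|by apply: bmfZ; exact: bmf_sum..].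
by rewrite !RintZ ?Rint_sum//; exact: bmf_sum.
Qed.

Let cell_int_Z k (z : smp k) N i :
  cell_int mu A N (Z z) i = weighted_sum (s k) (r k) (psi N i) z.
Proof. by rewrite /cell_int int_Z//; apply: bmf_indic; exact: measurable_cell. Qed.

Let bmf_psi N i : bmf (psi N i).
Proof. exact: bmf_cell_pairing. Qed.

Let proj_Z k N (z : smp k) := proj_sqnorm mu A N (Z z).

Let proj_W N w := proj_sqnorm mu A N (W w : T -> R).

Let bproj_Z k N : bmf (@proj_Z k N).
Proof.
rewrite /proj_Z /proj_sqnorm; under eq_fun do under eq_bigr do rewrite cell_int_Z.
apply: bmf_sum => i; apply: bmfM (bmf_cst _ _); apply: bmfX.
exact: bmf_weighted_sum.
Qed.

Let b1 N i : bmf (\1_(cell A N i) : T -> R).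
Proof. by apply: bmf_indic; exact: measurable_cell. Qed.

Let mcell_W N i : measurable_fun setT (fun w => cell_int mu A N (W w) i).
Proof. by apply: measurable_gaussian_inner; exact: l2_bmf. Qed.

Let mproj_W N : measurable_fun setT (proj_W N).
Proof.
apply: measurable_sum => i; apply: measurable_funM => //.
by apply: measurable_funX; exact: mcell_W.
Qed.

(** The central limit theorem for a fixed bounded function. *)
Let weighted_cos_cvg f C : bmf f -> (forall x, `|f x| <= C) ->
  var (H k) f @[k --> \oo] --> var L f ->
  \int[Q k]_z cos (weighted_sum (s k) (r k) f z) @[k --> \oo] -->
  expR (- (var L f / 2)).
Proof.
move=> bf fC cv.
pose err k := (`|s k| + `|r k|) * (2 * C) ^+ 3 +
  (s k ^+ 2 + r k ^+ 2) * (2 * C) ^+ 4 *+ 2.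
have err0 : err k @[k --> \oo] --> (0 : R).
  have ns : `|s k| @[k --> \oo] --> (0 : R) by rewrite -(normr0 R); exact: cvg_norm.
  have nr : `|r k| @[k --> \oo] --> (0 : R) by rewrite -(normr0 R); exact: cvg_norm.
  have s2 : s k ^+ 2 @[k --> \oo] --> (0 : R).
    by rewrite -(mulr0 0); under eq_fun do rewrite expr2; exact: cvgM.
  have r2 : r k ^+ 2 @[k --> \oo] --> (0 : R).
    by rewrite -(mulr0 0); under eq_fun do rewrite expr2; exact: cvgM.
  have -> : 0 = (0 + 0) * (2 * C) ^+ 3 + (0 + 0) * (2 * C) ^+ 4 *+ 2 :> R.
    by rewrite !addr0 !mul0r mul0rn addr0.
  apply: cvgD; first by apply: cvgMl; exact: cvgD.
  by apply: cvgMn; apply: cvgMl; exact: cvgD.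
have h k : `|\int[Q k]_z cos (weighted_sum (s k) (r k) f z) -
    expR (- (var (H k) f / 2))| <= err k.
  exact: Rint_weighted_sum_cos.
have e1 : expR (- (var (H k) f / 2)) @[k --> \oo] --> expR (- (var L f / 2)).
  apply: (@continuous_cvg _ _ _ _ _ _ (@expR R)); first exact: continuous_expR.
  by apply: cvgN; exact: cvgMl.
pose a k := \int[Q k]_z cos (weighted_sum (s k) (r k) f z).
pose b k := expR (- (var (H k) f / 2)).
have d0 : a k - b k @[k --> \oo] --> (0 : R).
  apply: norm_cvg0; apply: (squeeze_cvgr _ (cvg_cst 0) err0).
  by near=> k; rewrite normr_ge0/= h.
have d1 : (a k - b k) + b k @[k --> \oo] --> 0 + expR (- (var L f / 2)).
  exact: cvgD d0 e1.
rewrite add0r (_ : (fun k => _) = a) in d1; first exact: d1.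
by apply/funext => k; rewrite subrK.
Unshelve. all: end_near. Qed.

Let var_step_cvg N (a : nat -> R) :
  var (H k) (fun x => \sum_(i < 2 ^ N) a i * psi N i x) @[k --> \oo] -->
  var L (fun x => \sum_(i < 2 ^ N) a i * psi N i x).
Proof.
rewrite var_lin//; under eq_fun do rewrite var_lin//.
apply: cvg_sum_seq => i; apply: cvg_sum_seq => j.
apply: cvgMr; apply: cvgB; first exact: cvg_mean2.
by apply: cvgM; exact: cvg_mean.
Qed.

Section level.
Variables (N : nat) (lam : R).
Hypothesis lam0 : 0 <= lam.

(** With these scale factors |b|^2 / 2 is lam times [proj_sqnorm], where
    b_i = kap i * cell_int i is the i-th coefficient of the Gaussian form. *)
Let kap i : R := Num.sqrt (2 * lam / cell_mass mu A N i).

Let coef (g : (2 ^ N).-tuple R) (i : nat) : R := kap i * nth 0 g i.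

Let gauss := iid_law (normal_law (1 : R)) (2 ^ N).

Let gauss_proj (u : T -> R) : expR (- (lam * proj_sqnorm mu A N u)) =
  \int[gauss]_g cos (\sum_(i < 2 ^ N) coef g i * cell_int mu A N u i).
Proof.
have := @Rint_cos_gauss_vector R (2 ^ N) (fun i => kap i * cell_int mu A N u i) 0.
rewrite cos0 mul1r => e; apply/esym; apply: etrans (etrans e _).
  apply: eq_Rintegral => g _; rewrite add0r; congr cos; apply: eq_bigr => i _.
  by rewrite /coef (tnth_nth 0); ring.
congr (expR (- _)); rewrite /proj_sqnorm mulr_sumr; apply: eq_bigr => i _.
rewrite exprMn sqr_sqrtr; first by move: (cell_mass mu A N i)^-1 => w; field.
by rewrite divr_ge0 ?mulr_ge0// cell_mass_ge0.
Qed.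

Let step_sum_W g w : \sum_(i < 2 ^ N) coef g i * cell_int mu A N (W w) i =
  \int[mu]_t (W w t * coef g (cell_code A N t)).
Proof. by rewrite int_mul_step//; exact: L2_l2. Qed.

Let mcoef i : measurable_fun setT (fun g : (2 ^ N).-tuple R => coef g (i : 'I_(2 ^ N))).
Proof.
apply: measurable_funM => //.
have := measurable_tnth i (T := R).
by congr measurable_fun; apply/funext => g; rewrite (tnth_nth 0).
Qed.

(** Both sides are Gaussian averages of expectations of cosines: for fixed
    coefficients [g] the linear form is the pairing with the step function
    [coef g], so the left one converges to exp(- Var / 2), which is the right
    one. *)
Lemma laplace_proj_cvg :
  \int[Q k]_z expR (- (lam * proj_Z N z)) @[k --> \oo] -->
  \int[P]_w expR (- (lam * proj_W N w)).
Proof.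
pose f g x := \sum_(i < 2 ^ N) coef g i * psi N i x.
have bf g : bmf (f g) by apply: bmf_sum => i; exact: bmfZ.
have lin k z g : \sum_(i < 2 ^ N) coef g i * cell_int mu A N (@Z k z) i =
    weighted_sum (s k) (r k) (f g) z.
  rewrite weighted_sum_lin; apply: eq_bigr => i _.
  by rewrite cell_int_Z.
have bjoint dO' (Om : measurableType dO') (c : 'I_(2 ^ N) -> Om -> R) :
    (forall i, measurable_fun setT (c i)) ->
    bmf (fun p : Om * (2 ^ N).-tuple R => cos (\sum_(i < 2 ^ N) coef p.2 i * c i p.1)).
  move=> mc; apply: bmf_cos; apply: measurable_sum => i; apply: measurable_funM.
    exact: (measurableT_comp (mcoef i)).
  exact: (measurableT_comp (mc i)).
have bk k : bmf (fun p : smp k * (2 ^ N).-tuple R =>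
    cos (weighted_sum (s k) (r k) (f p.2) p.1)).
  have := bjoint _ _ (fun i z => cell_int mu A N (@Z k z) i).
  rewrite (_ : (fun p => cos _) = (fun p : smp k * (2 ^ N).-tuple R =>
    cos (weighted_sum (s k) (r k) (f p.2) p.1))); last first.
    by apply/funext => p; rewrite lin.
  apply => i; under eq_fun do rewrite cell_int_Z.
  by apply: bmf_measurable; exact: bmf_weighted_sum.
have bW := bjoint _ _ (fun i w => cell_int mu A N (W w) i) (mcell_W N).
have lhs k : \int[Q k]_z expR (- (lam * proj_Z N z)) =
    \int[gauss]_g \int[Q k]_z cos (weighted_sum (s k) (r k) (f g) z).
  rewrite -(Rint_swap (Q k) gauss (bk k)); apply: eq_Rintegral => z _.
  rewrite gauss_proj; apply: eq_Rintegral => g _.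
  by rewrite lin.
have rhs : \int[P]_w expR (- (lam * proj_W N w)) =
    \int[gauss]_g expR (- (var L (f g) / 2)).
  transitivity (\int[P]_w \int[gauss]_g
      cos (\sum_(i < 2 ^ N) coef g i * cell_int mu A N (W w) i)).
    by apply: eq_Rintegral => w _; rewrite gauss_proj.
  rewrite (Rint_swap P gauss bW); apply: eq_Rintegral => g _.
  under eq_Rintegral do rewrite step_sum_W.
  have bh := bmf_step mA (coef g) N.
  apply: (gaussian_cosine gW bh (bmf_cov_kernel bPhi L)); last exact: var_ge0.
  rewrite var_pairing//; congr (var L _); apply/funext => x.
  by rewrite pairing_step.
rewrite rhs; under eq_fun do rewrite lhs.
apply: (bounded_cvg_Rint (C := 1)).
- by move=> k; case: (bmf_Rint_r (Q k) (bk k)).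
- move=> k g; rewrite -[leRHS]mulr1 -[X in _ <= _ * X](_ : fine (Q k setT) = 1).
    apply: norm_Rint_le => [|z]; first exact: (bmf_ysection (bk k) g).
    by rewrite ler_norml cos_geN1 cos_le1.
  by rewrite [X in fine X]probability_setT.
- move=> g; have [C C0 hC] := bmf_ge0_bound (bf g).
  exact: (weighted_cos_cvg (bf g) hC (@var_step_cvg N (coef g))).
Qed.

End level.

Let mean_V k : \int[Q k]_z V z = \int[mu]_t var (H k) (fun x => Phi x t).
Proof.
rewrite /V (Rint_swap (Q k) mu (bmfX 2 (@bZ k))).
apply: eq_Rintegral => t _.
rewrite -(Rint_weighted_sum_sqr (H k) (balanced k) (normalised k))//.
exact: bmf_Phi_r.
Qed.

(** The weighted sum has the same variances as one resampled point. *)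
Let mean_residual_Z k N :
  \int[Q k]_z (V z - proj_Z N z) <= \int[H k]_x residual mu Phi A N x.
Proof.
apply: le_trans _ (residual_mean mu bPhi mA (H k) N).
rewrite RintB; [|exact: bV|exact: bproj_Z].
rewrite mean_V.
have -> // : \int[Q k]_z proj_Z N z =
    \sum_(i < 2 ^ N) var (H k) (psi N i) / cell_mass mu A N i.
rewrite /proj_Z /proj_sqnorm.
have bw (i : 'I_(2 ^ N)) : bmf (fun z : smp k =>
    weighted_sum (s k) (r k) (psi N i) z ^+ 2 / cell_mass mu A N i).
  by apply: bmfM (bmf_cst _ _); apply: bmfX; exact: bmf_weighted_sum.
under eq_Rintegral do under eq_bigr do rewrite cell_int_Z.
rewrite (Rint_sum (Q k) (index_enum _) bw); apply: eq_bigr => i _.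
under eq_Rintegral do rewrite mulrC.
rewrite RintZ; last by apply: bmfX; exact: bmf_weighted_sum.
by rewrite mulrC Rint_weighted_sum_sqr.
Qed.

Let expRN_dist (a b : R) : 0 <= b -> b <= a -> `|expR (- b) - expR (- a)| <= a - b.
Proof.
move=> b0 ab; rewrite ger0_norm; last by rewrite subr_ge0 ler_expR lerN2.
have h1 : expR (- b) <= 1 by rewrite -expR0 ler_expR oppr_le0.
have h2 := expR_ge1Dx (b - a).
have -> : expR (- a) = expR (- b) * expR (b - a) by rewrite -expRD; congr expR; ring.
have := expR_ge0 (- b); nra.
Qed.

(** Three comparisons: W with its projection, the projections of Z with those of
    W, and Z with its projection.  The level [N] is chosen from the limit law
    only; then [k] is taken large. *)
Let laplace_cvg (lam : R) : 0 <= lam ->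
  \int[Q k]_z expR (- (lam * V z)) @[k --> \oo] -->
  \int[P]_w expR (- (lam * L2sqnorm (W w))).
Proof.
move=> lam0; apply/cvgrPdist_le => e e0.
have e40 : 0 < e / 4 by rewrite divr_gt0.
have mW N : measurable_fun setT (fun w => expR (- (lam * proj_W N w))).
  apply: measurableT_comp => //; apply: measurable_funN.
  exact: measurable_funM.
have W_cvg : \int[P]_w expR (- (lam * proj_W N w)) @[N --> \oo] -->
    \int[P]_w expR (- (lam * L2sqnorm (W w))).
  apply: (bounded_cvg_Rint (C := 1)) => // [N w|w].
    rewrite ger0_norm ?expR_ge0// -expR0 ler_expR oppr_le0 mulr_ge0//.
    exact: proj_sqnorm_ge0.
  apply: (@continuous_cvg _ _ _ _ _ _ (@expR R)); first exact: continuous_expR.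
  apply: cvgN; apply: cvgMr; rewrite L2sqnormE.
  by apply: proj_sqnorm_cvg => //; exact: L2_l2.
have res_cvg : lam * \int[L]_x residual mu Phi A N x @[N --> \oo] --> (0 : R).
  by rewrite -(mulr0 lam); apply: cvgMr; exact: residual_cvg0.
near \oo => N.
have hW : `|\int[P]_w expR (- (lam * L2sqnorm (W w))) -
    \int[P]_w expR (- (lam * proj_W N w))| <= e / 4.
  by near: N; move/cvgrPdist_le : W_cvg; exact.
have hL : lam * \int[L]_x residual mu Phi A N x <= e / 4.
  by near: N; apply: cvgr_le res_cvg _ e40.
have proj_cvg := @laplace_proj_cvg N lam lam0.
have resH : lam * \int[H k]_x residual mu Phi A N x @[k --> \oo] -->
    lam * \int[L]_x residual mu Phi A N x by apply: cvgMr; exact: cvg_residual.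
near=> k.
have hp : `|\int[P]_w expR (- (lam * proj_W N w)) -
    \int[Q k]_z expR (- (lam * proj_Z N z))| <= e / 4.
  by near: k; move/cvgrPdist_le : proj_cvg; exact.
have hH : lam * \int[H k]_x residual mu Phi A N x <= e / 4 + e / 4.
  near: k; apply: cvgr_le resH _ _.
  by rewrite (le_lt_trans hL)// ltrDl.
have hZ : `|\int[Q k]_z expR (- (lam * proj_Z N z)) -
    \int[Q k]_z expR (- (lam * V z))| <= e / 4 + e / 4.
  have b2 : bmf (fun z : smp k => expR (- (lam * proj_Z N z))).
    apply: bmf_expRN => [|z]; first by apply: bmf_measurable; exact: bmfZ.
    by rewrite mulr_ge0// proj_sqnorm_ge0.
  have b3 : bmf (fun z : smp k => expR (- (lam * V z))).
    apply: bmf_expRN => [|z]; first by apply: bmf_measurable; exact: bmfZ.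
    by rewrite mulr_ge0.
  have bd : bmf (fun z : smp k => V z - proj_Z N z) by exact: bmfB.
  apply: le_trans hH.
  apply: (@le_trans _ _ (lam * \int[Q k]_z (V z - proj_Z N z))); last first.
    by rewrite ler_wpM2l// mean_residual_Z.
  rewrite -RintB// -RintZ//; apply: le_trans (le_normr_Rintegral _ _) _ => //.
    by apply: bmf_integrable; exact: bmfB.
  apply: le_Rint; [|exact: bmfZ|].
    have [m4 [D hD]] := bmfB b2 b3; split; first exact: measurableT_comp.
    by exists D => x; rewrite normr_id.
  move=> z; rewrite mulrBr; apply: expRN_dist.
    by rewrite mulr_ge0// proj_sqnorm_ge0.
  by rewrite ler_wpM2l// proj_sqnorm_le.
move: hW hp hZ; rewrite !ler_norml => /andP[? ?] /andP[? ?] /andP[? ?].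
by apply/andP; split; lra.
Unshelve. all: end_near. Qed.

(** The means of [V] are total variances, hence bounded by the sup of |Phi x|^2:
    this is the tightness that accompanies the Laplace transforms. *)
Lemma resampling_sqnorm_cvg (f : R -> R) (C : R) : continuous f ->
  (forall x, `|f x| <= C) ->
  \int[Q k]_z f (\int[mu]_t (weighted_sum (s k) (r k) (fun x => Phi x t) z ^+ 2))
    @[k --> \oo] --> \int[P]_w f (L2sqnorm (W w)).
Proof.
move=> cf fC.
have bsq : bmf (fun x => \int[mu]_t (Phi x t ^+ 2)).
  by apply: (bmf_Rint_l mu (f := fun z => Phi z.1 z.2 ^+ 2)); exact: bmfX.
have [D D0 hD] := bmf_ge0_bound bsq.
have mN : measurable_fun setT (fun w => L2sqnorm (W w)).
  exact: (measurableT_comp (measurable_funPT (@L2sqnorm R _ T mu))).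
have N0 w : 0 <= L2sqnorm (W w) by rewrite /L2sqnorm sqr_ge0.
have tight k : \int[Q k]_z V z <= D.
  rewrite mean_V mean_sqnorm_var//.
  apply: (@le_trans _ _ (\int[H k]_x \int[mu]_t (Phi x t ^+ 2))).
    by rewrite gerBl; apply: Rintegral_ge0 => t _; exact: sqr_ge0.
  rewrite -(prob_Rint_cst (H k) D); apply: le_Rint => //; first exact: bmf_cst.
  by move=> x; apply: le_trans (hD x); exact: ler_norm.
exact: (laplace_weak_convergence bV V_ge0 mN N0 tight
  (fun j => laplace_cvg (ler0n R j)) cf fC).
Qed.

End resampling_limit.

(** * A countable generator of the Borel sets *)

Section borel_boxes.
Context (R : realType) (d : nat).

Definition rational_box (b : {ffun 'I_d -> rat * rat}) : set 'rV[R]_d :=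
  [set x | forall i, ratr (b i).1 < x 0 i < ratr (b i).2].

(** An enumeration; indices that code no box give the empty set. *)
Definition borel_generator (j : nat) : set 'rV[R]_d :=
  if choice.unpickle j is Some b then rational_box b else set0.

Lemma measurable_borel_generator j : measurable (borel_generator j).
Proof.
rewrite /borel_generator; case: (choice.unpickle j) => [b|]; last exact: measurable0.
rewrite (_ : rational_box b = \bigcap_(i in [set: 'I_d])
  ((fun x : 'rV[R]_d => x 0 i) @^-1` `]ratr (b i).1, ratr (b i).2[)).
  apply: fin_bigcap_measurable => // i _.
  rewrite -[X in measurable X]setTI.
  exact: measurable_coord.
apply/seteqP; split => [x xb i _|x xb i]; first by rewrite /= in_itv; exact: xb.
by have := xb i I; rewrite /= in_itv.
Qed.

(** An open set is the union of the countably many boxes with rational corners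
    that it contains. *)
Lemma borel_generatorP (B : set 'rV[R]_d) : measurable B ->
  <<s range borel_generator >> B.
Proof.
apply: smallest_sub; first exact: smallest_sigma_algebra.
move=> U oU.
have -> : U = \bigcup_j
    (if `[< borel_generator j `<=` U >] then borel_generator j else set0).
  apply/seteqP; split => [x Ux|x [j _]]; last by case: asboolP => // h; exact: h.
  have : nbhs x U by exact: open_nbhs_nbhs.
  move=> /nbhs_ballP[e /= e0 xeU].
  have q1 i : exists q : rat, ratr q \in `]x 0 i - e, x 0 i[.
    by apply: rat_in_itvoo; rewrite gtrBl.
  have q2 i : exists q : rat, ratr q \in `]x 0 i, x 0 i + e[.
    by apply: rat_in_itvoo; rewrite ltrDl.
  have [l hl] := choice q1; have [r hr] := choice q2.
  pose b : {ffun 'I_d -> rat * rat} := [ffun i => (l i, r i)].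
  exists (choice.pickle b) => //; rewrite /borel_generator choice.pickleK.
  case: asboolP => [_ i|[]].
    rewrite ffunE/=; have := hl i; have := hr i; rewrite !in_itv/=.
    by move=> /andP[-> _] /andP[_ ->].
  move=> y yb; apply: xeU; split => // i' i; rewrite ord1.
  have := yb i; rewrite ffunE/=; have := hl i; have := hr i; rewrite !in_itv/=.
  move=> /andP[_ h1] /andP[h2 _] /andP[h3 h4].
  by rewrite /ball/= ltr_distlC; apply/andP; split; lra.
apply: sigma_algebra_bigcup => j; case: asboolP => _; last exact: sigma_algebra0.
by apply: sub_sigma_algebra; exists j.
Qed.

End borel_boxes.

(** * Pooled samples *)

Section pooled_sample.
Context (R : realType) dE (E : measurableType dE).

Let integral_empirical (x : nat -> E) n (f : E -> R) :
  measurable_fun setT f -> (forall y, 0 <= f y) ->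
  (\int[empirical R x n]_y (f y)%:E)%E = (n%:R^-1 * \sum_(j < n) f (x j))%:E.
Proof.
move=> mf f0.
have mEf : measurable_fun setT (EFin \o f) by exact/measurable_EFinP.
have f0' y : setT y -> (0 <= (EFin \o f) y)%E by move=> _; rewrite lee_fin.
rewrite ge0_integral_mscale// ge0_integral_measure_sum//=.
rewrite EFinM -sumEFin; congr (_ * _)%E; apply: eq_bigr => j _.
by rewrite integral_dirac// diracT mul1e.
Qed.

(** Integrals against sums and multiples of measures are additive for
    nonnegative functions; adding a bound of [f] reduces to these. *)
Lemma Rint_pooled_empirical (x y : nat -> E) n m (f : E -> R) :
  (0 < n)%N -> (0 < m)%N -> bmf f ->
  \int[pooled_empirical R x y n m]_z f z =
  n%:R / (m + n)%:R * (n%:R^-1 * \sum_(j < n) f (x j)) +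
  m%:R / (m + n)%:R * (m%:R^-1 * \sum_(j < m) f (y j)).
Proof.
move=> n0 m0 bf.
have ge0 g : bmf g -> (forall z, 0 <= g z) ->
    \int[pooled_empirical R x y n m]_z g z =
    n%:R / (m + n)%:R * (n%:R^-1 * \sum_(j < n) g (x j)) +
    m%:R / (m + n)%:R * (m%:R^-1 * \sum_(j < m) g (y j)).
  move=> [mg _] g0; have mEg : measurable_fun setT (EFin \o g) by exact/measurable_EFinP.
  have g0' z : setT z -> (0 <= (EFin \o g) z)%E by move=> _; rewrite lee_fin.
  rewrite /Rintegral (eq_measure_integral (pooled_empirical_raw R x y n m)); last first.
    move=> A mA _.
    exact: (congr1 (fun h => h A) (@pooled_empiricalE R _ E x y n m n0 m0)).
  rewrite ge0_integral_measure_add// [X in fine (X + _)]ge0_integral_mscale//.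
  rewrite [X in fine (_ + X)]ge0_integral_mscale//.
  by rewrite !integral_empirical.
have [C C0 fC] := bmf_ge0_bound bf.
have bg : bmf (fun z => f z + C) by apply: bmfD => //; exact: bmf_cst.
have := ge0 _ bg; rewrite RintD//; last exact: bmf_cst.
rewrite prob_Rint_cst !big_split/= !sumr_const !card_ord => h.
apply: (@addIr _ C); rewrite h; last first.
  by move=> z; have := fC z; rewrite ler_norml => /andP[+ _]; lra.
rewrite -[C *+ n]mulr_natl -[C *+ m]mulr_natl.
have n0' : 0 < n%:R :> R by rewrite ltr0n.
have m0' : 0 < m%:R :> R by rewrite ltr0n.
rewrite natrD; move: (n%:R : R) (m%:R : R) n0' m0' => a b a0 b0.
have ab : b + a != 0 by rewrite gt_eqF// addr_gt0.
by field; rewrite ab !gt_eqF.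
Qed.

End pooled_sample.

Section ae_nat.
Context (R : realType) dO (Omega : measurableType dO).
Variable P : {measure set Omega -> \bar R}.

Lemma ae_forall_nat (Q : nat -> Omega -> Prop) :
  (forall n, {ae P, forall w, Q n w}) -> {ae P, forall w, forall n, Q n w}.
Proof.
move=> h; have := negligible_bigcup h; rewrite /almost_everywhere.
apply: negligibleS => w /= /existsNP[n nQ].
by exists n.
Qed.

End ae_nat.

(** * The statistic as a squared norm *)

Section cos_plus_sin.
Context (R : realType) (d : nat).
Variable mu : {finite_measure set 'rV[R]_d -> \bar R}.
Hypothesis mu_sym : forall A : set 'rV[R]_d, measurable A ->
  mu ((fun x : 'rV[R]_d => - x) @^-1` A) = mu A.

Let measurable_opp : measurable_fun setT (fun x : 'rV[R]_d => - x).
Proof.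
apply: (measurability (@open 'rV[R]_d)) => // _ [U oU <-].
rewrite setTI; apply: sub_sigma_algebra.
by apply: open_comp oU => x _; exact: opp_continuous.
Qed.

Lemma Rint_reflect (g : 'rV[R]_d -> R) : bmf g ->
  \int[mu]_t g (- t) = \int[mu]_t g t.
Proof.
move=> bg; have [mg _] := bg; congr fine.
have mEg : measurable_fun setT (EFin \o g) by exact/measurable_EFinP.
have ig : mu.-integrable setT ((EFin \o g) \o (fun x : 'rV[R]_d => - x)).
  by apply: (bmf_integrable mu (f := fun t => g (- t))); exact: bmf_comp bg.
have := integral_pushforward measurable_opp mEg ig measurableT.
rewrite preimage_setT => /= <-; apply: eq_measure_integral => A mA _.
by have := mu_sym mA.
Qed.

Lemma Rint_odd (g : 'rV[R]_d -> R) : bmf g -> (forall t, g (- t) = - g t) ->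
  \int[mu]_t g t = 0.
Proof.
move=> bg godd; have := Rint_reflect bg.
under eq_Rintegral do rewrite godd -mulN1r.
by rewrite RintZ//; lra.
Qed.

Lemma dotpN (t x : 'rV[R]_d) : dotp (- t) x = - dotp t x.
Proof. by rewrite /dotp -sumrN; apply: eq_bigr => i _; rewrite mxE mulNr. Qed.

Definition CSdot (x t : 'rV[R]_d) : R := CS (dotp t x).

Lemma bmf_CSdot : bmf (fun z : 'rV[R]_d * 'rV[R]_d => CSdot z.1 z.2).
Proof.
have md : measurable_fun setT (fun z : 'rV[R]_d * 'rV[R]_d => dotp z.2 z.1).
  by apply: measurable_dotp; [exact: measurable_snd|exact: measurable_fst].
by apply: bmfD; [exact: bmf_cos|exact: bmf_sin].
Qed.

Section two_samples.
Variables (n m : nat) (x : n.-tuple 'rV[R]_d) (y : m.-tuple 'rV[R]_d).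

Let diff (h : R -> R) t := n%:R^-1 * \sum_(j < n) h (dotp t (tnth x j)) -
  m%:R^-1 * \sum_(j < m) h (dotp t (tnth y j)).

Let ecfE k (z : k.-tuple 'rV[R]_d) t : ecf z t =
  ((k%:R^-1 * \sum_(j < k) cos (dotp t (tnth z j)))
   +i* (k%:R^-1 * \sum_(j < k) sin (dotp t (tnth z j))))%C.
Proof.
rewrite /ecf.
have -> : k%:R^-1 = (k%:R^-1)%:C%C :> R[i] by rewrite fmorphV/= rmorph_nat.
have -> : \sum_(j < k) expi (dotp t (tnth z j)) =
   ((\sum_(j < k) cos (dotp t (tnth z j))) +i*
    (\sum_(j < k) sin (dotp t (tnth z j))))%C.
  apply/eqP; rewrite eq_complex/= !raddf_sum/=.
  by apply/andP; split; apply/eqP; apply: eq_bigr.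
by apply/eqP; rewrite eq_complex/= !mul0r subr0 addr0 !eqxx.
Qed.

Let bdiff (h : R -> R) : (forall f : 'rV[R]_d -> R, measurable_fun setT f ->
  bmf (fun t => h (f t))) -> bmf (diff h).
Proof.
move=> bh; apply: bmfB; apply: bmfZ; apply: bmf_sum => j; apply: bh.
  by apply: measurable_dotp; [exact: measurable_id|exact: measurable_cst].
by apply: measurable_dotp; [exact: measurable_id|exact: measurable_cst].
Qed.

(** The squared modulus is the sum of the squares of the differences for cos and
    for sin, and the square of the difference for CS exceeds it by twice their
    product, which is odd in [t] and integrates to 0. *)
Lemma Tstat_CS (c : R) : c ^+ 2 = n%:R * m%:R / (n + m)%:R ->
  Tstat mu x y = \int[mu]_t (weighted_sum (c / n%:R) (- (c / m%:R))
    (fun u => CSdot u t) (x, y) ^+ 2).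
Proof.
move=> c2; have bc : bmf (diff cos) by apply: bdiff => f; exact: bmf_cos.
have bs : bmf (diff sin) by apply: bdiff => f; exact: bmf_sin.
have bcs : bmf (fun t => diff cos t * diff sin t) by exact: bmfM.
have b2 : bmf (fun t => diff cos t ^+ 2 + diff sin t ^+ 2).
  by apply: bmfD; exact: bmfX.
have cs0 : \int[mu]_t (diff cos t * diff sin t) = 0.
  apply: Rint_odd => // t; rewrite -mulrN; congr (_ * _).
    by rewrite /diff; congr (_ * _ - _ * _); apply: eq_bigr => j _; rewrite dotpN cosN.
  have sN k (z : k.-tuple 'rV[R]_d) : \sum_(j < k) sin (dotp (- t) (tnth z j)) =
      - \sum_(j < k) sin (dotp t (tnth z j)).
    by rewrite -sumrN; apply: eq_bigr => j _; rewrite dotpN sinN.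
  by rewrite /diff !sN; ring.
have -> : Tstat mu x y = c ^+ 2 * \int[mu]_t (diff cos t ^+ 2 + diff sin t ^+ 2).
  rewrite /Tstat c2; congr (_ * _); apply: eq_Rintegral => t _.
  by rewrite !ecfE /= sqr_sqrtr// addr_ge0// sqr_ge0.
transitivity (\int[mu]_t (c ^+ 2 * (diff cos t ^+ 2 + diff sin t ^+ 2) +
    2 * c ^+ 2 * (diff cos t * diff sin t))).
  rewrite [RHS]RintD; [|exact: bmfZ|exact: bmfZ].
  by rewrite !RintZ// cs0 mulr0 addr0.
apply: eq_Rintegral => t _; rewrite /weighted_sum /CSdot /CS /diff/=.
by rewrite !big_split/=; ring.
Qed.

End two_samples.
End cos_plus_sin.

Lemma covariance_cov (R : realType) dO (Omega : measurableType dO) dE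
    (E : measurableType dE) (P : probability Omega R) (X : {RV P >-> E})
    (f g : E -> R) : bmf f -> bmf g ->
  fine (covariance P (fun w => f (X w)) (fun w => g (X w))) =
  cov (distribution P X) f g.
Proof.
move=> bf bg.
have bX h : bmf h -> bmf (fun w => h (X w)) by move=> bh; exact: bmf_comp bh.
have mean h : bmf h -> fine ('E_P[fun w => h (X w)])%E = \int[distribution P X]_x h x.
  by move=> bh; rewrite Rint_distribution// unlock.
rewrite covariance.unlock !mean//.
set a := \int[_]_x f x; set b := \int[_]_x g x.
have bfa : bmf (fun x => f x - a) by apply: bmfB => //; exact: bmf_cst.
transitivity (\int[distribution P X]_x ((f x - a) * (g x - b))).
  rewrite Rint_distribution; first by rewrite unlock.
  by apply: bmfM => //; apply: bmfB => //; exact: bmf_cst.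
transitivity (\int[distribution P X]_x ((f x * g x - a * g x) + (a * b - b * f x))).
  by apply: eq_Rintegral => x _; ring.
have b1 : bmf (fun x => a * g x) by exact: bmfZ.
have b2 : bmf (fun x => b * f x) by exact: bmfZ.
have b3 : bmf (fun x => f x * g x) by exact: bmfM.
have b4 := bmf_cst E (a * b).
rewrite RintD; [|exact: bmfB|exact: bmfB].
by rewrite !RintB// prob_Rint_cst !RintZ// /cov -/a -/b; ring.
Qed.

(** * Convergence of the bootstrap law *)

Section pooled_convergence.
Context (R : realType) dE (E : measurableType dE).

Lemma cvg_nat_comp (u : nat -> R) (n_ : nat -> nat) (l : R) :
  u n @[n --> \oo] --> l -> n_ k @[k --> \oo] --> \oo ->
  u (n_ k) @[k --> \oo] --> l.
Proof. by move=> ul noo; exact: (cvg_comp _ _ noo ul). Qed.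

(** The integral is a convex combination of the two sample means, which have the
    same limit. *)
Lemma cvg_pooled_empirical (x y : nat -> E) (n_ m_ : nat -> nat) (f : E -> R)
    (l : R) : bmf f -> (forall k, (0 < n_ k)%N) -> (forall k, (0 < m_ k)%N) ->
  n_ k @[k --> \oo] --> \oo -> m_ k @[k --> \oo] --> \oo ->
  n%:R^-1 * \sum_(j < n) f (x j) @[n --> \oo] --> l ->
  n%:R^-1 * \sum_(j < n) f (y j) @[n --> \oo] --> l ->
  \int[pooled_empirical R x y (n_ k) (m_ k)]_z f z @[k --> \oo] --> l.
Proof.
move=> bf n0 m0 noo moo fx fy.
pose a k := (n_ k)%:R^-1 * \sum_(j < n_ k) f (x j).
pose b k := (m_ k)%:R^-1 * \sum_(j < m_ k) f (y j).
have ca : a k - l @[k --> \oo] --> (0 : R).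
  rewrite -(subrr l); apply: cvgB (cvg_cst _).
  exact: (cvg_nat_comp (u := fun n => n%:R^-1 * \sum_(j < n) f (x j))).
have cb : b k - l @[k --> \oo] --> (0 : R).
  rewrite -(subrr l); apply: cvgB (cvg_cst _).
  exact: (cvg_nat_comp (u := fun n => n%:R^-1 * \sum_(j < n) f (y j))).
have cab : `|a k - l| + `|b k - l| @[k --> \oo] --> (0 : R).
  by rewrite -[0]addr0; apply: cvgD; rewrite -(normr0 R); exact: cvg_norm.
apply/cvgrPdist_le => e e0.
near=> k.
have hk : `|a k - l| + `|b k - l| <= e by near: k; apply: cvgr_le cab _ e0.
rewrite Rint_pooled_empirical// -/(a k) -/(b k).
set p := _ / _; set q := _ / _.
have mn0 : 0 < (m_ k + n_ k)%:R :> R by rewrite ltr0n addn_gt0 m0.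
have pq : p + q = 1.
  by rewrite /p /q -mulrDl -natrD addnC mulfV// gt_eqF.
have p0 : 0 <= p by rewrite divr_ge0.
have q0 : 0 <= q by rewrite divr_ge0.
have -> : l - (p * a k + q * b k) = - (p * (a k - l) + q * (b k - l)).
  by rewrite -[l in LHS]mul1r -pq; ring.
rewrite normrN (le_trans (ler_normD _ _))// (le_trans _ hk)//.
rewrite normrM (ger0_norm p0) normrM (ger0_norm q0).
by rewrite lerD// ler_piMl//; lra.
Unshelve. all: end_near. Qed.

End pooled_convergence.

(** Splitting the factor n m / (n + m) of the statistic into two square roots
    gives the weights of the two samples. *)
Section weights.
Context (R : realType).
Variables n m : nat.
Hypotheses (n0 : (0 < n)%N) (m0 : (0 < m)%N).

Definition weight_scale : R := Num.sqrt (n%:R * m%:R / (n + m)%:R).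

Lemma weight_scale_sqr : weight_scale ^+ 2 = n%:R * m%:R / (n + m)%:R.
Proof. by rewrite sqr_sqrtr// divr_ge0// mulr_ge0. Qed.

Let n0' : 0 < n%:R :> R. Proof. by rewrite ltr0n. Qed.
Let m0' : 0 < m%:R :> R. Proof. by rewrite ltr0n. Qed.

Lemma weights_balanced :
  n%:R * (weight_scale / n%:R) + m%:R * (- (weight_scale / m%:R)) = 0.
Proof.
rewrite mulrN mulrCA mulfV ?gt_eqF// [m%:R * _]mulrCA mulfV ?gt_eqF//.
by rewrite subrr.
Qed.

Lemma weights_normalised :
  n%:R * (weight_scale / n%:R) ^+ 2 + m%:R * (- (weight_scale / m%:R)) ^+ 2 = 1.
Proof.
rewrite sqrrN !exprMn weight_scale_sqr natrD.
move: (n%:R : R) (m%:R : R) n0' m0' => a b a0 b0.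
have ab : a + b != 0 by rewrite gt_eqF// addr_gt0.
by field; rewrite ab !gt_eqF.
Qed.

Lemma weight_small_l : (weight_scale / n%:R) ^+ 2 <= n%:R^-1.
Proof.
have := weights_normalised.
have : 0 <= m%:R * (- (weight_scale / m%:R)) ^+ 2 by rewrite mulr_ge0// sqr_ge0.
set w := (_ / n%:R) ^+ 2 => h1 h2.
by rewrite -[leRHS]mul1r ler_pdivlMr// mulrC; lra.
Qed.

Lemma weight_small_r : (- (weight_scale / m%:R)) ^+ 2 <= m%:R^-1.
Proof.
have := weights_normalised.
have : 0 <= n%:R * (weight_scale / n%:R) ^+ 2 by rewrite mulr_ge0// sqr_ge0.
set w := (- (_ / m%:R)) ^+ 2 => h1 h2.
by rewrite -[leRHS]mul1r ler_pdivlMr// mulrC; lra.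
Qed.

End weights.

Lemma cvg0_of_sqr_le (R : realType) (s : nat -> R) (n_ : nat -> nat) :
  n_ k @[k --> \oo] --> \oo -> (forall k, (0 < n_ k)%N) ->
  (forall k, s k ^+ 2 <= (n_ k)%:R^-1) -> s @ \oo --> (0 : R).
Proof.
move=> noo n0 hs; apply/cvgr0Pnorm_le => e e0.
have c0 : ((n_ k)%:R^-1 : R) @[k --> \oo] --> (0 : R).
  apply: (cvg_nat_comp (u := fun n => n%:R^-1)) noo.
  apply/gtr0_cvgV0; last exact: cvgr_idn.
  by near=> n; rewrite ltr0n; near: n; exact: nbhs_infty_gt.
near=> k.
have hk : (n_ k)%:R^-1 <= e ^+ 2.
  by near: k; apply: cvgr_le c0 _ (exprn_gt0 2 e0).
have := le_trans (hs k) hk.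
by rewrite -(real_normK (num_real (s k))) ler_pXn2r// nnegrE// ltW.
Unshelve. all: end_near. Qed.

(** The family of events that takes the value [A] at [i] and [B] elsewhere only
    matters on the pair [i], [j]. *)
Lemma indep_pair (R : realType) dO dE (Omega : measurableType dO)
    (E : measurableType dE) (P : probability Omega R) (I : choiceType)
    (Z : I -> Omega -> E) (i j : I) (A B : set E) :
  mutually_independent P Z -> i != j -> measurable A -> measurable B ->
  P (Z i @^-1` A `&` Z j @^-1` B) = (P (Z i @^-1` A) * P (Z j @^-1` B))%E.
Proof.
move=> ind ij mA mB.
pose C k := if k == i then A else B.
have mC k : measurable (C k) by rewrite /C; case: ifP.
have := ind [fset i; j]%fset C mC.
rewrite big_fsetU1/= ?inE// big_seq_fset1 /C eqxx eq_sym (negbTE ij) => <-.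
congr (P _); apply/seteqP; split => [w [iw jw] k|w h].
  rewrite /= !inE => /orP[/eqP ->|/eqP ->]; first by rewrite eqxx.
  by rewrite eq_sym (negbTE ij).
split.
  by have := h i; rewrite /= !inE eqxx/= => /(_ isT).
by have := h j; rewrite /= !inE eqxx orbT/= eq_sym (negbTE ij) => /(_ isT).
Qed.

Theorem mainTheorem6
  (R : realType) (d : nat) (d_ge2 : (2 <= d)%N)
  (M : set 'rV[R]_d) (M_neq0 : M !=set0) (mM : measurable M)
  (mu : {finite_measure set 'rV[R]_d -> \bar R}) (mu_M : mu (~` M) = 0%E)
  (dO : measure_display) (Omega : measurableType dO) (P : probability Omega R)
  (* X 0 and Y 0 are the generic copies, X 1, X 2, ... and Y 1, Y 2, ... the
     observations *)
  (X Y : nat -> {RV P >-> 'rV[R]_d})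
  (X_M : forall i w, M (X i w)) (Y_M : forall i w, M (Y i w))
  (indep : mutually_independent P
     (fun i : nat + nat => match i with
                           | inl j => (X j : Omega -> 'rV[R]_d)
                           | inr j => (Y j : Omega -> 'rV[R]_d)
                           end))
  (X_id : forall i, same_distribution (X i) (X 0%N))
  (Y_id : forall i, same_distribution (Y i) (Y 0%N))
  (X_density : has_density mu (X 0%N)) (Y_density : has_density mu (Y 0%N))
  (M_sym : forall x, M (- x) <-> M x)
  (mu_sym : forall A : set 'rV[R]_d, measurable A ->
     mu ((fun x : 'rV[R]_d => - x) @^-1` A) = mu A)
  (XY : same_distribution (X 0%N) (Y 0%N))
  (dO' : measure_display) (Omega' : measurableType dO')
  (P' : probability Omega' R) (W : {RV P' >-> L2 mu})
  (W_gaussian : centred_gaussian W (fun s t : 'rV[R]_d =>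
     fine (covariance P (fun w => CS (dotp s (X 0%N w)))
                        (fun w => CS (dotp t (X 0%N w))))))
  (tau : R) (tau_ge0 : 0 <= tau) (tau_le1 : tau <= 1) :
  {ae P, forall w, forall n_ m_ : nat -> nat,
     n_ k @[k --> \oo] --> \oo ->
     m_ k @[k --> \oo] --> \oo ->
     (m_ k)%:R / (m_ k + n_ k)%:R @[k --> \oo] --> tau ->
     weakly_converges
       (fun k => bootstrap_law mu (fun j => X j.+1 w) (fun j => Y j.+1 w)
                   (n_ k) (m_ k))
       (sqnorm_law W)}.
Proof.
pose L : probability 'rV[R]_d R := distribution P (X 0%N).
pose A := @borel_generator R d.
have mA := @measurable_borel_generator R d.
have genA := @borel_generatorP R d.
have bPhi := @bmf_CSdot R d.
have KE : (fun s t : 'rV[R]_d =>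
     fine (covariance P (fun w => CS (dotp s (X 0%N w)))
                        (fun w => CS (dotp t (X 0%N w))))) =
    cov_kernel (@CSdot R d) L.
  apply/funext => s; apply/funext => t.
  exact: (covariance_cov (X 0%N) (bmf_Phi_r bPhi s) (bmf_Phi_r bPhi t)).
have gW : centred_gaussian W (cov_kernel (@CSdot R d) L) by rewrite -KE.
have slX (f : 'rV[R]_d -> R) : bmf f -> {ae P, forall w,
    n%:R^-1 * \sum_(j < n) f (X j.+1 w) @[n --> \oo] --> \int[L]_x f x}.
  move=> bf; rewrite Rint_distribution//.
  apply: (slln_bounded (X := fun j => X j.+1)) => // i j B C ij mB mC.
  exact: (indep_pair (i := inl i.+1) (j := inl j.+1) indep).
have slY (f : 'rV[R]_d -> R) : bmf f -> {ae P, forall w,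
    n%:R^-1 * \sum_(j < n) f (Y j.+1 w) @[n --> \oo] --> \int[L]_x f x}.
  move=> bf; rewrite Rint_distribution//.
  apply: (slln_bounded (X := fun j => Y j.+1)) => [i B mB|i j B C ij mB mC|//].
    by rewrite Y_id// XY.
  exact: (indep_pair (i := inr i.+1) (j := inr j.+1) indep).
(* countably many functions, so that one null set serves for all of them *)
pose psi := cell_pairing mu (@CSdot R d) A.
pose good (f : 'rV[R]_d -> R) w :=
  n%:R^-1 * \sum_(j < n) f (X j.+1 w) @[n --> \oo] --> \int[L]_x f x /\
  n%:R^-1 * \sum_(j < n) f (Y j.+1 w) @[n --> \oo] --> \int[L]_x f x.
have ae_good f : bmf f -> {ae P, forall w, good f w}.
  by move=> bf; apply: filterS2 (slX f bf) (slY f bf) => w.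
have bpsi N i : bmf (psi N i) by exact: bmf_cell_pairing.
have bres N : bmf (residual mu (@CSdot R d) A N) by exact: bmf_residual.
have ae1 : {ae P, forall w, forall N i, good (psi N i) w}.
  by do 2 apply: ae_forall_nat => ?; exact: ae_good.
have ae2 : {ae P, forall w, forall N i j, good (fun x => psi N i x * psi N j x) w}.
  by do 3 apply: ae_forall_nat => ?; apply: ae_good; exact: bmfM.
have ae3 : {ae P, forall w, forall N, good (residual mu (@CSdot R d) A N) w}.
  by apply: ae_forall_nat => N; exact: ae_good.
apply: filterS3 ae1 ae2 ae3 => w g1 g2 g3 n_ m_ noo moo _ f cf [C fC].
(* eventually equal sample sizes that are positive for every k *)
pose n k := maxn 1 (n_ k); pose m k := maxn 1 (m_ k).
have n0 k : (0 < n k)%N by rewrite leq_max.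
have m0 k : (0 < m k)%N by rewrite leq_max.
have nE : \forall k \near \oo, n_ k = n k.
  near=> k; apply/esym/maxn_idPr; near: k.
  exact: (noo [set i | (0 < i)%N] (nbhs_infty_gt 0)).
have mE : \forall k \near \oo, m_ k = m k.
  near=> k; apply/esym/maxn_idPr; near: k.
  exact: (moo [set i | (0 < i)%N] (nbhs_infty_gt 0)).
have {}noo : n k @[k --> \oo] --> \oo by apply: cvg_trans noo; exact: near_eq_cvg.
have {}moo : m k @[k --> \oo] --> \oo by apply: cvg_trans moo; exact: near_eq_cvg.
pose H k := pooled_empirical R (fun j => X j.+1 w) (fun j => Y j.+1 w) (n k) (m k).
have cvgH g : bmf g -> good g w ->
    \int[H k]_x g x @[k --> \oo] --> \int[L]_x g x.
  by move=> bg [gx gy]; exact: cvg_pooled_empirical.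
pose s k : R := weight_scale R (n k) (m k) / (n k)%:R.
pose r k : R := - (weight_scale R (n k) (m k) / (m k)%:R).
have s0 : s @ \oo --> (0 : R).
  by apply: (cvg0_of_sqr_le noo n0) => k; exact: (weight_small_l R (n0 k) (m0 k)).
have r0 : r @ \oo --> (0 : R).
  by apply: (cvg0_of_sqr_le moo m0) => k; exact: (weight_small_r R (n0 k) (m0 k)).
have := @resampling_sqnorm_cvg R _ _ _ _ mu (@CSdot R d) bPhi A mA genA H L n m s r
  (fun k => weights_balanced R (n0 k) (m0 k))
  (fun k => weights_normalised R (n0 k) (m0 k)) s0 r0
  (fun N i => cvgH _ (bpsi N i) (g1 N i))
  (fun N i j => cvgH _ (bmfM (bpsi N i) (bpsi N j)) (g2 N i j))
  (fun N => cvgH _ (bres N) (g3 N)) _ _ _ W gW f C cf fC.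
have bf dT (T : measurableType dT) (U : T -> R) : measurable_fun setT U ->
    bmf (fun z => f (U z)).
  by move=> mU; apply: (bmf_compr mU _ fC); exact: continuous_measurable_fun.
have bfid : bmf f by apply: (bf _ _ idfun); exact: measurable_id.
have -> : \int[sqnorm_law W]_x f x = \int[P']_w f (L2sqnorm (W w)).
  by rewrite /sqnorm_law Rint_distribution.
move=> h.
apply: cvg_trans h; apply: near_eq_cvg.
apply: filterS2 nE mE => k nk mk.
rewrite nk mk /bootstrap_law Rint_distribution//.
apply: eq_Rintegral => z _; congr f.
case: z => x y.
exact/esym/(Tstat_CS mu_sym x y (weight_scale_sqr R (n k) (m k))).
Unshelve. all: end_near. Qed.
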